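(* Let $N$ be a self-exciting Hawkes process with intensity $(\lambda_t)_{t\ge0}$ as described in the context, with jump times $T_1<T_2<\dots$ on $(0,\infty)$. Let $f_1$ be a real positive decreasing function, integrable in the neighborhood of $0$, and for each $q\ge1$ let $f_2^{(q)}:(\mathbb{R}^+)^q\to\mathbb{R}_+$ be bounded and such that $f_2^{(q)}(t_q,\dots,t_1)\neq0$ only if $t_1\in J^{(q)}=J^{(q)}(t_2,\dots,t_q)$, where $J^{(q)}$ is some interval in $\mathbb{R}^+$. Assume that $\sup_{q\ge1}|J^{(q)}|\le\overline{J}<\infty$, where $|J^{(q)}|$ is the length of $J^{(q)}$. On $\{N_s=q\}$ set $$f^{(q)}(s-T_q,T_q-T_1,\dots,T_2-T_1,T_1)=f_1(s-T_q)\,f_2^{(q)}(T_q-T_1,\dots,T_2-T_1,T_1).$$ Then, for all $\varepsilon>0$, there exists a constant $C_\varepsilon>0$ such that, for all $s\ge0$, $$\sum_{q=1}^\infty\mathbb{E}\big[f^{(q)}(s-T_q,\dots,T_2-T_1,T_1)\,\mathbf{1}_{\{N_s=q\}}\mid\lambda_0=y_0\big]\le C_\varepsilon\left(\int_0^{\overline{J}}f_1(u)\,du\right)e^{\varepsilon s},$$ where the constant $C_\varepsilon$ is uniform for $y_0$ in a compact interval of $\mathbb{R}$.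
   Context: $N$ is a one-dimensional càdlàg counting process with left-continuous predictable intensity $\lambda_t=\xi+(\lambda_0-\xi)e^{-\beta t}+\int_0^{t-}\alpha e^{-\beta(t-u)}\,dN_u$ (so $N_t-\int_0^t\lambda_s ds$ is a local martingale), where $\xi>0$ is the baseline, $\alpha\in\mathbb{R}^+$, $\beta$ is the decay parameter, $\alpha/\beta<1$, and $\lambda_0\ge\xi$. $N_s$ denotes the number of jumps on $(0,s]$.
   Formalization: The functions f_2^(q) are assumed bounded by one constant for all q (and measurable); with bounds depending arbitrarily on q the series can diverge, e.g. for a Poisson process with f_2^(q) = 1_{t_1 in [0,1]}/P(N_1=q) and s=1. *)

(* Defs.v *)
From HB Require Import structures.
From mathcomp Require Import all_boot all_order all_algebra.
From mathcomp Require Import all_classical all_reals all_analysis.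
From mathcomp Require Import measurable_realfun.
Set Implicit Arguments.
Unset Strict Implicit.
Unset Printing Implicit Defensive.
Import Order.TTheory GRing.Theory Num.Theory.
Import numFieldNormedType.Exports.
Local Open Scope classical_set_scope.
Local Open Scope ring_scope.

(* Processes are indexed by R; only their values at times [t >= 0] matter. *)

Section processes.
Context (R : realType) (d : measure_display) (T : measurableType d).
Variable P : probability T R.
Implicit Types (F : R -> set (set T)) (M : R -> T -> R).

Definition filtration F : Prop :=
  [/\ forall t, 0 <= t -> sigma_algebra setT (F t),
      forall t, 0 <= t -> F t `<=` measurable &
      forall s t, 0 <= s -> s <= t -> F s `<=` F t].

Definition measurable_wrt d' (U : measurableType d')
    (G : set (set T)) (X : T -> U) : Prop :=
  forall B, measurable B -> G (X @^-1` B).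

Definition adapted d' (U : measurableType d') F (X : R -> T -> U) : Prop :=
  forall t, 0 <= t -> measurable_wrt (F t) (X t).

(* The last clause says that [M s] is a version of E[M t | F s]. *)
Definition martingale F M : Prop :=
  [/\ adapted F M,
      forall t, 0 <= t -> P.-integrable setT (EFin \o M t) &
      forall s t, 0 <= s -> s <= t -> forall A, F s A ->
        (\int[P]_(w in A) (M t w)%:E = \int[P]_(w in A) (M s w)%:E)%E].

Definition stopping_time F (tau : T -> \bar R) : Prop :=
  (forall w, 0 <= tau w)%E /\
  forall t, 0 <= t -> F t [set w | (tau w <= t%:E)%E].

Definition stopped M (tau : T -> \bar R) : R -> T -> R :=
  fun t w => M (fine (Order.min t%:E (tau w))) w.

Definition local_martingale F M : Prop :=
  exists tau : nat -> T -> \bar R,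
    [/\ forall n, stopping_time F (tau n),
        {ae P, forall w, forall n, (tau n w <= tau n.+1 w)%E},
        {ae P, forall w, (fun n => tau n w) @ \oo --> +oo%E} &
        forall n, martingale F (stopped M (tau n))].

(* [g] is a version of [y |-> E[X | Z = y]], for a nonnegative [X]. *)
Definition cond_expectation_given (X : T -> \bar R) (Z : {RV P >-> R})
    (g : R -> \bar R) : Prop :=
  [/\ measurable_fun setT g, forall y, (0 <= g y)%E &
      forall B, measurable B ->
        (\int[distribution P Z]_(y in B) g y
          = \int[P]_(w in Z @^-1` B) X w)%E].

End processes.

Section counting.
Context (R : realType) (T : Type).
Implicit Types (N : R -> T -> nat) (w : T).

Definition counting_path (n : R -> nat) : Prop :=
  [/\ n 0 = 0%N,
      forall s t, 0 <= s -> s <= t -> (n s <= n t)%N,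
      forall t, 0 <= t -> \forall u \near t^'+, n u = n t &
      forall t, 0 < t -> \forall u \near t^'-, (n t <= (n u).+1)%N].

(* The k-th jump time, for [k >= 1]. If there are fewer than [k] jumps this is
   the junk value [inf set0]; it is only relevant on events where [k] jumps
   have occurred. *)
Definition jump_time N (k : nat) w : R :=
  inf [set t | 0 <= t /\ (k <= N t w)%N].

(* Since N is a pure jump process with unit jumps, the integral of
   [alpha * exp (- beta (t - u))] against [dN_u] over [u < t] is the sum over
   the jump times [T_k < t]; all of them have [k <= N t]. *)
Definition hawkes_intensity (xi alpha beta : R) (lambda0 : T -> R) N
    (t : R) w : R :=
  xi + (lambda0 w - xi) * expR (- beta * t) +
  \sum_(1 <= k < (N t w).+1 | jump_time N k w < t)
     alpha * expR (- beta * (t - jump_time N k w)).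

(* [(t_1, t_2, .., t_q) = (T_1, T_2 - T_1, .., T_q - T_1)], listed in
   increasing order of the index. *)
Definition jump_tuple N (q : nat) w : q.-tuple R :=
  [tuple if (i == 0 :> nat)%N then jump_time N 1 w
         else jump_time N i.+1 w - jump_time N 1 w | i < q].

End counting.

(* The intensity is left-continuous by its formula, and adapted since [N] is
   adapted and [lambda0] is [F 0]-measurable; hence it is predictable. *)
Definition hawkes_process (R : realType) (d : measure_display)
    (T : measurableType d) (P : probability T R) (xi alpha beta : R)
    (F : R -> set (set T)) (lambda0 : {RV P >-> R}) (N : R -> T -> nat) : Prop :=
  [/\ filtration F,
      adapted F N,
      measurable_wrt (F 0) lambda0 /\ (forall w, xi <= lambda0 w),
      forall w, counting_path (N ^~ w) &
      local_martingale P F (fun t w => (N t w)%:R -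
        \int[lebesgue_measure]_(u in `[0, t])
          hawkes_intensity xi alpha beta lambda0 N u w)].

Definition nonneg_tuple (R : realType) (q : nat) (t : q.-tuple R) : Prop :=
  forall i, 0 <= tnth t i.

Definition last_jump_functional (R : realType) (T : Type) (f1 : R -> R)
    (f2 : forall q : nat, q.-tuple R -> R) (N : R -> T -> nat)
    (q : nat) (s : R) (w : T) : R :=
  f1 (s - jump_time N q w) * f2 q (jump_tuple N q w) * (N s w == q)%:R.

(* Main.v *)
Require Import Defs.
From HB Require Import structures.
From mathcomp Require Import all_boot all_order all_algebra.
From mathcomp Require Import all_classical all_reals all_analysis.
From mathcomp Require Import measurable_realfun.
From mathcomp Require Import ring lra.
Import Order.TTheory GRing.Theory Num.Theory.
Import numFieldNormedType.Exports.
Local Open Scope classical_set_scope.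
Local Open Scope ring_scope.
Set Implicit Arguments.
Unset Strict Implicit.
Unset Printing Implicit Defensive.

(** Given the differences [T_i - T_1], the function [f2] confines [T_1] to an
   interval, and the law of [T_1] is smoothed by translating the whole history.
   Shifting the jump times [T_1, .., T_q] by [h >= 0] multiplies each intensity by at most
   [e^(beta h)], hence the law of the history on [{N_s = q}] is at most
   [2 e^(beta h q)] times the law of the history shifted by [h] on
   [{N_(s + h) = q, N_h = 0}]. Averaging over [h] in [0, eta], for a fixed
   history the point [T_1 - h] stays in an interval of length at most [Jbar],
   while [f1] is evaluated at [s + h - T_q]; as [f1] is decreasing this gives at
   most the integral of [f1] over [0, Jbar]. There remains
   [e^(beta eta q) P(N_(s + eta) >= q)], summable in [q] when [eta] is small
   because subcriticality provides
   [E[e^(theta N_t + kappa lambda_t)] <= e^(eps t + kappa b)]. Everything is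
   derived from the local martingale property by comparing increments over small
   steps [dl], up to errors of order [dl^2]. *)

(** The process is known only through a local martingale relative to an abstract filtration, so no
    explicit density of the jump times is at hand. The comparison of laws is therefore run in time,
    by induction on the number [k] of jumps, as an inequality for all test functions of the history.
    During a step the history survives at level [k] with the factor [1 - dl * intensity], or arrives
    from level [k - 1] with a density given by the intensity; both factors are absorbed into the
    test function. A translation affects the intensity only through its initial term: the delayed
    process has the smaller intensity, so survival costs nothing, and each arrival costs
    [expR (beta * h)]. The factor 2 pays for the absence of jumps up to [h], of conditional
    probability at least 1/2 if [4 * b * h <= 1] and [alpha * h <= 1/2]. Subcriticality is used
    once: [alpha < beta] makes [expR (kap * alpha) - 1 < kap * beta] for small [kap], and the
    exponent [theta] fills this gap. The growth rate is [kap * beta * xi], so a small [eps] is met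
    by a small [kap]. *)

(* Over [S / dl] steps an error of order [dl ^+ 2] per step is negligible; this
   replaces the use of differential inequalities. *)
Lemma quad_iter (R : realType) (Pr : R -> R -> Prop) (S C d0 : R) :
  0 <= S -> 0 < d0 -> 0 <= C ->
  (forall t dl e, 0 <= t -> 0 < dl -> dl <= d0 -> t + dl <= S -> 0 <= e ->
    Pr t e -> Pr (t + dl) (e + C * dl ^+ 2)) ->
  Pr 0 0 -> forall e, 0 < e -> exists2 e', 0 <= e' <= e & Pr S e'.
Proof.
move=> S0 d00 C0 step P0 e e0.
have [->|Sn0] := eqVneq S 0.
  by exists 0; rewrite // lexx ltW.
have Sp : 0 < S by rewrite lt_neqAle eq_sym Sn0.
(* The number of steps makes the mesh at most [d0] and the accumulated error [C * S ^+ 2 / n] at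
   most [e]. *)
have [n0 xn] : exists n0 : nat, S / d0 + C * S ^+ 2 / e < n0.+1%:R.
  by exists (Num.truncn (S / d0 + C * S ^+ 2 / e)); rewrite truncnS_gt.
set n := n0.+1 in xn.
have np : 0 < n%:R :> R by rewrite ltr0n.
have a1 : 0 <= S / d0 by rewrite divr_ge0 // ltW.
have a2 : 0 <= C * S ^+ 2 / e by rewrite divr_ge0 ?mulr_ge0 ?sqr_ge0 // ltW.
set dl := S / n%:R.
have dlp : 0 < dl by rewrite divr_gt0.
have dle : dl <= d0.
  rewrite ler_pdivrMr // mulrC -ler_pdivrMr //; lra.
have Sdl : n%:R * dl = S by rewrite mulrC divfK // gt_eqF.
have ind i : (i <= n)%N -> Pr (i%:R * dl) (i%:R * (C * dl ^+ 2)).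
  elim: i => [_|i IH lin]; first by rewrite !mul0r.
  rewrite -natr1 !mulrDl !mul1r; apply: step => //.
  - by rewrite mulr_ge0 // ltW.
  - rewrite -[X in _ + X]mul1r -mulrDl natr1 -Sdl ler_wpM2r ?ler_nat //; exact: ltW.
  - by rewrite !mulr_ge0 ?sqr_ge0.
  - exact/IH/ltnW.
exists (n%:R * (C * dl ^+ 2)); last by rewrite -[X in Pr X]Sdl; apply: ind.
rewrite !mulr_ge0 ?sqr_ge0 //=.
have -> : n%:R * (C * dl ^+ 2) = C * S ^+ 2 / n%:R.
  by rewrite /dl; field; rewrite gt_eqF.
rewrite ler_pdivrMr // (mulrC e) -ler_pdivrMr //; lra.
Qed.

(** * Integrals against nonnegative weights *)

Section extension.
Local Open Scope ereal_scope.
Context (R : realType) dV (V : measurableType dV).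
Implicit Types (h : {nnsfun V >-> R}) (phi : V -> \bar R).

Import HBNNSimple.

Section one_measure.
Context d (T : measurableType d) (m : {measure set T -> \bar R}).
Variables (Y : T -> V) (w : T -> R).
Hypothesis mY : measurable_fun setT Y.
Hypothesis mw : measurable_fun setT w.
Hypothesis w0 : forall x, (0 <= w x)%R.

Lemma integral_weighted_nnsfun h :
  \int[m]_x ((w x)%:E * (h (Y x))%:E) =
    \sum_(k \in range h)
      (k%:E * \int[m]_x ((w x)%:E * (\1_(h @^-1` [set k]) (Y x))%:E)).
Proof.
have mi k : measurable_fun setT (fun x => (\1_(h @^-1` [set k]) (Y x))%:E : \bar R).
  apply/measurable_EFinP; apply: (measurableT_comp _ mY) => //.
have mw' : measurable_fun setT (fun x => (w x)%:E) by exact/measurable_EFinP.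
have w0' x : 0 <= (w x)%:E by rewrite lee_fin.
have := @ge0_integral_fsum _ T R m setT measurableT R
  (fun k x => (k%:E * ((w x)%:E * (\1_(h @^-1` [set k]) (Y x))%:E))).
move=> /(_ _ _ (range h) (fimfunP h)) E.
transitivity (\int[m]_x (\sum_(k \in range h)
   (k%:E * ((w x)%:E * (\1_(h @^-1` [set k]) (Y x))%:E)))).
  apply: eq_integral => x _.
  rewrite fimfunE -fsumEFin // ge0_mule_fsumr; last first.
    by move=> i; rewrite EFinM; exact: nnfun_muleindic_ge0.
  by apply: eq_fsbigr => k _; rewrite EFinM muleCA.
rewrite E; last 2 first.
- by move=> k; apply: emeasurable_funM => //; exact: emeasurable_funM.
- move=> k x _; rewrite muleCA mule_ge0 // -EFinM.
  by rewrite EFinM nnfun_muleindic_ge0.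
apply: eq_fsbigr => k /[!inE] -[x _ <-].
rewrite ge0_integralZl //.
- exact: emeasurable_funM.
- by move=> y _; rewrite mule_ge0 // lee_fin.
- by rewrite lee_fin.
Qed.

Lemma cvg_integral_weighted phi (mphi : measurable_fun setT phi) :
  (forall v, 0 <= phi v) ->
  (\int[m]_x ((w x)%:E * (nnsfun_approx measurableT mphi n (Y x))%:E))
     @[n --> \oo] --> \int[m]_x ((w x)%:E * phi (Y x)).
Proof.
move=> phi0.
pose h := nnsfun_approx measurableT mphi.
have lim x : (w x)%:E * (h n (Y x))%:E @[n --> \oo] --> (w x)%:E * phi (Y x).
  by apply: cvgeZl => //; exact: cvg_nnsfun_approx.
have -> : \int[m]_x ((w x)%:E * phi (Y x)) =
   \int[m]_x limn (fun n => (w x)%:E * (h n (Y x))%:E).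
  by apply: eq_integral => x _; apply/esym/cvg_lim.
apply: cvg_monotone_convergence => //.
- move=> n; apply/measurable_EFinP => /=.
  by apply: measurable_funM => //; exact: measurableT_comp.
- by move=> n x _; rewrite lee_fin mulr_ge0.
- move=> x _ a b ab; rewrite lee_fin ler_wpM2l //.
  exact/lefP/nd_nnsfun_approx.
Qed.

End one_measure.

(* Specialised to a sub-sigma-algebra ([Y] the identity) this extends
   inequalities of conditional type from events to nonnegative weights. *)
Lemma le_integral_weighted d1 d2 (T1 : measurableType d1)
    (T2 : measurableType d2)
    (m1 : {measure set T1 -> \bar R}) (m2 : {measure set T2 -> \bar R})
    (Y1 : T1 -> V) (Y2 : T2 -> V) (w1 : T1 -> R) (w2 : T2 -> R) :
  measurable_fun setT Y1 -> measurable_fun setT Y2 ->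
  measurable_fun setT w1 -> measurable_fun setT w2 ->
  (forall x, 0 <= w1 x)%R -> (forall x, 0 <= w2 x)%R ->
  (forall B, measurable B ->
    \int[m1]_x ((w1 x)%:E * (\1_B (Y1 x))%:E) <=
    \int[m2]_x ((w2 x)%:E * (\1_B (Y2 x))%:E)) ->
  forall phi, measurable_fun setT phi -> (forall v, 0 <= phi v) ->
  \int[m1]_x ((w1 x)%:E * phi (Y1 x)) <= \int[m2]_x ((w2 x)%:E * phi (Y2 x)).
Proof.
move=> mY1 mY2 mw1 mw2 w10 w20 leB phi mphi phi0.
apply: (lee_cvg_to (cvg_integral_weighted (m := m1) mY1 mw1 w10 mphi phi0)
  (cvg_integral_weighted (m := m2) mY2 mw2 w20 mphi phi0)).
apply: nearW => n.
rewrite !integral_weighted_nnsfun //.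
apply: lee_fsum => [|k [x _ <-]]; first exact: fimfunP.
by apply: lee_wpmul2l; [rewrite lee_fin|exact: leB].
Qed.

End extension.

(** * Real expectations of bounded random variables *)

Section bounded_expectation.
Context (R : realType) d (T : measurableType d) (P : probability T R).
Implicit Types (f g : T -> R) (b : T -> bool).

(** This class is stable under the operations below and integrable for any probability, so linearity
    and monotonicity of the real-valued integral hold without further side conditions. *)
Definition bounded_mfun f :=
  measurable_fun setT f /\ exists M, forall w, `|f w| <= M.

Lemma bounded_mfun_integrable f : bounded_mfun f ->
  P.-integrable setT (EFin \o f).
Proof.
move=> [mf [M fM]]; apply: measurable_bounded_integrable => //.
  by apply: (le_lt_trans (probability_le1 P _)) => //; rewrite ltry.
exists M; split; first exact: num_real.
by move=> x Mx w _ /=; apply: le_trans (fM w) _; exact: ltW.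
Qed.

Lemma bounded_mfunD f g : bounded_mfun f -> bounded_mfun g ->
  bounded_mfun (fun w => f w + g w).
Proof.
move=> [mf [M fM]] [mg [M' gM]]; split; first exact: measurable_funD.
by exists (M + M') => w; rewrite (le_trans (ler_normD _ _)) // lerD.
Qed.

Lemma bounded_mfunB f g : bounded_mfun f -> bounded_mfun g ->
  bounded_mfun (fun w => f w - g w).
Proof.
move=> [mf [M fM]] [mg [M' gM]]; split; first exact: measurable_funB.
by exists (M + M') => w; rewrite (le_trans (ler_normB _ _)) // lerD.
Qed.

Lemma bounded_mfunM f g : bounded_mfun f -> bounded_mfun g ->
  bounded_mfun (fun w => f w * g w).
Proof.
move=> [mf [M fM]] [mg [M' gM]]; split; first exact: measurable_funM.
by exists (M * M') => w; rewrite normrM ler_pM.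
Qed.

Lemma bounded_mfun_cst (r : R) : bounded_mfun (fun=> r).
Proof. by split => //; exists `|r|. Qed.

Lemma bounded_mfunZ (r : R) f : bounded_mfun f -> bounded_mfun (fun w => r * f w).
Proof. by move=> bf; apply: bounded_mfunM => //; exact: bounded_mfun_cst. Qed.

Lemma measurable_bool_nat b : measurable [set w | b w] ->
  measurable_fun setT (fun w => (b w)%:R : R).
Proof.
move=> mb; rewrite (_ : (fun _ => _) = \1_[set w | b w]).
  exact: measurable_indic.
apply/funext => w; rewrite indicE; congr (_%:R).
by congr nat_of_bool; apply/idP/idP; rewrite inE.
Qed.

Lemma bounded_mfun_bool b : measurable [set w | b w] ->
  bounded_mfun (fun w => (b w)%:R).
Proof.
move=> mb; split; first exact: measurable_bool_nat.
by exists 1 => w; case: (b w); rewrite ?normr1 // normr0.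
Qed.

Lemma bounded_mfun_sum (I : Type) (r : seq I) (Q : pred I) (F : I -> T -> R) :
  (forall i, bounded_mfun (F i)) ->
  bounded_mfun (fun w => \sum_(i <- r | Q i) F i w).
Proof.
move=> bF; elim: r => [|i r IH].
  by under eq_fun do rewrite big_nil; exact: bounded_mfun_cst.
under eq_fun do rewrite big_cons.
by case: (Q i) => //; exact: bounded_mfunD.
Qed.

Lemma expectD f g : bounded_mfun f -> bounded_mfun g ->
  \int[P]_w (f w + g w) = \int[P]_w f w + \int[P]_w g w.
Proof. by move=> bf bg; rewrite RintegralD //; exact: bounded_mfun_integrable. Qed.

Lemma expectB f g : bounded_mfun f -> bounded_mfun g ->
  \int[P]_w (f w - g w) = \int[P]_w f w - \int[P]_w g w.
Proof. by move=> bf bg; rewrite RintegralB //; exact: bounded_mfun_integrable. Qed.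

Lemma expectZ (r : R) f : bounded_mfun f ->
  \int[P]_w (r * f w) = r * \int[P]_w f w.
Proof. by move=> bf; rewrite RintegralZl //; exact: bounded_mfun_integrable. Qed.

Lemma expect_cst (r : R) : \int[P]_w r = r.
Proof. by rewrite Rintegral_cst // [X in fine X]probability_setT mulr1. Qed.

Lemma expect_sum (I : Type) (r : seq I) (Q : pred I) (F : I -> T -> R) :
  (forall i, bounded_mfun (F i)) ->
  \int[P]_w (\sum_(i <- r | Q i) F i w) = \sum_(i <- r | Q i) \int[P]_w F i w.
Proof.
move=> bF; elim: r => [|i r IH].
  by under eq_Rintegral do rewrite big_nil; rewrite expect_cst big_nil.
under eq_Rintegral do rewrite big_cons.
rewrite big_cons; case: (Q i) => //.
by rewrite expectD ?IH //; exact: bounded_mfun_sum.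
Qed.

Lemma ler_expect f g : bounded_mfun f -> bounded_mfun g ->
  (forall w, f w <= g w) -> \int[P]_w f w <= \int[P]_w g w.
Proof.
by move=> bf bg fg; apply: le_Rintegral => //; exact: bounded_mfun_integrable.
Qed.

Lemma expect_ge0 f : (forall w, 0 <= f w) -> 0 <= \int[P]_w f w.
Proof. by move=> f0; apply: Rintegral_ge0. Qed.

Lemma expect_EFin f : bounded_mfun f ->
  (\int[P]_w (f w)%:E)%E = (\int[P]_w f w)%:E.
Proof.
by move=> bf; rewrite fineK //; apply: integrable_fin_num => //;
  exact: bounded_mfun_integrable.
Qed.

End bounded_expectation.

(** * Counting paths and the intensity *)

Section jump_times.
Context (R : realType) (T : Type) (N : R -> T -> nat) (w : T).
Hypothesis cpN : counting_path (N ^~ w).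
Local Notation tau k := (jump_time N k w).

Lemma counting_path0 : N 0 w = 0%N.
Proof. by case: cpN. Qed.

Lemma counting_path_le s t : 0 <= s -> s <= t -> (N s w <= N t w)%N.
Proof. by case: cpN => _ + _ _; apply. Qed.

Lemma jump_time_ge0 k t : 0 <= t -> (k <= N t w)%N -> 0 <= tau k.
Proof.
move=> t0 kN; apply: lb_le_inf; first by exists t.
by move=> u [].
Qed.

Lemma jump_time_le k t : 0 <= t -> (k <= N t w)%N -> tau k <= t.
Proof.
move=> t0 kN; have lb : has_lbound [set t | 0 <= t /\ (k <= N t w)%N].
  by exists 0 => u [].
by apply: (ge_inf lb).
Qed.

(** Right-continuity at an infimum: times at which the count is at least [k] are found at [tau k] or
    arbitrarily close after it, and the count is constant just after [tau k]. *)
Lemma leq_count_jump_time k t : 0 <= t -> (k <= N t w)%N -> (k <= N (tau k) w)%N.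
Proof.
move=> t0 kN; have T0 := jump_time_ge0 t0 kN.
case: cpN => _ _ /(_ _ T0) Nr _.
have [e /= e0 He] := Nr.
have [u [u0 kNu] uT] : exists2 u, [set t | 0 <= t /\ (k <= N t w)%N] u & u < tau k + e.
  have [//|u Su uT] := @inf_adherent _ [set t | 0 <= t /\ (k <= N t w)%N] e e0.
    by split; [exists t|exists 0 => u []].
  by exists u.
have Tu : tau k <= u by exact: jump_time_le.
move: Tu; rewrite le_eqVlt => /predU1P[->|Tu] //.
rewrite -(He u) //=.
by rewrite /= distrC ger0_norm ?subr_ge0 ?(ltW Tu) // ltrBlDl.
Qed.

(** Events about jump times become events about counts, which are the adapted objects. Requiring [k]
    jumps by some time [t] excludes the junk value of [jump_time]. *)
Lemma leq_countP k t u : 0 <= t -> (k <= N t w)%N -> 0 <= u ->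
  (k <= N u w)%N = (tau k <= u).
Proof.
move=> t0 kN u0; apply/idP/idP => [|Tu]; first exact: jump_time_le.
apply: leq_trans (leq_count_jump_time t0 kN) _.
by apply: counting_path_le => //; exact: jump_time_ge0 t0 kN.
Qed.

Lemma jump_time_homo k l t : 0 <= t -> (k <= l)%N -> (l <= N t w)%N ->
  tau k <= tau l.
Proof.
move=> t0 kl lN; apply: jump_time_le; first exact: jump_time_ge0 lN.
exact: leq_trans kl (leq_count_jump_time t0 lN).
Qed.

Lemma jump_time_gt0 k t : 0 <= t -> (0 < k <= N t w)%N -> 0 < tau k.
Proof.
move=> t0 /andP[k0 kN]; rewrite ltNge -(leq_countP t0 kN) //.
by rewrite counting_path0 -ltnNge.
Qed.

(** Jumps of size one enter here: just before [tau k] the count is below [k], and the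
    left-neighbourhood clause of [counting_path] allows an increase by at most one. *)
Lemma count_jump_time k t : 0 <= t -> (k <= N t w)%N -> N (tau k) w = k.
Proof.
case: k => [t0 _|k t0 kN].
  rewrite (_ : tau 0 = 0) ?counting_path0 //.
  apply/eqP; rewrite eq_le; apply/andP; split.
    exact: jump_time_le.
  exact: (@jump_time_ge0 0 0).
have T0 : 0 < tau k.+1 by apply: (@jump_time_gt0 _ t).
apply/eqP; rewrite eqn_leq (leq_count_jump_time t0 kN) andbT.
case: cpN => _ _ _ /(_ _ T0) [e /= e0 He].
set c := tau k.+1 in T0 He *.
pose u := Num.max (c / 2) (c - e / 2).
have uc : u < c by rewrite gt_max; apply/andP; split; lra.
have u0 : 0 <= u by rewrite le_max; apply/orP; left; lra.
have cu : c - e < u by rewrite lt_max; apply/orP; right; lra.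
have := He u; rewrite /= ger0_norm ?subr_ge0 ?(ltW uc) // => /(_ _ uc) H.
apply: leq_trans (H _) _; first by rewrite ltrBlDl -ltrBlDr.
by rewrite ltnS leqNgt (leq_countP t0 kN) // -ltNge.
Qed.

(** Jump number [q.+1], at time [c], is followed by an interval free of jumps, of length [e]. Once
    the mesh is below [e], a cell that begins with count [q] ends before [c] or within this
    interval. This gives the pointwise convergence needed in [double_increment_le]. *)
Lemma eventually_no_double_jump t dl q : 0 <= t -> 0 < dl -> N t w = q ->
  \forall m \near \oo, forall i, (i < m)%N ->
    N (t + i%:R * (dl / m%:R)) w = q ->
    (N (t + i.+1%:R * (dl / m%:R)) w <= q.+1)%N.
Proof.
move=> t0 dl0 Nt.
have nneg (i m : nat) : 0 <= t + i%:R * (dl / m%:R).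
  by rewrite addr_ge0 // mulr_ge0 // divr_ge0 // ltW.
have [Nle|Nlt] := leqP (N (t + dl) w) q.
  apply: nearW => -[//|m] i im _; apply: leq_trans (leqnSn q).
  apply: leq_trans Nle; apply: counting_path_le => //.
  rewrite lerD2l mulrA ler_pdivrMr ?ltr0n // mulrC ler_wpM2l ?(ltW dl0) //.
  by rewrite ler_nat.
have td0 : 0 <= t + dl by rewrite addr_ge0 // ltW.
have Nc := count_jump_time td0 Nlt.
have c0 := jump_time_ge0 td0 Nlt.
set c := tau q.+1 in Nc c0.
have [e /= e0 He] : \forall u \near c^'+, N u w = N c w.
  by case: cpN => _ _ + _; apply.
exists (Num.truncn (dl / e)).+1 => // m /= mge i im Ni.
have m0 : (0 < m)%N by exact: leq_ltn_trans im.
have mesh : dl / m%:R < e.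
  rewrite ltr_pdivrMr ?ltr0n // mulrC -ltr_pdivrMr //.
  by apply: lt_le_trans (truncnS_gt _) _; rewrite ler_nat.
have ui : t + i%:R * (dl / m%:R) < c.
  by rewrite ltNge -(leq_countP td0 Nlt) // Ni ltnn.
set v := t + i.+1%:R * (dl / m%:R).
have [vc|cv] := ltP v c.
  by apply: ltnW; rewrite ltnNge (leq_countP td0 Nlt) ?nneg // -ltNge.
move: cv; rewrite le_eqVlt => /predU1P[<-|cv]; first by rewrite Nc.
rewrite (He v) ?Nc //=.
rewrite distrC ger0_norm ?subr_ge0 ?(ltW cv) //.
move: ui; rewrite /v -natr1 mulrDl mul1r; lra.
Qed.

End jump_times.

Section intensity.
Context (R : realType) (xi alpha beta : R).
Hypothesis xi0 : 0 < xi.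
Hypothesis alpha0 : 0 <= alpha.
Hypothesis beta0 : 0 < beta.

(* [r i] is the [i]-th jump time, for [1 <= i <= k]. *)
Definition intens (k : nat) (u y : R) (r : nat -> R) : R :=
  xi + (y - xi) * expR (- beta * u) +
  \sum_(1 <= i < k.+1) alpha * expR (- beta * (u - r i)).

Lemma eq_intens k u y r r' : (forall i, (0 < i <= k)%N -> r i = r' i) ->
  intens k u y r = intens k u y r'.
Proof.
move=> rr'; congr (_ + _); apply: eq_big_nat => i /andP[i1 ik].
by rewrite rr' ?i1.
Qed.

Lemma intens_recr k u y r : intens k.+1 u y r =
  intens k u y r + alpha * expR (- beta * (u - r k.+1)).
Proof. by rewrite /intens big_nat_recr //= addrA. Qed.

(** The exponential kernel makes the intensity Markovian: without further jumps its excess over [xi]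
    decays by the factor [expR (- beta * dl)]. *)
Lemma intensD k u dl y r :
  intens k (u + dl) y r = xi + (intens k u y r - xi) * expR (- beta * dl).
Proof.
rewrite /intens.
rewrite (eq_bigr (fun i => alpha * expR (- beta * (u - r i)) * expR (- beta * dl))).
  by rewrite -mulr_suml mulrDr expRD; ring.
by move=> i _; rewrite -mulrA -expRD; congr (_ * expR _); ring.
Qed.

Lemma intens_ge k u y r : xi <= y -> xi <= intens k u y r.
Proof.
move=> xy; rewrite /intens -addrA lerDl addr_ge0 //.
  by rewrite mulr_ge0 ?subr_ge0 // expR_ge0.
by apply: sumr_ge0 => i _; rewrite mulr_ge0 ?expR_ge0.
Qed.

Lemma intens_ge0 k u y r : xi <= y -> 0 <= intens k u y r.
Proof. by move=> xy; apply: le_trans (ltW xi0) (intens_ge _ _ _ xy). Qed.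

Lemma intens_nonincr k u v y r : xi <= y -> u <= v ->
  intens k v y r <= intens k u y r.
Proof.
move=> xy uv; rewrite -(subrKC u v) intensD -lerBrDl ler_piMr //.
  by rewrite subr_ge0 intens_ge.
by rewrite expR_le1 mulNr oppr_le0 mulr_ge0 ?subr_ge0 // ltW.
Qed.

(** From [1 - expR (- x) <= x], applied to the decay of the excess over [xi]. *)
Lemma intens_lip k u v y r : xi <= y -> u <= v ->
  intens k u y r - intens k v y r <= beta * (v - u) * intens k u y r.
Proof.
move=> xy uv; rewrite -{1}(subrKC u v) intensD.
have e1 := @expR_ge1Dx R (- beta * (v - u)).
have i0 : 0 <= intens k u y r - xi by rewrite subr_ge0 intens_ge.
have := ler_wpM2l i0 e1; set z := expR _.
have b0 : 0 <= beta * (v - u) * xi.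
  by rewrite !mulr_ge0 ?subr_ge0 // ltW.
nra.
Qed.

Lemma intens_le k u y b r : 0 <= u -> xi <= y -> y <= b ->
  (forall i, (0 < i <= k)%N -> r i <= u) -> intens k u y r <= b + alpha * k%:R.
Proof.
move=> u0 xy yb ru; rewrite /intens; apply: lerD.
  have e1 : expR (- beta * u) <= 1 by rewrite expR_le1 mulNr oppr_le0 mulr_ge0 // ltW.
  have y0 : 0 <= y - xi by rewrite subr_ge0.
  have := ler_wpM2l y0 e1; lra.
apply: (@le_trans _ _ (\sum_(1 <= i < k.+1) alpha)); last first.
  by rewrite sumr_const_nat subn1 /= mulr_natr.
rewrite big_nat_cond [leRHS]big_nat_cond; apply: ler_sum => i; rewrite andbT => /andP[i1 ik].
rewrite ler_piMr // expR_le1 mulNr oppr_le0 mulr_ge0 ?(ltW beta0) //.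
by rewrite subr_ge0 ru // i1.
Qed.

(** The jump terms depend on [u - r i] only and are invariant under translation, while the initial
    term decays with the elapsed time. This direction says that delaying a history does not raise
    its intensity, so survival between jumps costs no factor. *)
Lemma intens_translate_le k u h y r : 0 <= h -> xi <= y ->
  intens k (u + h) y r <= intens k u y (fun i => r i - h).
Proof.
move=> h0 xy; rewrite /intens lerD //; last first.
  rewrite le_eqVlt; apply/orP; left; apply/eqP; apply: eq_bigr => i _.
  by congr (_ * expR _); ring.
rewrite lerD2l ler_wpM2l ?subr_ge0 // ler_expR !mulNr lerN2 ler_wpM2l ?(ltW beta0) //.
by rewrite lerDl.
Qed.

(** The factor restores exactly the decay of the initial term over a time [h] and only enlarges the
    other, nonnegative terms. It is paid once per jump, whence the power of [expR (beta * h)] in the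
    comparison of laws. *)
Lemma intens_translate_ge k u h y r : 0 <= h -> xi <= y ->
  intens k u y (fun i => r i - h) <= expR (beta * h) * intens k (u + h) y r.
Proof.
move=> h0 xy.
have e1 : 1 <= expR (beta * h) by rewrite -(expR0 R) ler_expR mulr_ge0 // ltW.
rewrite /intens !mulrDr; apply: lerD; first apply: lerD.
- by rewrite ler_peMl // ltW.
- by rewrite mulrCA -expRD ler_wpM2l ?subr_ge0 // ler_expR; lra.
- rewrite mulr_sumr; apply: ler_sum => i _.
  rewrite (_ : u - _ = u + h - r i); last by ring.
  by rewrite ler_peMl // mulr_ge0 // expR_ge0.
Qed.

End intensity.

Section hawkes_path.
Context (R : realType) (xi alpha beta : R) (T : Type).
Context (lambda0 : T -> R) (N : R -> T -> nat) (w : T).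
Hypothesis xi0 : 0 < xi.
Hypothesis alpha0 : 0 <= alpha.
Hypothesis beta0 : 0 < beta.
Hypothesis cpN : counting_path (N ^~ w).
Hypothesis lambda0_ge : xi <= lambda0 w.
Local Notation tau k := (jump_time N k w).
Local Notation hawkes u := (hawkes_intensity xi alpha beta lambda0 N u w).
Local Notation lam k u :=
  (intens xi alpha beta k u (lambda0 w) (fun i => jump_time N i w)).
Local Notation mu := (@lebesgue_measure R).

(** With [N t w] terms for all [u <= t], the number of terms no longer depends on [u], and
    measurability in [u] becomes visible. *)
Lemma hawkes_intensityE t u : 0 <= u -> u <= t ->
  hawkes u = xi + (lambda0 w - xi) * expR (- beta * u) +
    \sum_(1 <= k < (N t w).+1)
       (if tau k < u then alpha * expR (- beta * (u - tau k)) else 0).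
Proof.
move=> u0 ut; rewrite /hawkes_intensity; congr (_ + _).
have Nut : (N u w <= N t w)%N by exact: counting_path_le.
rewrite [RHS](@big_cat_nat _ _ _ (N u w).+1) //= -[LHS]addr0 -big_mkcond; congr (_ + _).
rewrite big_nat big1 // => k /andP[uk kt].
suff : ~~ (tau k <= u) by rewrite -ltNge => /ltW/le_gtF ->.
by rewrite -(leq_countP cpN (le_trans u0 ut)) // -ltnNge.
Qed.

(** [lam (N t w) u] is the intensity at [u] had no jump occurred after [t]; each jump after [t] adds
    between 0 and [alpha]. *)
Lemma hawkes_intensity_bounds t u : 0 <= t -> t < u ->
  lam (N t w) u <= hawkes u <= lam (N t w) u + alpha * (N u w - N t w)%N%:R.
Proof.
move=> t0 tu; have u0 : 0 <= u by rewrite (le_trans t0) // ltW.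
have Ntu : (N t w <= N u w)%N by apply: counting_path_le => //; exact: ltW.
have -> : hawkes u = lam (N t w) u + \sum_((N t w).+1 <= k < (N u w).+1)
    (if tau k < u then alpha * expR (- beta * (u - tau k)) else 0).
  rewrite (hawkes_intensityE u0 (lexx u)) (@big_cat_nat _ _ _ (N t w).+1) //=.
  rewrite addrA; congr (_ + _ + _).
  apply: eq_big_nat => k /andP[_ kN]; rewrite ifT //.
  by apply: le_lt_trans tu; rewrite -(leq_countP cpN t0).
apply/andP; split.
  rewrite lerDl; apply: sumr_ge0 => k _; case: ifP => // _.
  by rewrite mulr_ge0 ?expR_ge0.
rewrite lerD2l mulr_natr -subSS -sumr_const_nat; apply: ler_sum => k _.
case: ifP => // tk; rewrite ler_piMr // expR_le1 mulNr oppr_le0 mulr_ge0 ?(ltW beta0) //.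
by rewrite subr_ge0 ltW.
Qed.

Lemma hawkes_integrable t : 0 <= t ->
  mu.-integrable `[0, t] (EFin \o (fun u => hawkes u)).
Proof.
move=> t0; pose h u := xi + (lambda0 w - xi) * expR (- beta * u) +
    \sum_(1 <= k < (N t w).+1)
       (if tau k < u then alpha * expR (- beta * (u - tau k)) else 0).
have mE (c : R) : measurable_fun setT (fun u : R => expR (- beta * (u - c))).
  apply: measurableT_comp; first exact: measurable_expR.
  by apply: measurable_funM => //; exact: measurable_funB.
have mh : measurable_fun setT h.
  apply: measurable_funD.
    apply: measurable_funD => //; apply: measurable_funM => //.
    by have := mE 0; under eq_fun => u do rewrite subr0.
  apply: measurable_sum => i; apply: measurable_fun_ifT => //.
    by apply: measurable_fun_ltr.
  by apply: measurable_funM => //; exact: mE.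
apply: (@eq_integrable _ _ _ mu _ _ (EFin \o h)) => //.
  by move=> u; rewrite inE /= in_itv /= => /andP[u0 ut]; rewrite /h (hawkes_intensityE u0 ut).
apply: measurable_bounded_integrable => //.
- by rewrite /= lebesgue_measure_itv /=; case: ifP => // _; rewrite -EFinB ltry.
- exact: measurable_funS mh.
have e1 c u : c <= u -> expR (- beta * (u - c)) <= 1.
  by move=> cu; rewrite expR_le1 mulNr oppr_le0 mulr_ge0 ?subr_ge0 // ltW.
have h0 u : 0 <= h u.
  rewrite /h !addr_ge0 ?(ltW xi0) //.
    by rewrite mulr_ge0 ?subr_ge0 // expR_ge0.
  by apply: sumr_ge0 => k _; case: ifP => // _; rewrite mulr_ge0 ?expR_ge0.
pose M := xi + (lambda0 w - xi) + \sum_(1 <= k < (N t w).+1) alpha.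
have hM u : 0 <= u -> h u <= M.
  move=> u0; apply: lerD; last first.
    apply: ler_sum => k _; case: ifP => // /ltW/e1 ?.
    by rewrite ler_piMr.
  rewrite lerD2l ler_piMr ?subr_ge0 //.
  by have := e1 _ _ u0; rewrite subr0.
exists M; split; first exact: num_real.
move=> x Mx u /=; rewrite in_itv /= => /andP[u0 _].
by rewrite ger0_norm //; apply: le_trans (hM u u0) (ltW Mx).
Qed.

Lemma compensator_increment t v : 0 <= t -> t <= v ->
  (v - t) * lam (N t w) v <=
  \int[mu]_(u in `[0, v]) hawkes u - \int[mu]_(u in `[0, t]) hawkes u
  <= (v - t) * (lam (N t w) t + alpha * (N v w - N t w)%N%:R).
Proof.
move=> t0 tv; have v0 := le_trans t0 tv.
have iv := hawkes_integrable v0.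
rewrite Rintegral_itvB ?bnd_simp //.
have itv : mu.-integrable `]t, v] (EFin \o (fun u => hawkes u)).
  apply: integrableS iv => // u /=.
  by rewrite !in_itv /= => /andP[/ltW tu ->]; rewrite (le_trans t0).
have ic (r : R) : mu.-integrable `]t, v] (EFin \o (fun=> r)).
  apply: measurable_bounded_integrable => //.
    by rewrite /= lebesgue_measure_itv /=; case: ifP => // _; rewrite -EFinB ltry.
  exact: bounded_cst.
have muE : fine (mu `]t, v]) = v - t.
  rewrite /= lebesgue_measure_itv /= lte_fin; case: ltP => // vt.
  by rewrite (_ : v = t) ?subrr //; apply/eqP; rewrite eq_le tv vt.
rewrite (mulrC (v - t)) (mulrC (v - t)) -muE -!(Rintegral_cst mu) //.
apply/andP; split; apply: le_Rintegral => // u; rewrite /= in_itv /= => /andP[tu uv].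
  have /andP[+ _] := hawkes_intensity_bounds t0 tu.
  by apply: le_trans; apply: intens_nonincr.
have /andP[_] := hawkes_intensity_bounds t0 tu.
move=> /le_trans; apply; apply: lerD.
  by apply: intens_nonincr => //; exact: ltW.
rewrite ler_wpM2l // ler_nat leq_sub2r //; apply: counting_path_le => //.
by rewrite (le_trans t0) // ltW.
Qed.

(** The pathwise source of all first-order estimates. The jumps of the step raise the compensator
    themselves, by at most [alpha * (v - t)] each, which explains the coefficient
    [1 - alpha * (v - t)]. *)
Lemma compensated_increment t v : 0 <= t -> t <= v ->
  let M u := (N u w)%:R - \int[mu]_(x in `[0, u]) hawkes x in
  (1 - alpha * (v - t)) * (N v w - N t w)%N%:R - (v - t) * lam (N t w) t
  <= M v - M t <= (N v w - N t w)%N%:R - (v - t) * lam (N t w) v.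
Proof.
move=> t0 tv /=.
have Ntv : (N t w <= N v w)%N by exact: counting_path_le.
have /andP[] := compensator_increment t0 tv.
rewrite natrB //; set I1 := \int[mu]_(u in `[0, v]) _; set I2 := \int[mu]_(u in _) _.
set a := (N v w)%:R; set b := (N t w)%:R.
by move=> h1 h2; apply/andP; split; lra.
Qed.

End hawkes_path.

(** * From the local martingale to increments *)

Section localization.
Context (R : realType) d (T : measurableType d) (P : probability T R).
Variable F : R -> set (set T).
Hypothesis filF : filtration F.
Local Notation FT t := (g_sigma_algebraType (F t)).

Lemma filtration_measurableE t : 0 <= t ->
  (measurable : set (set (FT t))) = F t.
Proof. by move=> t0; rewrite measurable_g_measurableTypeE //; case: filF => + _ _; apply. Qed.

Lemma filtrationP t A : 0 <= t -> F t A <-> measurable (A : set (FT t)).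
Proof. by move=> t0; rewrite filtration_measurableE. Qed.

Lemma filtration_measurable t A : 0 <= t -> F t A -> measurable A.
Proof. by move=> t0; case: filF => _ + _; apply. Qed.

Lemma filtration_le s t A : 0 <= s -> s <= t -> F s A -> F t A.
Proof. by move=> s0 st; case: filF => _ _ + ; apply. Qed.

Lemma filtrationI t A B : 0 <= t -> F t A -> F t B -> F t (A `&` B).
Proof. by move=> t0 /(filtrationP _ t0) mA /(filtrationP _ t0) mB; apply/(filtrationP _ t0)/measurableI. Qed.

Lemma measurable_filtration_id t : 0 <= t ->
  measurable_fun setT (id : T -> FT t).
Proof.
move=> t0 _ B; rewrite filtration_measurableE // setTI preimage_id => FB.
exact: filtration_measurable FB.
Qed.

(** A stopping time only provides the events [tau <= r]; the event [tau < s] is their union over a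
    sequence [r k] increasing to [s] from below. *)
Lemma measurable_stopping_ge (tau : T -> \bar R) (s : R) : stopping_time F tau ->
  0 < s -> measurable [set w | (s%:E <= tau w)%E].
Proof.
move=> [tau0 Ftau] s0.
pose r (k : nat) : R := s * (1 - k.+1%:R^-1).
have r0 k : 0 <= r k.
  by rewrite mulr_ge0 ?(ltW s0) // subr_ge0 invf_le1 ?ltr0n // ler1n.
rewrite (_ : [set _ | _] = \bigcap_k ~` [set w | (tau w <= (r k)%:E)%E]).
  by apply: bigcapT_measurable => k; apply: measurableC;
    exact: (filtration_measurable (r0 k) (Ftau _ (r0 k))).
apply/seteqP; split=> [w /= sw k _ /= tw|w /= H].
  have := le_trans sw tw; rewrite lee_fin /r ler_pMr // => h.
  by move: h; rewrite leNgt ltrBlDr ltrDl invr_gt0 ltr0n.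
rewrite leNgt; apply/negP => ws.
have tfin : tau w \is a fin_num by rewrite ge0_fin_numE // (lt_le_trans ws) // leey.
move: ws H; rewrite -(fineK tfin) lte_fin => ws H.
set x := fine (tau w) in ws H.
pose k := Num.truncn (s / (s - x)).
have sx : 0 < s - x by rewrite subr_gt0.
apply: (H k I) => /=; rewrite -(fineK tfin) -/x lee_fin /r mulrBr mulr1 lerBrDr -lerBrDl.
rewrite ler_pdivrMr ?ltr0n // mulrC -ler_pdivrMr //.
exact/ltW/truncnS_gt.
Qed.

(** Fatou's lemma along the localizing sequence: at almost every point the indicator of [s <= tau n]
    is eventually 1, and the bound [c] does not depend on [n]. Integrability of [g] is not
    presupposed, so this can serve to prove it. *)
Lemma localized_integral_le (tau : nat -> T -> \bar R) (s : R) A (g : T -> R) (c : \bar R) :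
  (forall n, stopping_time F (tau n)) ->
  {ae P, forall w, (fun n => tau n w) @ \oo --> +oo%E} ->
  0 < s -> measurable A -> measurable_fun setT g ->
  (forall w, A w -> 0 <= g w) ->
  (forall n, \int[P]_(w in A) ((s%:E <= tau n w)%E%:R * g w)%:E <= c)%E ->
  (\int[P]_(w in A) (g w)%:E <= c)%E.
Proof.
move=> st tauy s0 mA mg g0 gc.
pose f n w := ((s%:E <= tau n w)%E%:R * g w)%:E.
have mf n : measurable_fun A (f n).
  apply: (@measurable_funS _ _ _ _ setT) => //.
  apply/measurable_EFinP; apply: measurable_funM => //.
  exact/measurable_bool_nat/measurable_stopping_ge.
have f0 n w : A w -> (0 <= f n w)%E.
  by move=> Aw; rewrite lee_fin mulr_ge0 // g0.
apply: (@le_trans _ _ (\int[P]_(w in A) limn_einf (f^~ w))%E).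
  apply: ae_ge0_le_integral => //.
  - by apply/measurable_EFinP; exact: measurable_funS mg.
  - move=> w Aw; rewrite limn_einf_lim; apply: lime_ge; last first.
      apply: nearW => n; apply: le_ereal_inf_tmp => _ [m _ <-]; exact: f0.
    exact: is_cvg_einfs.
  - under eq_fun do rewrite limn_einf_lim.
    apply: (@emeasurable_fun_cvg _ _ _ _ (fun n x => einfs (f^~ x) n)).
      exact: measurable_fun_einfs.
    by move=> x _; exact: is_cvg_einfs.
  - apply: filterS tauy => w tw Aw.
    suff lim : f n w @[n --> \oo] --> (g w)%:E.
      by have [-> _] := cvg_limn_einf_sup lim.
    apply: cvg_near_cst; have /cvgeyPge/(_ s) := tw; apply: filterS => n sn.
    by rewrite /f sn mul1r.
apply: (@le_trans _ _ (limn_einf (fun n => \int[P]_(w in A) f n w))%E); first exact: fatou.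
rewrite limn_einf_lim; apply: lime_le; first exact: is_cvg_einfs.
apply: nearW => n; apply: (@le_trans _ _ (\int[P]_(w in A) f n w)%E); last exact: gc.
by rewrite /einfs /=; apply: ereal_inf_lbound; exists n => /=.
Qed.

End localization.

Lemma measurable_fun_sublevel (R : realType) d (T : measurableType d)
    (D : set T) (f : T -> R) : measurable D ->
  (forall x : R, measurable (D `&` [set w | f w <= x])) -> measurable_fun D f.
Proof.
move=> mD H; apply: (measurability (@RGenOInfty.G R)).
  exact: RGenOInfty.measurableE.
move=> _ [_ [x ->] <-].
rewrite (_ : _ `&` _ = D `\` (D `&` [set w | f w <= x])).
  exact: measurableD.
apply/seteqP; split=> [w [Dw]/= |w [Dw] /= nf].
  by rewrite in_itv /= andbT => xf; split => // -[_]; rewrite leNgt xf.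
by split => //; rewrite in_itv /= andbT ltNge; apply/negP => h; exact: nf.
Qed.

Section hawkes_increments.
Context (R : realType) d (T : measurableType d) (P : probability T R).
Context (xi alpha beta : R) (F : R -> set (set T)).
Context (lambda0 : {RV P >-> R}) (N : R -> T -> nat).
Hypothesis xi0 : 0 < xi.
Hypothesis alpha0 : 0 <= alpha.
Hypothesis beta0 : 0 < beta.
Hypothesis hawkesN : hawkes_process xi alpha beta F lambda0 N.

(** The intensity at [u] generated by the first [k] jumps alone. With [k] fixed it is an explicit
    function of [lambda0] and of [k] jump times, and on the event [N t w = k] it is known at time
    [t], even for [u] after [t]. *)
Definition hist_intens (k : nat) (u : R) (w : T) : R :=
  intens xi alpha beta k u (lambda0 w) (fun i => jump_time N i w).
Local Notation lam := hist_intens.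

Lemma hawkes_filtration : filtration F.
Proof. by case: hawkesN. Qed.

Lemma hawkes_counting w : counting_path (N ^~ w).
Proof. by case: hawkesN => _ _ _ + _; apply. Qed.

Lemma hawkes_lambda0_ge w : xi <= lambda0 w.
Proof. by case: hawkesN => _ _ [_ +] _ _; apply. Qed.

Let filF := hawkes_filtration.
Let cpN := hawkes_counting.
Let l0ge := hawkes_lambda0_ge.

Lemma hawkes_lambda0_adapted (t : R) (B : set R) : 0 <= t -> measurable B ->
  F t (lambda0 @^-1` B).
Proof.
move=> t0 mB; apply: (filtration_le filF (lexx 0) t0).
by case: hawkesN => _ _ [+ _] _ _; apply.
Qed.

Lemma count_adapted (t : R) (B : set nat) : 0 <= t -> F t [set w | B (N t w)].
Proof. by case: hawkesN => _ aN _ _ _ t0; apply: (aN t t0 B). Qed.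

Lemma count_measurable (t : R) (B : set nat) : 0 <= t ->
  measurable [set w | B (N t w)].
Proof. by move=> t0; exact: (filtration_measurable filF t0 (count_adapted B t0)). Qed.

Lemma jump_time_nneg k w : 0 <= jump_time N k w.
Proof.
have [[t [t0 kN]]|H] := pselect (exists t : R, 0 <= t /\ (k <= N t w)%N).
  exact: jump_time_ge0 t0 kN.
rewrite /jump_time (_ : [set _ | _] = set0) ?inf0 //.
by apply/seteqP; split => // t [t0 kN]; apply: H; exists t.
Qed.

(** Paths with fewer than [k] jumps carry the junk value [inf set0 = 0]; for [x >= 0] they belong to
    the sublevel set and form the countable intersection below. *)
Lemma measurable_jump_time k : measurable_fun setT (jump_time N k).
Proof.
apply: measurable_fun_sublevel => // x; rewrite setTI.
have [x0|x0] := ltP x 0.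
  rewrite (_ : [set _ | _] = set0) //.
  apply/seteqP; split => // w /= Tx.
  by have := lt_le_trans x0 (jump_time_nneg k w); rewrite ltNge Tx.
rewrite (_ : [set _ | _] = [set w | (k <= N x w)%N] `|`
    \bigcap_n [set w | (N n%:R w < k)%N]).
  apply: measurableU; first exact: (count_measurable [set m | (k <= m)%N]).
  apply: bigcapT_measurable => n.
  exact: (count_measurable [set m | (m < k)%N]).
apply/seteqP; split=> w /=.
  move=> Tx; have [[t [t0 kN]]|H] := pselect (exists t : R, 0 <= t /\ (k <= N t w)%N).
    by left; rewrite (leq_countP (cpN w) t0).
  by right => n _ /=; rewrite ltnNge; apply/negP => kn; apply: H; exists n%:R.
move=> [kN|H]; first exact: jump_time_le.
rewrite /jump_time (_ : [set _ | _] = set0) ?inf0 //.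
apply/seteqP; split => // t [t0 kN].
have := H (Num.truncn t).+1 I; rewrite /= ltnNge (leq_trans kN) //.
apply: (counting_path_le (cpN w)) => //.
exact/ltW/truncnS_gt.
Qed.

Lemma measurable_hist_intens k u : measurable_fun setT (lam k u).
Proof.
apply: measurable_funD.
  apply: measurable_funD => //; apply: measurable_funM => //.
  by apply: measurable_funB.
apply: measurable_sum => i; apply: measurable_funM => //.
apply: measurableT_comp; first exact: measurable_expR.
apply: measurable_funM => //; apply: measurable_funB => //.
exact: measurable_jump_time.
Qed.

Lemma hist_intens_ge0 k u w : 0 <= lam k u w.
Proof. exact: intens_ge0. Qed.

Lemma hist_intens_le b k u w : 0 <= u -> lambda0 w <= b -> (k <= N u w)%N ->
  lam k u w <= b + alpha * k%:R.
Proof.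
move=> u0 lb kN; apply: intens_le => // i /andP[_ ik].
by apply: jump_time_le => //; exact: leq_trans kN.
Qed.

End hawkes_increments.

Section increments.
Context (R : realType) d (T : measurableType d) (P : probability T R).
Context (xi alpha beta : R) (F : R -> set (set T)).
Context (lambda0 : {RV P >-> R}) (N : R -> T -> nat).
Hypothesis xi0 : 0 < xi.
Hypothesis alpha0 : 0 <= alpha.
Hypothesis beta0 : 0 < beta.
Hypothesis hawkesN : hawkes_process xi alpha beta F lambda0 N.
Local Notation lam := (hist_intens xi alpha beta lambda0 N).
Let filF := hawkes_filtration hawkesN.
Let cpN := hawkes_counting hawkesN.
Let l0ge := hawkes_lambda0_ge hawkesN.
Let lam_ge0 := hist_intens_ge0 xi0 alpha0 hawkesN.
Let lam_le := hist_intens_le alpha0 beta0 hawkesN.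
Let mlam := measurable_hist_intens hawkesN.
Let mcount := count_measurable hawkesN.

Let M (t : R) (w : T) : R := (N t w)%:R -
  \int[lebesgue_measure]_(u in `[0, t]) hawkes_intensity xi alpha beta lambda0 N u w.

(** If [tau] precedes [t] the stopped process does not move; if it falls inside the step,
    [compensated_increment] is used up to [tau]. The indicator [I] is kept only on the term to be
    retained in each inequality: the jumps in the lower bound, the intensity in the upper one. The
    other terms do not depend on [tau]. *)
Lemma stopped_increment (tau : T -> \bar R) (t dl : R) w : (0 <= tau w)%E ->
  0 <= t -> 0 < dl -> alpha * dl <= 1 ->
  let I := (((t + dl)%:E <= tau w)%E)%:R in
  let D := (N (t + dl) w - N t w)%N%:R in
  (1 - alpha * dl) * (I * D) - dl * lam (N t w) t w
  <= stopped M tau (t + dl) w - stopped M tau t w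
  <= D - I * (dl * lam (N t w) (t + dl) w).
Proof.
move=> tau0 t0 dl0 adl /=.
have td : t <= t + dl by rewrite lerDl ltW.
have lam0 u : 0 <= lam (N t w) u w by exact: lam_ge0.
have D0 : 0 <= (N (t + dl) w - N t w)%N%:R :> R by [].
have [tlt|tge] := ltP (tau w) t%:E.
  have tdlt : (tau w < (t + dl)%:E)%E by apply: lt_le_trans tlt _; rewrite lee_fin.
  rewrite /stopped min_r ?(ltW tdlt) // min_r ?(ltW tlt) // subrr.
  rewrite (lt_geF tdlt) /= !mul0r mulr0 sub0r subr0 D0 andbT oppr_le0.
  by rewrite mulr_ge0 // ltW.
have stE : stopped M tau t w = M t w by rewrite /stopped min_l.
have [tdle|tdlt] := leP (t + dl)%:E (tau w).
  have -> : stopped M tau (t + dl) w = M (t + dl) w by rewrite /stopped min_l.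
  have := compensated_increment xi0 alpha0 beta0 (cpN w) (l0ge w) t0 td.
  rewrite (_ : t + dl - t = dl); last by ring.
  by rewrite stE !mul1r.
set v := fine (tau w).
have vE : tau w = v%:E by rewrite fineK // ge0_fin_numE // (lt_trans tdlt) // ltry.
have -> : stopped M tau (t + dl) w = M v w by rewrite /stopped min_r ?(ltW tdlt).
move: tge tdlt; rewrite vE lee_fin lte_fin => tv vt.
rewrite stE /= !mul0r mulr0 sub0r subr0.
have := compensated_increment xi0 alpha0 beta0 (cpN w) (l0ge w) t0 tv.
rewrite -/(M v w) -/(M t w) => /andP[h1 h2].
have l1 := lam0 t; have l2 := lam0 v.
have n1 : (N v w - N t w)%N%:R <= (N (t + dl) w - N t w)%N%:R :> R.
  rewrite ler_nat leq_sub2r //; apply: (counting_path_le (cpN w)); last exact: ltW.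
  exact: le_trans tv.
have n2 : 0 <= (1 - alpha * (v - t)) * (N v w - N t w)%N%:R.
  rewrite mulr_ge0 // subr_ge0; apply: le_trans adl; rewrite ler_wpM2l //; lra.
apply/andP; split.
  apply: le_trans h1; rewrite -[leLHS]add0r; apply: lerD => //.
  rewrite lerN2 ler_wpM2r //; lra.
apply: (le_trans h2).
have : 0 <= (v - t) * lam (N t w) v w by rewrite mulr_ge0 // subr_ge0.
rewrite /hist_intens; lra.
Qed.

Variables (b : R) (q : nat) (t dl : R) (A : set T).
Hypothesis t0 : 0 <= t.
Hypothesis dl0 : 0 < dl.
Hypothesis adl : alpha * dl <= 2^-1.
Hypothesis FA : F t A.
Hypothesis AN : forall w, A w -> N t w = q.
Hypothesis Ab : forall w, A w -> lambda0 w <= b.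

Let mA : measurable A. Proof. exact: (filtration_measurable filF t0 FA). Qed.
Let td0 : 0 <= t + dl. Proof. by rewrite addr_ge0 // ltW. Qed.
Let adl1 : alpha * dl <= 1. Proof. by apply: le_trans adl _; lra. Qed.

Let lamP u w : A w -> t <= u -> 0 <= lam q u w <= b + alpha * q%:R.
Proof.
move=> Aw tu; rewrite lam_ge0 /= lam_le //; [exact: le_trans tu|exact: Ab|].
by rewrite -(AN Aw); apply: (counting_path_le (cpN w)).
Qed.

Let ilam u : t <= u -> P.-integrable A (EFin \o lam q u).
Proof.
move=> tu; apply: measurable_bounded_integrable => //.
- by apply: (le_lt_trans (probability_le1 P _)) => //; rewrite ltry.
- exact: measurable_funS (mlam q u).
exists (b + alpha * q%:R); split; first exact: num_real.
move=> x Mx w Aw /=; have /andP[l1 l2] := lamP Aw tu.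
by rewrite ger0_norm //; apply: le_trans l2 (ltW Mx).
Qed.

Let mD : measurable_fun setT (fun w => (N (t + dl) w - q)%N%:R : R).
Proof.
apply: measurable_fun_sublevel => // x; rewrite setTI.
exact: (mcount [set n | (n - q)%N%:R <= x]).
Qed.

Let stopped_martingale : exists tau : nat -> T -> \bar R,
  [/\ forall n, stopping_time F (tau n),
      {ae P, forall w, (fun n => tau n w) @ \oo --> +oo%E} &
      forall n, P.-integrable A (fun w =>
         (stopped M (tau n) (t + dl) w - stopped M (tau n) t w)%:E) /\
        (\int[P]_(w in A)
          (stopped M (tau n) (t + dl) w - stopped M (tau n) t w)%:E = 0)%E].
Proof.
case: hawkesN => _ _ _ _ [tau [st _ tauy mart]].
exists tau; split => // n; have [_ imart emart] := mart n.
have i1 : P.-integrable A (EFin \o stopped M (tau n) t).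
  by apply: integrableS (imart t t0).
have i2 : P.-integrable A (EFin \o stopped M (tau n) (t + dl)).
  by apply: integrableS (imart _ td0).
split; first by have := integrableB mA i2 i1; apply: eq_integrable => // w _; rewrite /= EFinB.
rewrite integralB_EFin // (emart t (t + dl)) //.
  by rewrite subee // integrable_fin_num.
by rewrite lerDl ltW.
Qed.

(** Integrating the lower bound of [stopped_increment] leaves the coefficient [1 - alpha * dl] on
    the left; for [alpha * dl <= 1/2] its inverse is at most [1 + 2 * alpha * dl]. *)
Lemma count_increment_le :
  (\int[P]_(w in A) ((N (t + dl) w - q)%N%:R : R)%:E <=
   (dl * (1 + 2 * alpha * dl))%:E * \int[P]_(w in A) (lam q t w)%:E)%E.
Proof.
have [tau [st tauy mart]] := stopped_martingale.
have c0 : 0 < 1 - alpha * dl by move: adl; lra.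
have Ilam : (0 <= \int[P]_(w in A) (lam q t w)%:E)%E.
  by apply: integral_ge0 => w Aw; rewrite lee_fin; have /andP[] := lamP Aw (lexx t).
suff H : (\int[P]_(w in A) ((1 - alpha * dl) * (N (t + dl) w - q)%N%:R)%:E <=
   dl%:E * \int[P]_(w in A) (lam q t w)%:E)%E.
  move: H; under eq_integral do rewrite EFinM.
  rewrite ge0_integralZl_EFin //; [|exact/measurable_EFinP/measurable_funTS|exact: ltW].
  rewrite -lee_pdivlMl // => /le_trans; apply.
  rewrite muleA -EFinM lee_wpmul2r // lee_fin mulrC ler_wpM2l ?(ltW dl0) //.
  rewrite -[leLHS]mul1r ler_pdivrMr //.
  have : 0 <= alpha * dl by rewrite mulr_ge0 // ltW.
  move: adl; set x := alpha * dl => h1 h2.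
  rewrite (_ : 2 * alpha * dl = 2 * x); last by rewrite /x; ring.
  nra.
apply: (@localized_integral_le _ _ _ P F filF tau (t + dl)) => //.
- by rewrite ltr_wpDl.
- by apply: measurable_funM.
- by move=> w Aw; rewrite mulr_ge0 // ltW.
move=> n; have [iX EX] := mart n.
rewrite -ge0_integralZl_EFin //; last 3 first.
- by move=> w Aw; rewrite lee_fin; have /andP[] := lamP Aw (lexx t).
- by case/integrableP: (ilam (lexx t)).
- exact: ltW.
rewrite -[leRHS]add0e -EX -integralD //; last first.
  by apply: integrableZl => //; exact: ilam.
have bnd w : A w -> (1 - alpha * dl) * ((((t + dl)%:E <= tau n w)%E)%:R *
    (N (t + dl) w - q)%N%:R) - dl * lam q t w
    <= stopped M (tau n) (t + dl) w - stopped M (tau n) t w.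
  move=> Aw; have [tau0 _] := st n.
  by have /andP[+ _] := stopped_increment (tau0 w) t0 dl0 adl1; rewrite (AN Aw).
apply: ge0_le_integral => //.
- by move=> w Aw; rewrite lee_fin !mulr_ge0 // ltW.
- apply/measurable_EFinP/measurable_funTS; apply: measurable_funM.
    apply: measurable_bool_nat; apply: (measurable_stopping_ge filF (st n)).
    by rewrite ltr_wpDl.
  exact: measurable_funM.
- apply: emeasurable_funD; first by case/integrableP: iX.
  by apply: measurable_funeM; case/integrableP: (ilam (lexx t)).
- move=> w Aw; rewrite -EFinM -EFinD lee_fin mulrCA.
  by have := bnd _ Aw; lra.
Qed.

(** Integrating the upper bound of [stopped_increment] requires the increment of [N] to be
    integrable, which [count_increment_le] has provided. *)
Lemma count_increment_ge :
  (dl%:E * \int[P]_(w in A) (lam q (t + dl) w)%:E <=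
   \int[P]_(w in A) ((N (t + dl) w - q)%N%:R : R)%:E)%E.
Proof.
have [tau [st tauy mart]] := stopped_martingale.
have tdl : t <= t + dl by rewrite lerDl ltW.
have iD : P.-integrable A (fun w => ((N (t + dl) w - q)%N%:R : R)%:E).
  apply/integrableP; split; first exact/measurable_EFinP/measurable_funTS.
  under eq_integral do rewrite gee0_abs //.
  apply: (le_lt_trans count_increment_le).
  have := integrable_fin_num mA (ilam (lexx t)).
  by move=> /fineK <-; rewrite -EFinM ltry.
rewrite -ge0_integralZl_EFin //; last 3 first.
- by move=> w Aw; rewrite lee_fin; have /andP[] := lamP Aw tdl.
- by case/integrableP: (ilam tdl).
- exact: ltW.
under eq_integral do rewrite -EFinM.
apply: (@localized_integral_le _ _ _ P F filF tau (t + dl)) => //.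
- by rewrite ltr_wpDl.
- apply: measurable_funM => //; exact: mlam.
- by move=> w Aw; rewrite mulr_ge0 ?(ltW dl0) //; have /andP[] := lamP Aw tdl.
move=> n; have [iX EX] := mart n.
rewrite -[leRHS]sube0 -EX -integralB //.
have bnd w : A w -> stopped M (tau n) (t + dl) w - stopped M (tau n) t w <=
    (N (t + dl) w - q)%N%:R -
    (((t + dl)%:E <= tau n w)%E)%:R * (dl * lam q (t + dl) w).
  move=> Aw; have [tau0 _] := st n.
  by have /andP[_] := stopped_increment (tau0 w) t0 dl0 adl1; rewrite (AN Aw).
apply: ge0_le_integral => //.
- move=> w Aw; rewrite lee_fin !mulr_ge0 ?(ltW dl0) //.
- apply/measurable_EFinP/measurable_funTS; apply: measurable_funM.
    apply: measurable_bool_nat; apply: (measurable_stopping_ge filF (st n)).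
    by rewrite ltr_wpDl.
  by apply: measurable_funM => //; exact: mlam.
- by apply: emeasurable_funB; [case/integrableP: iD|case/integrableP: iX].
- by move=> w Aw; rewrite -EFinB lee_fin; have := bnd _ Aw; lra.
Qed.

End increments.

(** * Two jumps within a short step *)

Section double_jumps.
Context (R : realType) d (T : measurableType d) (P : probability T R).
Context (xi alpha beta : R) (F : R -> set (set T)).
Context (lambda0 : {RV P >-> R}) (N : R -> T -> nat).
Hypothesis xi0 : 0 < xi.
Hypothesis alpha0 : 0 <= alpha.
Hypothesis beta0 : 0 < beta.
Hypothesis hawkesN : hawkes_process xi alpha beta F lambda0 N.
Local Notation lam := (hist_intens xi alpha beta lambda0 N).
Let filF := hawkes_filtration hawkesN.
Let cpN := hawkes_counting hawkesN.
Let lam_ge0 := hist_intens_ge0 xi0 alpha0 hawkesN.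
Let lam_le := hist_intens_le alpha0 beta0 hawkesN.
Let mlam := measurable_hist_intens hawkesN.
Let mcount := count_measurable hawkesN.
Let acount := count_adapted hawkesN.

Variable b : R.
Hypothesis b0 : 0 <= b.

Lemma measurable_count_fun (f : nat -> R) (t : R) : 0 <= t ->
  measurable_fun setT (fun w => f (N t w)).
Proof.
move=> t0; apply: measurable_fun_sublevel => // x; rewrite setTI.
exact: (mcount [set n | f n <= x]).
Qed.

(** The case [dl = 0] is included because no time remains after the last cell of a subdivision. The
    factor 2 bounds [1 + 2 * alpha * dl]. *)
Lemma count_increment_le_bound q (t dl : R) (A : set T) : 0 <= t -> 0 <= dl ->
  alpha * dl <= 2^-1 -> F t A -> (forall w, A w -> N t w = q) ->
  (forall w, A w -> lambda0 w <= b) ->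
  (\int[P]_(w in A) ((N (t + dl) w - q)%N%:R : R)%:E <=
   (2 * dl * (b + alpha * q%:R))%:E * P A)%E.
Proof.
move=> t0 + adl FA AN Ab; rewrite le_eqVlt => /predU1P[<-|dl0].
  rewrite mulr0 mul0r mul0e addr0 integral0_eq // => w Aw.
  by rewrite (AN w Aw) subnn.
have mA : measurable A by exact: (filtration_measurable filF t0 FA).
apply: (le_trans (count_increment_le xi0 alpha0 beta0 hawkesN t0 dl0 adl FA AN Ab)).
have ad0 : 0 <= alpha * dl by rewrite mulr_ge0 // ltW.
apply: (@le_trans _ _ ((2 * dl)%:E * \int[P]_(w in A) (lam q t w)%:E)%E).
  apply: lee_wpmul2r; first by apply: integral_ge0 => w _; rewrite lee_fin.
  rewrite lee_fin mulrC ler_wpM2r ?(ltW dl0) //.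
  by rewrite (_ : 2 * alpha * dl = 2 * (alpha * dl)); [lra|ring].
rewrite (EFinM (2 * dl)) -muleA; apply: lee_wpmul2l; first by rewrite lee_fin mulr_ge0 // ltW.
rewrite -integral_cst //; apply: ge0_le_integral => //.
- by move=> w _; rewrite lee_fin.
- exact/measurable_EFinP/measurable_funTS/mlam.
- move=> w Aw; rewrite lee_fin; apply: lam_le => //; first exact: Ab.
  by rewrite (AN w Aw).
Qed.

(** The martingale property controls expected increments to first order only. The step is cut into
    cells; a path with at least two jumps either has count [q.+1] at the end of the first cell where
    it leaves [q], or jumps twice in that cell. In the first case the first-order bound is used
    twice, for leaving [q] and then from the end of the cell on, which gives [dl ^+ 2]; the second
    case disappears as the mesh tends to 0. *)
Lemma double_increment_le q (t dl : R) (A : set T) : 0 <= t -> 0 < dl ->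
  alpha * dl <= 2^-1 -> F t A -> (forall w, A w -> N t w = q) ->
  (forall w, A w -> lambda0 w <= b) ->
  (\int[P]_(w in A) ((N (t + dl) w - q.+1)%N%:R : R)%:E <=
   ((2 * (b + alpha * q.+1%:R)) ^+ 2 * dl ^+ 2)%:E * P A)%E.
Proof.
move=> t0 dl0 adl FA AN Ab.
set L := 2 * (b + alpha * q.+1%:R).
have L0 : 0 <= L by rewrite mulr_ge0 // addr_ge0 // mulr_ge0.
have dl0' := ltW dl0.
have mA : measurable A by exact: (filtration_measurable filF t0 FA).
have td0 : 0 <= t + dl by rewrite addr_ge0.
pose u (m i : nat) : R := t + i%:R * (dl / m%:R).
have u0 m i : 0 <= u m i by rewrite addr_ge0 // mulr_ge0 // divr_ge0.
have ule m i j : (i <= j)%N -> u m i <= u m j.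
  by move=> ij; rewrite lerD2l ler_wpM2r ?divr_ge0 // ler_nat.
have utop m : u m.+1 m.+1 = t + dl by rewrite /u mulrC divfK // pnatr_eq0.
have u_0 m : u m 0%N = t by rewrite /u mul0r addr0.
have Nmono (s1 s2 : R) w : 0 <= s1 -> s1 <= s2 -> (N s1 w <= N s2 w)%N.
  by move=> s10 s12; apply: (counting_path_le (cpN w)).
(* On [A], the first jump after [t] falls into cell [i] and is alone in it. The event [A_ m i] is
   known at the end of the cell, from which the next increment is estimated. *)
pose B_ m i := [set w | N (u m i) w = q] `&` [set w | N (u m i.+1) w = q.+1].
pose A_ m i := A `&` B_ m i.
have FA_ m i : F (u m i.+1) (A_ m i).
  have ut : t <= u m i.+1 by rewrite -(u_0 m); exact: ule.
  apply: (filtrationI filF) => //; first exact: (filtration_le filF t0 ut FA).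
  apply: (filtrationI filF) => //; last exact: (acount [set n | n = q.+1]).
  apply: (filtration_le filF (u0 m i)); first exact: ule.
  exact: (acount [set n | n = q]).
have mA_ m i : measurable (A_ m i) by exact: (filtration_measurable filF (u0 m i.+1)).
(* The error event: some cell takes the path from [q] directly beyond [q.+1]. *)
pose E m w := [exists i : 'I_m, (N (u m i) w == q) && (q.+1 < N (u m i.+1) w)%N].
have mE m : measurable [set w | E m w].
  rewrite (_ : [set w | _] = \bigcup_(i in [set i | (i < m)%N])
    ([set w | N (u m i) w = q] `&` [set w | (q.+1 < N (u m i.+1) w)%N])).
    apply: bigcup_measurable => i _; apply: measurableI.
      exact: (mcount [set n | n = q]).
    exact: (mcount [set n | (q.+1 < n)%N]).
  apply/seteqP; split=> w /=.
    by move=> /existsP[i /andP[/eqP h1 h2]]; exists i => //=.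
  by move=> [i /= im [h1 h2]]; apply/existsP; exists (Ordinal im); rewrite /= h1 eqxx.
pose g w : R := (N (t + dl) w - q)%N%:R.
pose g1 w : R := (N (t + dl) w - q.+1)%N%:R.
have mg : measurable_fun setT g by exact: (measurable_count_fun (fun n => (n - q)%N%:R)).
have mg1 : measurable_fun setT g1 by exact: (measurable_count_fun (fun n => (n - q.+1)%N%:R)).
have gle : (\int[P]_(w in A) (g w)%:E <= (L * dl)%:E * P A)%E.
  apply: (le_trans (count_increment_le_bound t0 dl0' adl FA AN Ab)).
  apply: lee_wpmul2r => //; rewrite lee_fin /L mulrAC ler_wpM2r // ler_wpM2l //.
  by rewrite lerD2l ler_wpM2l // ler_nat.
have ig : P.-integrable A (EFin \o g).
  apply/integrableP; split; first exact/measurable_EFinP/measurable_funTS.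
  under eq_integral do rewrite /= ger0_norm //.
  apply: (le_lt_trans gle).
  by have /fineK <- := fin_num_measure P _ mA; rewrite -EFinM ltry.
have step m w : A w -> g1 w <=
    \sum_(i < m.+1) \1_(A_ m.+1 i) w * g1 w + (E m.+1 w)%:R * g w.
  move=> Aw.
  have s0 : 0 <= \sum_(i < m.+1) \1_(A_ m.+1 i) w * g1 w.
    by apply: sumr_ge0 => i _; rewrite mulr_ge0.
  have [Nle|Nlt] := leqP (N (t + dl) w) q.+1.
    rewrite {1}/g1 (_ : (_ - _)%N = 0%N); last by apply/eqP; rewrite subn_eq0.
    by rewrite addr_ge0 // mulr_ge0.
  have ex : exists i, (i <= m.+1)%N && (q < N (u m.+1 i) w)%N.
    by exists m.+1; rewrite leqnn utop ltnW.
  (* The first grid time at which the count exceeds [q]; it is not the initial one, since the count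
     there is [q]. *)
  have [[|i] /andP[im Ni] mini] := ex_minnP ex.
    by move: Ni; rewrite u_0 (AN w Aw) ltnn.
  have Nqi : N (u m.+1 i) w = q.
    apply/eqP; rewrite eqn_leq; apply/andP; split; last first.
      by rewrite -{1}(AN w Aw) -(u_0 m.+1) Nmono // ule.
    rewrite leqNgt; apply/negP => h.
    by have := mini i; rewrite h (ltnW im) ltnn => /(_ isT).
  have [N2|N2] := leqP (N (u m.+1 i.+1) w) q.+1.
    rewrite (bigD1 (Ordinal im)) //= indicE mem_set; last first.
      by split => //; split => //=; apply/eqP; rewrite eqn_leq N2.
    rewrite mul1r -addrA lerDl addr_ge0 ?mulr_ge0 //.
    by apply: sumr_ge0 => j _; rewrite mulr_ge0.
  have -> : E m.+1 w by apply/existsP; exists (Ordinal im); rewrite /= Nqi eqxx N2.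
  rewrite mul1r; apply: ler_wpDl => //.
  by rewrite ler_nat; apply: leq_sub2l.
(* The cells of the events [A_ m i] each consume one unit of the telescoping increment of [N]. *)
have sumA m w : A w -> \sum_(i < m.+1) \1_(A_ m.+1 i) w <= g w.
  move=> Aw; have Nt : N (u m.+1 0%N) w = q by rewrite u_0 AN.
  rewrite /g -(utop m).
  apply: (@le_trans _ _ (\sum_(i < m.+1) ((N (u m.+1 i.+1) w)%:R - (N (u m.+1 i) w)%:R))).
    apply: ler_sum => i _; have Nii := Nmono _ _ w (u0 m.+1 i) (ule m.+1 i i.+1 (leqnSn i)).
    rewrite indicE; case: (boolP (w \in _)); last by rewrite subr_ge0 ler_nat.
    by rewrite inE => -[_ [/= -> ->]]; rewrite -natrB // subSnn.
  rewrite -(big_mkord xpredT (fun i => (N (u m.+1 i.+1) w)%:R - (N (u m.+1 i) w)%:R : R)).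
  rewrite (telescope_sumr (fun i => (N (u m.+1 i) w)%:R : R)) // natrB ?Nt //.
  by rewrite -{1}Nt Nmono // ule.
pose r m := (\int[P]_(w in A) ((E m.+1 w)%:R * g w)%:E)%E.
(* On each path the error event fails once the mesh is small, and [g] is an integrable bound. *)
have r0 : r m @[m --> \oo] --> 0%E.
  have := @dominated_convergence _ _ _ P A mA (fun m w => ((E m.+1 w)%:R * g w)%:E)
    (cst 0%E) (EFin \o g).
  rewrite integral0 => -[] //.
  - move=> m; apply/measurable_EFinP/measurable_funTS; apply: measurable_funM => //.
    exact: measurable_bool_nat.
  - apply: aeW => w Aw; apply: cvg_near_cst.
    have [k _ Hk] := eventually_no_double_jump (cpN w) t0 dl0 (AN w Aw).
    exists k => // m /= km; rewrite (_ : E m.+1 w = false) ?mul0r //.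
    apply/negbTE/existsPn => i; apply/negP => /andP[/eqP h1].
    by rewrite ltnNge (Hk m.+1 (leqW km) i (ltn_ord i) h1).
  - by apply: aeW => w m Aw; rewrite /= lee_fin normrM !normr_nat ler_piMl //; case: (E m.+1 w).
have main m : (\int[P]_(w in A) (g1 w)%:E <= (L ^+ 2 * dl ^+ 2)%:E * P A + r m)%E.
  apply: (@le_trans _ _ (\int[P]_(w in A)
     ((\sum_(i < m.+1) \1_(A_ m.+1 i) w * g1 w)%:E + ((E m.+1 w)%:R * g w)%:E))%E).
    apply: ge0_le_integral => //.
    - by move=> w _; rewrite lee_fin.
    - exact/measurable_EFinP/measurable_funTS.
    - apply: emeasurable_funD; apply/measurable_EFinP/measurable_funTS.
        by apply: measurable_sum => i; apply: measurable_funM.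
      by apply: measurable_funM => //; exact: measurable_bool_nat.
    - by move=> w Aw; rewrite -EFinD lee_fin; exact: step.
  rewrite ge0_integralD //; last 4 first.
  - by move=> w _; rewrite lee_fin sumr_ge0 // => i _; rewrite mulr_ge0.
  - by apply/measurable_EFinP/measurable_funTS; apply: measurable_sum => i; apply: measurable_funM.
  - by move=> w _; rewrite lee_fin mulr_ge0.
  - by apply/measurable_EFinP/measurable_funTS; apply: measurable_funM => //; exact: measurable_bool_nat.
  rewrite -/(r m) leeD2r //.
  under eq_integral do rewrite -sumEFin.
  rewrite ge0_integral_sum //; last 2 first.
  - by move=> i; apply/measurable_EFinP/measurable_funTS; apply: measurable_funM.
  - by move=> i w _; rewrite lee_fin mulr_ge0.
  apply: (@le_trans _ _ (\sum_(i < m.+1) ((L * dl)%:E * P (A_ m.+1 i)))%E).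
    apply: lee_sum => i _.
    rewrite (eq_integral ((EFin \o g1) \_ (B_ m.+1 i))); last first.
      move=> w wA; rewrite /A_ indicE in_setI wA /= patchE.
      by case: ifP; rewrite ?mul1r ?mul0r.
    rewrite -integral_mkcondr.
    have ui : u m.+1 i.+1 <= t + dl by rewrite -(utop m); exact: ule.
    have tui : t <= u m.+1 i.+1 by rewrite -(u_0 m.+1); exact: ule.
    have := @count_increment_le_bound q.+1 (u m.+1 i.+1) (t + dl - u m.+1 i.+1) (A_ m.+1 i).
    rewrite subrKC => /(_ (u0 _ _)) H.
    apply: (le_trans (H _ _ _ _ _)).
    - by rewrite subr_ge0.
    - apply: le_trans adl; rewrite ler_wpM2l //; lra.
    - exact: FA_.
    - by move=> w [_ []].
    - by move=> w [/Ab].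
    apply: lee_wpmul2r => //; rewrite lee_fin /L mulrAC ler_wpM2l //; lra.
  rewrite -ge0_sume_distrr //.
  rewrite !expr2 mulrACA [in leRHS]EFinM -[leRHS]muleA.
  apply: lee_wpmul2l; first by rewrite lee_fin mulr_ge0.
  apply: le_trans gle.
  rewrite (eq_bigr (fun i : 'I_m.+1 => \int[P]_(w in A) (\1_(A_ m.+1 i) w)%:E)%E); last first.
    move=> i _; rewrite integral_indic // setIC.
    by congr (P _); apply/esym/setIidr; exact: subIsetl.
  rewrite -ge0_integral_sum //; last first.
    by move=> i; apply/measurable_EFinP/measurable_funTS.
  apply: ge0_le_integral => //.
  - by move=> w _; apply: sume_ge0 => i _; rewrite lee_fin.
  - by apply: emeasurable_sum => i; apply/measurable_EFinP/measurable_funTS.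
  - exact/measurable_EFinP/measurable_funTS.
  - by move=> w Aw; rewrite sumEFin lee_fin; exact: sumA.
have fc : ((L ^+ 2 * dl ^+ 2)%:E * P A)%E \is a fin_num.
  by rewrite fin_numM // fin_num_measure.
apply: (@lee_cvg_to _ \oo _ _ (cst _) (fun m => (L ^+ 2 * dl ^+ 2)%:E * P A + r m)%E).
- exact: cvg_cst.
- rewrite -[X in _ --> X]adde0; apply: cvgeD => //; last exact: cvg_cst.
  by rewrite fin_num_adde_defr.
- by apply: nearW => m; exact: main.
Qed.

End double_jumps.

(** * Increments tested against weights known at time [t] *)

Section weighted_increments.
Context (R : realType) d (T : measurableType d) (P : probability T R).
Context (xi alpha beta : R) (F : R -> set (set T)).
Context (lambda0 : {RV P >-> R}) (N : R -> T -> nat).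
Hypothesis xi0 : 0 < xi.
Hypothesis alpha0 : 0 <= alpha.
Hypothesis beta0 : 0 < beta.
Hypothesis hawkesN : hawkes_process xi alpha beta F lambda0 N.
Local Notation FT t := (g_sigma_algebraType (F t)).
Local Notation lam := (hist_intens xi alpha beta lambda0 N).
Let filF := hawkes_filtration hawkesN.
Let cpN := hawkes_counting hawkesN.
Let lam_ge0 := hist_intens_ge0 xi0 alpha0 hawkesN.
Let lam_le := hist_intens_le alpha0 beta0 hawkesN.
Let mlam := measurable_hist_intens hawkesN.
Let mcount := count_measurable hawkesN.
Let acount := count_adapted hawkesN.
Let al0 := hawkes_lambda0_adapted hawkesN.

Section weight.
Variables (b : R) (q : nat) (t : R) (Z : T -> R).
Hypothesis b0 : 0 <= b.
Hypothesis t0 : 0 <= t.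
Hypothesis mZ : measurable_fun setT (Z : FT t -> R).
Hypothesis Z0 : forall w, 0 <= Z w.
Hypothesis ZM : exists M, forall w, Z w <= M.
Hypothesis ZN : forall w, Z w != 0 -> N t w = q /\ lambda0 w <= b.

Lemma weight_measurable : measurable_fun setT Z.
Proof. exact: (measurableT_comp mZ (measurable_filtration_id filF t0)). Qed.

Lemma weight_bounded : bounded_mfun Z.
Proof.
split; first exact: weight_measurable.
by have [M HM] := ZM; exists M => w; rewrite ger0_norm.
Qed.

Lemma weight_bounded_intens u : t <= u -> bounded_mfun (fun w => Z w * lam q u w).
Proof.
move=> tu; split; first exact: measurable_funM weight_measurable (mlam q u).
have [M HM] := ZM; exists (M * (b + alpha * q%:R)) => w.
have M0 : 0 <= M by apply: le_trans (HM w).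
have [->|/ZN[Nq lb]] := eqVneq (Z w) 0.
  by rewrite mul0r normr0 mulr_ge0 // addr_ge0 // mulr_ge0.
rewrite ger0_norm; last by rewrite mulr_ge0.
apply: ler_pM => //; apply: lam_le => //; first exact: le_trans tu.
by rewrite -Nq; apply: (counting_path_le (cpN w)).
Qed.

(** [le_integral_weighted] is applied to the identity from the full sigma-algebra to [F t], so an
    inequality on events of [F t] extends to nonnegative [F t]-measurable weights. As it is
    available only where [N t w = q] and [lambda0 w <= b], the indicator of this set is joined to
    [f] and [g]; this changes nothing, since [Z] vanishes elsewhere. *)
Lemma ler_expect_weighted (f g : T -> R) :
  measurable_fun setT f -> measurable_fun setT g ->
  (forall w, 0 <= f w) -> (forall w, 0 <= g w) ->
  bounded_mfun (fun w => Z w * f w) -> bounded_mfun (fun w => Z w * g w) ->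
  (forall A, F t A -> (forall w, A w -> N t w = q) ->
    (forall w, A w -> lambda0 w <= b) ->
    (\int[P]_(w in A) (f w)%:E <= \int[P]_(w in A) (g w)%:E)%E) ->
  \int[P]_w (Z w * f w) <= \int[P]_w (Z w * g w).
Proof.
move=> mf mg f0 g0 bf bg H.
rewrite -lee_fin -!expect_EFin //.
pose S := [set w | N t w = q] `&` (lambda0 @^-1` `]-oo, b]).
have FS : F t S.
  by apply: (filtrationI filF) => //; [exact: (acount [set n | n = q])|exact: al0].
have mS : measurable S by exact: (filtration_measurable filF t0 FS).
have SE (h : T -> R) w : \1_S w * h w * Z w = Z w * h w.
  have [->|/ZN[Nq lb]] := eqVneq (Z w) 0; first by rewrite mulr0 mul0r.
  by rewrite indicE mem_set ?mul1r 1?mulrC //; split => //=; rewrite in_itv.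
have E (h : T -> R) : (\int[P]_w (Z w * h w)%:E =
    \int[P]_w ((\1_S w * h w)%:E * (Z w)%:E))%E.
  by apply: eq_integral => w _; rewrite -EFinM SE.
rewrite !E.
apply: (@le_integral_weighted R _ (FT t) _ _ _ _ P P id id _ _ _ _ _ _ _ _ _ (EFin \o Z)).
- exact: measurable_filtration_id.
- exact: measurable_filtration_id.
- exact: measurable_funM.
- exact: measurable_funM.
- by move=> w; rewrite mulr_ge0.
- by move=> w; rewrite mulr_ge0.
- move=> B /(filtrationP filF _ t0) FB.
  have EB (h : T -> R) : (\int[P]_w ((\1_S w * h w)%:E * (\1_B w)%:E) =
      \int[P]_(w in S `&` B) (h w)%:E)%E.
    rewrite [RHS]integral_mkcond; apply: eq_integral => w _; rewrite patchE in_setI -EFinM.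
    by rewrite !indicE; case: (w \in S); case: (w \in B); rewrite /= ?(mul1r,mul0r,mulr1,mulr0).
  rewrite !EB; apply: H.
  + exact: (filtrationI filF).
  + by move=> w [[]].
  + by move=> w [[_ /=]]; rewrite in_itv.
- exact/measurable_EFinP.
- by move=> w; rewrite lee_fin.
Qed.

Variable dl : R.
Hypothesis dl0 : 0 < dl.
Hypothesis adl : alpha * dl <= 2^-1.

Let td0 : 0 <= t + dl. Proof. by rewrite addr_ge0 // ltW. Qed.
Let tdl : t <= t + dl. Proof. by rewrite lerDl ltW. Qed.
Let ad0 : 0 <= alpha * dl. Proof. by rewrite mulr_ge0 // ltW. Qed.
Let mcf (f : nat -> R) : measurable_fun setT (fun w => f (N (t + dl) w)).
Proof. exact: (measurable_count_fun hawkesN f td0). Qed.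
Let bcount (p : nat -> bool) : bounded_mfun (fun w => (p (N (t + dl) w))%:R : R).
Proof. by apply: bounded_mfun_bool; exact: (mcount [set n | p n]). Qed.

Lemma expect_jump_le :
  \int[P]_w (Z w * (q < N (t + dl) w)%N%:R) <=
  dl * (1 + 2 * alpha * dl) * \int[P]_w (Z w * lam q t w).
Proof.
have c0 : 0 <= dl * (1 + 2 * alpha * dl).
  by rewrite mulr_ge0 ?(ltW dl0) // -mulrA addr_ge0 // mulr_ge0.
have bl := weight_bounded_intens (lexx t).
rewrite -expectZ //.
under [leRHS]eq_Rintegral do rewrite mulrCA.
apply: ler_expect_weighted.
- exact: (mcf (fun n => (q < n)%N%:R)).
- by apply: measurable_funM => //; exact: mlam.
- by [].
- by move=> w; rewrite mulr_ge0.
- by apply: bounded_mfunM; [exact: weight_bounded|exact: (bcount (fun n => q < n)%N)].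
- by under eq_fun do rewrite mulrCA; exact: bounded_mfunZ.
- move=> A FA AN Ab; have mA : measurable A by exact: (filtration_measurable filF t0 FA).
  apply: (@le_trans _ _ (\int[P]_(w in A) ((N (t + dl) w - q)%N%:R : R)%:E)%E).
    apply: ge0_le_integral => //.
    - exact/measurable_EFinP/measurable_funTS/(mcf (fun n => (q < n)%N%:R)).
    - exact/measurable_EFinP/measurable_funTS/(mcf (fun n => (n - q)%N%:R)).
    - by move=> w _; rewrite lee_fin ler_nat; case: ltnP => //; rewrite subn_gt0.
  apply: (le_trans (count_increment_le xi0 alpha0 beta0 hawkesN t0 dl0 adl FA AN Ab)).
  under [leRHS]eq_integral do rewrite EFinM.
  rewrite ge0_integralZl_EFin //.
  + by move=> w _; rewrite lee_fin.
  + exact/measurable_EFinP/measurable_funTS/mlam.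
Qed.

Let C := (2 * (b + alpha * q.+1%:R)) ^+ 2.

Lemma expect_double_jump_le :
  \int[P]_w (Z w * (q.+1 < N (t + dl) w)%N%:R) <= C * dl ^+ 2 * \int[P]_w Z w.
Proof.
have bZ := weight_bounded.
rewrite -expectZ //.
under [leRHS]eq_Rintegral do rewrite mulrC.
apply: (@ler_expect_weighted _ (cst (C * dl ^+ 2))).
- exact: (mcf (fun n => (q.+1 < n)%N%:R)).
- by [].
- by [].
- by move=> w; rewrite mulr_ge0 // sqr_ge0.
- by apply: bounded_mfunM => //; exact: (bcount (fun n => q.+1 < n)%N).
- by apply: bounded_mfunM => //; exact: bounded_mfun_cst.
- move=> A FA AN Ab; have mA : measurable A by exact: (filtration_measurable filF t0 FA).
  rewrite [leRHS](_ : _ = ((C * dl ^+ 2)%:E * P A)%E); last by rewrite -integral_cst.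
  apply: le_trans (double_increment_le xi0 alpha0 beta0 hawkesN b0 t0 dl0 adl FA AN Ab).
  apply: ge0_le_integral => //.
  - exact/measurable_EFinP/measurable_funTS/(mcf (fun n => (q.+1 < n)%N%:R)).
  - exact/measurable_EFinP/measurable_funTS/(mcf (fun n => (n - q.+1)%N%:R)).
  - by move=> w _; rewrite lee_fin ler_nat; case: ltnP => //; rewrite subn_gt0.
Qed.

(** The expected increment exceeds the probability of a jump by the expected number of jumps beyond
    the first, which [double_increment_le] bounds. *)
Lemma expect_jump_ge :
  dl * \int[P]_w (Z w * lam q (t + dl) w) <=
  \int[P]_w (Z w * (q < N (t + dl) w)%N%:R) + C * dl ^+ 2 * \int[P]_w Z w.
Proof.
have bZ := weight_bounded.
have bl := weight_bounded_intens tdl.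
have bj : bounded_mfun (fun w => Z w * (q < N (t + dl) w)%N%:R).
  by apply: bounded_mfunM => //; exact: (bcount (fun n => q < n)%N).
rewrite -!expectZ // -expectD //; last exact: bounded_mfunZ.
under [leLHS]eq_Rintegral do rewrite mulrCA.
under [leRHS]eq_Rintegral do rewrite (mulrC _ (Z _)) -mulrDr.
apply: ler_expect_weighted.
- by apply: measurable_funM => //; exact: mlam.
- exact: (mcf (fun n => (q < n)%N%:R + C * dl ^+ 2)).
- by move=> w; rewrite mulr_ge0 // ltW.
- by move=> w; rewrite addr_ge0 // mulr_ge0 // sqr_ge0.
- by under eq_fun do rewrite mulrCA; exact: bounded_mfunZ.
- under eq_fun do rewrite mulrDr; apply: bounded_mfunD => //.
  by apply: bounded_mfunM => //; exact: bounded_mfun_cst.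
- move=> A FA AN Ab; have mA : measurable A by exact: (filtration_measurable filF t0 FA).
  under [leLHS]eq_integral do rewrite EFinM.
  rewrite ge0_integralZl_EFin //; last 3 first.
  + by move=> w _; rewrite lee_fin.
  + exact/measurable_EFinP/measurable_funTS/mlam.
  + exact: ltW.
  apply: (le_trans (count_increment_ge xi0 alpha0 beta0 hawkesN t0 dl0 adl FA AN Ab)).
  under [leRHS]eq_integral do rewrite EFinD.
  rewrite ge0_integralD //; last 2 first.
  + exact/measurable_EFinP/measurable_funTS/(mcf (fun n => (q < n)%N%:R)).
  + by move=> w _; rewrite lee_fin mulr_ge0 // sqr_ge0.
  rewrite [X in (_ <= _ + X)%E](_ : _ = ((C * dl ^+ 2)%:E * P A)%E); last by rewrite -integral_cst.
  apply: le_trans; last first.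
    apply: leeD; first exact: lexx.
    exact: (double_increment_le xi0 alpha0 beta0 hawkesN b0 t0 dl0 adl FA AN Ab).
  rewrite -ge0_integralD //; last 2 first.
  + exact/measurable_EFinP/measurable_funTS/(mcf (fun n => (q < n)%N%:R)).
  + exact/measurable_EFinP/measurable_funTS/(mcf (fun n => (n - q.+1)%N%:R)).
  (* With truncated subtraction, [n - q] is the indicator of [q < n] plus [n - q.+1]. *)
  rewrite le_eqVlt; apply/orP; left; apply/eqP; apply: eq_integral => w _.
  rewrite -EFinD -natrD; congr (_%:R%:E).
  case: ltnP => h; first by rewrite add1n subnSK.
  by move: (h); rewrite -subn_eq0 => /eqP ->; move: (leqW h); rewrite -subn_eq0 => /eqP ->.
Qed.

End weight.

End weighted_increments.

(** Through [expR (- x) <= (1 + x)^-1]. *)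
Lemma expRN_le (R : realType) (x : R) : 0 <= x -> expR (- x) <= 1 - x + x ^+ 2.
Proof.
move=> x0; rewrite expRN.
have h : 1 + x <= expR x by exact: expR_ge1Dx.
have p : 0 < 1 + x by rewrite ltr_pwDl.
apply: (@le_trans _ _ (1 + x)^-1); first by rewrite lef_pV2 ?posrE // expR_gt0.
rewrite -[leLHS]mul1r ler_pdivrMr //.
have : 0 <= x * x ^+ 2 by rewrite mulr_ge0 // sqr_ge0.
rewrite expr2; lra.
Qed.

(** The summand 1 keeps the threshold positive when [a = 0]. *)
Lemma mul_step_size (R : realType) (a x : R) : 0 <= a ->
  x <= (2 * a + 1)^-1 -> a * x <= 2^-1.
Proof.
move=> a0 /(ler_wpM2l a0) /le_trans; apply.
have p : 0 < 2 * a + 1 by rewrite ltr_wpDl // mulr_ge0.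
by rewrite ler_pdivrMr //; lra.
Qed.

(** From [expR (K * x) * (1 - K * x) <= 1]. It is used with [x = dl ^+ 2], so that the correction is
    quadratic in the step. *)
Lemma expR_le_quad (R : realType) (x K : R) : 0 <= x -> x <= 1 -> 0 <= K ->
  expR (K * x) <= 1 + K * expR K * x.
Proof.
move=> x0 x1 K0.
have h : 1 - K * x <= expR (- (K * x)) by exact: expR_ge1Dx.
have e0 : 0 < expR (K * x) by exact: expR_gt0.
have := ler_wpM2l (ltW e0) h; rewrite -expRD subrr expR0 => h1.
have h2 : expR (K * x) <= expR K by rewrite ler_expR ler_piMr.
have : expR (K * x) * (K * x) <= expR K * (K * x) by rewrite ler_wpM2r // mulr_ge0.
lra.
Qed.

(** * Measurability of the history at time [t] *)

Section adapted_history.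
Context (R : realType) d (T : measurableType d) (P : probability T R).
Context (xi alpha beta : R) (F : R -> set (set T)).
Context (lambda0 : {RV P >-> R}) (N : R -> T -> nat).
Hypothesis xi0 : 0 < xi.
Hypothesis alpha0 : 0 <= alpha.
Hypothesis beta0 : 0 < beta.
Hypothesis hawkesN : hawkes_process xi alpha beta F lambda0 N.
Local Notation FT t := (g_sigma_algebraType (F t)).
Local Notation lam := (hist_intens xi alpha beta lambda0 N).
Let filF := hawkes_filtration hawkesN.
Let cpN := hawkes_counting hawkesN.
Let acount := count_adapted hawkesN.
Let al0 := hawkes_lambda0_adapted hawkesN.

Lemma measurable_count_eq (t : R) k : 0 <= t ->
  measurable ([set w | N t w = k] : set (FT t)).
Proof. by move=> t0; apply/(filtrationP filF _ t0); exact: (acount [set n | n = k]). Qed.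

(** On [N t w = k] the first [k] jumps lie before or at [t], so for [x >= 0] the event
    [jump_time N i w <= x] can be read off the count at time [min x t]. Outside this event the jump
    time may depend on the future. *)
Lemma jump_time_adapted (t : R) i k : 0 <= t -> (i <= k)%N ->
  measurable_fun (T := FT t) [set w | N t w = k] (jump_time N i).
Proof.
move=> t0 ik; apply: (measurable_fun_sublevel (T := FT t)) => [|x].
  exact: measurable_count_eq.
have [x0|x0] := ltP x 0.
  rewrite (_ : _ `&` _ = set0) //; apply/seteqP; split => // w [_ /= Tx].
  by have := lt_le_trans x0 (jump_time_nneg N i w); rewrite ltNge Tx.
have y0 : 0 <= Num.min x t by rewrite le_min x0.
have yt : Num.min x t <= t by rewrite ge_min lexx orbT.
rewrite (_ : _ `&` _ =
    [set w | N t w = k] `&` [set w | (i <= N (Num.min x t) w)%N]).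
  apply/(filtrationP filF _ t0); apply: (filtrationI filF) => //.
    exact: (acount [set n | n = k]).
  apply: (filtration_le filF y0 yt).
  exact: (acount [set n | (i <= n)%N]).
have iff w : N t w = k ->
    (jump_time N i w <= x) = (i <= N (Num.min x t) w)%N.
  move=> Nt; have iN : (i <= N t w)%N by rewrite Nt.
  rewrite (leq_countP (cpN w) t0 iN y0) le_min.
  by rewrite (jump_time_le t0 iN) andbT.
by apply/seteqP; split=> w /= [Nt]; rewrite -(iff w Nt).
Qed.

Lemma lambda0_adapted (t : R) : 0 <= t -> measurable_fun setT (lambda0 : FT t -> R).
Proof.
by move=> t0 _ B mB; rewrite setTI; apply/(filtrationP filF _ t0); exact: al0.
Qed.

Lemma intens_measurable_fun d' (U : measurableType d') (D : set U) k
    (u y : U -> R) (r : nat -> U -> R) : measurable_fun D u -> measurable_fun D y ->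
  (forall i, (0 < i <= k)%N -> measurable_fun D (r i)) ->
  measurable_fun D (fun x => intens xi alpha beta k (u x) (y x) (r ^~ x)).
Proof.
move=> mu my mr; elim: k mr => [|k IH] mr.
  under eq_fun do rewrite /intens big_geq //.
  apply: measurable_funD => //; apply: measurable_funD => //.
  apply: measurable_funM; first exact: measurable_funB.
  apply: measurableT_comp; first exact: measurable_expR.
  exact: measurable_funM.
under eq_fun do rewrite intens_recr.
apply: measurable_funD.
  by apply: IH => i /andP[i0 ik]; apply: mr; rewrite i0 ltnW.
apply: measurable_funM => //; apply: measurableT_comp; first exact: measurable_expR.
apply: measurable_funM => //; apply: measurable_funB => //.
by apply: mr; rewrite leqnn.
Qed.

Lemma hist_intens_adapted (t u : R) k : 0 <= t ->
  measurable_fun (T := FT t) [set w | N t w = k] (lam k u).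
Proof.
move=> t0; apply: (@intens_measurable_fun _ (FT t) _ _ (fun=> u)) => //.
  by apply: measurable_funTS; exact: lambda0_adapted.
by move=> i /andP[_ ik]; exact: jump_time_adapted.
Qed.

(** Multiplication by the indicator turns measurability on the event [N t w = k] into measurability
    on the whole space, as required of the weights. *)
Lemma weight_adapted (t : R) k (f : T -> R) : 0 <= t ->
  measurable_fun (T := FT t) [set w | N t w = k] (f) ->
  measurable_fun setT ((fun w => (N t w == k)%:R * f w) : FT t -> R).
Proof.
move=> t0 mf.
rewrite (_ : (fun w => _) = (f : FT t -> R) \_ [set w | N t w = k]).
  by apply/(measurable_restrictT _ _).1 => //; exact: measurable_count_eq.
apply/funext => w; rewrite patchE.
have [h|h] := eqVneq (N t w) k; first by rewrite mem_set // mul1r.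
by rewrite memNset ?mul0r //=; apply/eqP.
Qed.

Lemma lambda0_indic_adapted (t : R) (B : set R) : 0 <= t -> measurable B ->
  measurable_fun setT ((fun w => \1_B (lambda0 w)) : FT t -> R).
Proof.
move=> t0 mB.
have m1 : measurable_fun setT (\1_B : R -> R) by exact: measurable_indic.
exact: (measurableT_comp m1 (lambda0_adapted t0)).
Qed.

End adapted_history.

(** * Exponential moments *)

Section exponential_moment.
Context (R : realType) d (T : measurableType d) (P : probability T R).
Context (xi alpha beta : R) (F : R -> set (set T)).
Context (lambda0 : {RV P >-> R}) (N : R -> T -> nat).
Hypothesis xi0 : 0 < xi.
Hypothesis alpha0 : 0 <= alpha.
Hypothesis beta0 : 0 < beta.
Hypothesis hawkesN : hawkes_process xi alpha beta F lambda0 N.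
Local Notation FT t := (g_sigma_algebraType (F t)).
Local Notation lam := (hist_intens xi alpha beta lambda0 N).
Let filF := hawkes_filtration hawkesN.
Let cpN := hawkes_counting hawkesN.
Let l0ge := hawkes_lambda0_ge hawkesN.
Let lam_le := hist_intens_le alpha0 beta0 hawkesN.
Let mcount := count_measurable hawkesN.

Variables (b : R) (n : nat) (th kap : R) (B : set R).
Hypothesis b0 : 0 <= b.
Hypothesis th0 : 0 <= th.
Hypothesis kap0 : 0 <= kap.
Hypothesis thkap : expR (th + kap * alpha) - 1 <= kap * beta.
Hypothesis mB : measurable B.
Hypothesis Bb : forall y, B y -> y <= b.

(** A Lyapunov function of count and intensity. A jump multiplies it by at most [c], and [thkap]
    makes the gain [(c - 1) * lam] due to jumps at most the loss [kap * beta * lam] due to the decay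
    of the intensity. Only the constant drift [rho] remains. *)
Let V i t w := expR (th * i%:R + kap * lam i t w).
Let Y i t w : R := \1_B (lambda0 w) * (N t w == i)%:R.
Let rho := kap * beta * xi.
Let L := b + alpha * n%:R.
Let vmax := expR (th * n%:R + kap * L).
Let c := expR (th + kap * alpha).
Let C3 := (2 * (b + alpha * n.+1%:R)) ^+ 2.
Let K := kap * beta ^+ 2 * L.
Let C2 := expR rho * vmax * (K * expR K) + 2 * vmax * (c - 1) * alpha * L.

Let L0 : 0 <= L. Proof. by rewrite addr_ge0 // mulr_ge0. Qed.
Let K0 : 0 <= K. Proof. by rewrite !mulr_ge0 // ltW. Qed.
Let c1 : 1 <= c.
Proof. by rewrite -(expR0 R) ler_expR addr_ge0 // mulr_ge0. Qed.
Let rho0 : 0 <= rho. Proof. by rewrite !mulr_ge0 // ltW. Qed.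

Let YP i t w : Y i t w != 0 -> N t w = i /\ lambda0 w <= b.
Proof.
rewrite /Y indicE; have [wB|] := boolP (lambda0 w \in B); last by rewrite mul0r eqxx.
have [-> _|] := eqVneq (N t w) i; last by rewrite mulr0 eqxx.
by split => //; apply: Bb; exact: set_mem.
Qed.

Let Y01 i t w : 0 <= Y i t w <= 1.
Proof.
by rewrite /Y indicE; case: (_ \in _); case: (_ == _); rewrite ?mulr0 ?mul0r ?mulr1 ?lexx ?ler01.
Qed.

Let lamL i t u w : 0 <= t -> t <= u -> (i <= n)%N -> Y i t w != 0 -> lam i u w <= L.
Proof.
move=> t0 tu ni /YP[Ni lb].
apply: (@le_trans _ _ (b + alpha * i%:R)).
  apply: lam_le => //; first exact: le_trans tu.
  by rewrite -Ni; apply: (counting_path_le (cpN w)).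
by rewrite lerD2l ler_wpM2l // ler_nat.
Qed.

Let VL i t u w : 0 <= t -> t <= u -> (i <= n)%N -> Y i t w != 0 -> V i u w <= vmax.
Proof.
move=> t0 tu ni Yn; rewrite ler_expR lerD //; last first.
  by rewrite ler_wpM2l //; apply: lamL Yn.
by rewrite ler_wpM2l // ler_nat.
Qed.

Let mY i t : 0 <= t -> measurable_fun setT (Y i t : FT t -> R).
Proof.
move=> t0; rewrite /Y; under eq_fun do rewrite mulrC.
by apply: (weight_adapted hawkesN) => //; apply: measurable_funTS;
  exact: (lambda0_indic_adapted hawkesN).
Qed.

Let mYV i t u : 0 <= t ->
  measurable_fun setT ((fun w => Y i t w * V i u w) : FT t -> R).
Proof.
move=> t0; rewrite /Y; under eq_fun do rewrite (mulrC (\1_B _)) -mulrA.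
apply: (weight_adapted hawkesN) => //; apply: measurable_funM.
  by apply: measurable_funTS; exact: (lambda0_indic_adapted hawkesN).
apply: measurableT_comp; first exact: measurable_expR.
apply: measurable_funD => //; apply: measurable_funM => //.
exact: (hist_intens_adapted hawkesN).
Qed.

Let bY i t : 0 <= t -> bounded_mfun (Y i t).
Proof.
move=> t0; split.
  exact: (measurableT_comp (mY i t0) (measurable_filtration_id filF t0)).
by exists 1 => w; have /andP[y0 y1] := Y01 i t w; rewrite ger0_norm.
Qed.

Let YVle i t u w : 0 <= t -> t <= u -> (i <= n)%N -> Y i t w * V i u w <= vmax.
Proof.
move=> t0 tu ni; have [->|Yn] := eqVneq (Y i t w) 0.
  by rewrite mul0r expR_ge0.
have /andP[y0 y1] := Y01 i t w.
by apply: le_trans (VL t0 tu ni Yn); rewrite ler_piMl // expR_ge0.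
Qed.

Let bYV i t u : 0 <= t -> t <= u -> (i <= n)%N ->
  bounded_mfun (fun w => Y i t w * V i u w).
Proof.
move=> t0 tu ni; split.
  exact: (measurableT_comp (mYV i u t0) (measurable_filtration_id filF t0)).
exists vmax => w; have /andP[y0 y1] := Y01 i t w.
by rewrite ger0_norm; [exact: YVle|rewrite mulr_ge0 // expR_ge0].
Qed.

(** Truncation at count [n] keeps every quantity bounded; paths that leave this range are simply
    lost, which is harmless for an upper bound. *)
Let G t := \sum_(i < n.+1) \int[P]_w (Y i t w * V i t w).

(** The generator inequality in integrated form. By [thkap], [1 + (c - 1) * dl * x] is at most
    [expR (kap * beta * dl * x)], and this exponential cancels against the decay of the intensity up
    to [rho * dl] and terms of order [dl ^+ 2], which [K] and [C2] collect. *)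
Let step_pointwise t dl i w : 0 <= t -> 0 < dl -> dl <= 1 -> (i <= n)%N ->
  Y i t w * V i (t + dl) w * (1 + (c - 1) * (dl * (1 + 2 * alpha * dl)) * lam i t w)
  <= expR (rho * dl) * (Y i t w * V i t w) + C2 * dl ^+ 2.
Proof.
move=> t0 dl0 dl1 ni; have dl0' := ltW dl0.
have e0 (x : R) : 0 <= expR x by exact: expR_ge0.
have vm0 : 0 <= vmax by exact: expR_ge0.
have C20 : 0 <= C2.
  rewrite /C2; apply: addr_ge0; first by apply: mulr_ge0; apply: mulr_ge0.
  by rewrite !mulr_ge0 // subr_ge0.
have [->|Yn] := eqVneq (Y i t w) 0.
  by rewrite !mul0r mulr0 add0r mulr_ge0 // sqr_ge0.
have -> : Y i t w = 1.
  have YE : Y i t w = ((lambda0 w \in B) && (N t w == i))%:R by rewrite /Y indicE -natrM mulnb.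
  by move: Yn; rewrite YE; case: (_ && _); rewrite ?eqxx.
rewrite !mul1r.
have tdl : t <= t + dl by rewrite lerDl.
have xL := lamL t0 (lexx t) ni Yn.
have V'L := VL t0 tdl ni Yn.
have VtL := VL t0 (lexx t) ni Yn.
have xx : xi <= lam i t w by apply: intens_ge.
have x'E : lam i (t + dl) w = xi + (lam i t w - xi) * expR (- beta * dl).
  exact: intensD.
set x := lam i t w in xL xx x'E *.
have bd : 0 <= beta * dl by rewrite mulr_ge0 // ltW.
have x' : lam i (t + dl) w <= x - beta * dl * (x - xi) + beta ^+ 2 * dl ^+ 2 * L.
  have h := expRN_le bd; rewrite -mulNr in h.
  have h1 : 0 <= x - xi by rewrite subr_ge0.
  have := ler_wpM2l h1 h; rewrite x'E.
  have h2 : (x - xi) * (beta * dl) ^+ 2 <= L * (beta * dl) ^+ 2.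
    by rewrite ler_wpM2r ?sqr_ge0 //; move: xi0; lra.
  move: h2; rewrite exprMn; lra.
have ex : 1 + (c - 1) * dl * x <= expR (kap * beta * dl * x).
  apply: (@le_trans _ _ (1 + kap * beta * dl * x)); last exact: expR_ge1Dx.
  rewrite lerD2l; apply: ler_wpM2r; first by move: xi0; lra.
  by rewrite ler_wpM2r.
have main : V i (t + dl) w * (1 + (c - 1) * dl * x) <=
    expR (rho * dl) * V i t w + expR rho * vmax * (K * expR K) * dl ^+ 2.
  apply: (@le_trans _ _ (V i (t + dl) w * expR (kap * beta * dl * x))).
    by rewrite ler_wpM2l ?e0.
  apply: (@le_trans _ _ (expR (rho * dl) * V i t w * expR (K * dl ^+ 2))).
    rewrite /V -!expRD ler_expR.
    have := ler_wpM2l kap0 x'; rewrite /K /rho -/x; lra.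
  have d2 : dl ^+ 2 <= 1 by rewrite expr_le1.
  have := expR_le_quad (sqr_ge0 dl) d2 K0.
  move/(ler_wpM2l (_ : 0 <= expR (rho * dl) * V i t w)).
  rewrite mulr_ge0 ?e0 // => /(_ isT) /le_trans; apply.
  rewrite mulrDr mulr1 lerD2l.
  rewrite [leLHS]mulrA; apply: ler_wpM2r; first exact: sqr_ge0.
  apply: ler_wpM2r; first by rewrite mulr_ge0.
  apply: ler_pM => //; first by rewrite e0.
  by rewrite ler_expR ler_piMr.
have rest : V i (t + dl) w * ((c - 1) * (dl * (2 * alpha * dl)) * x) <=
    2 * vmax * (c - 1) * alpha * L * dl ^+ 2.
  apply: (@le_trans _ _ (vmax * ((c - 1) * (dl * (2 * alpha * dl)) * L))).
    have cc : 0 <= (c - 1) * (dl * (2 * alpha * dl)).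
      by rewrite !mulr_ge0 // subr_ge0.
    apply: ler_pM => //; first by rewrite e0.
      by rewrite mulr_ge0 //; move: xi0; lra.
    by rewrite ler_wpM2l.
  rewrite le_eqVlt; apply/orP; left; apply/eqP; ring.
have -> : V i (t + dl) w * (1 + (c - 1) * (dl * (1 + 2 * alpha * dl)) * x) =
  V i (t + dl) w * (1 + (c - 1) * dl * x) +
  V i (t + dl) w * ((c - 1) * (dl * (2 * alpha * dl)) * x) by ring.
rewrite /C2 [X in _ <= _ + X]mulrDl addrA; exact: lerD.
Qed.

Let C1 := n.+1%:R * (C2 + vmax * C3).

Let step t dl : 0 <= t -> 0 < dl -> dl <= 1 -> alpha * dl <= 2^-1 ->
  G (t + dl) <= expR (rho * dl) * G t + C1 * dl ^+ 2.
Proof.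
move=> t0 dl0 dl1 adl.
have tdl : t <= t + dl by rewrite lerDl ltW.
have td0 : 0 <= t + dl by apply: le_trans tdl.
have e0 (x : R) : 0 <= expR x by exact: expR_ge0.
pose Z i w := Y i t w * V i (t + dl) w.
pose J k w : R := (k < N (t + dl) w)%N%:R.
have bJ k : bounded_mfun (J k).
  by apply: bounded_mfun_bool; exact: (mcount [set m | (k < m)%N]).
have Y0 i s w : 0 <= Y i s w by have /andP[] := Y01 i s w.
have Z0 i w : 0 <= Z i w by rewrite mulr_ge0 ?e0.
have bT i : (i <= n)%N -> bounded_mfun (fun w =>
    Z i w + (c - 1) * (Z i w * J i w) + vmax * (Y i t w * J i.+1 w)).
  move=> ni; apply: bounded_mfunD; last first.
    by apply: bounded_mfunZ; apply: bounded_mfunM => //; exact: bY.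
  apply: bounded_mfunD; first exact: bYV.
  by apply: bounded_mfunZ; apply: bounded_mfunM => //; exact: bYV.
(* A path at level [i] stays there, or makes one jump, which multiplies [V] by at most [c], or makes
   several; for the last case the crude bound [vmax] is enough, its probability being of order
   [dl ^+ 2]. *)
have pw w : \sum_(j < n.+1) Y j (t + dl) w * V j (t + dl) w <=
    \sum_(i < n.+1) (Z i w + (c - 1) * (Z i w * J i w) + vmax * (Y i t w * J i.+1 w)).
  have T0 i : 0 <= Z i w + (c - 1) * (Z i w * J i w) + vmax * (Y i t w * J i.+1 w).
    by rewrite !addr_ge0 // !mulr_ge0 // ?subr_ge0 ?e0.
  have [Nn|Nn] := ltnP n (N (t + dl) w).
    rewrite big1 ?sumr_ge0 // => j _.
    rewrite /Y; case: eqP => [Nj|_]; last by rewrite mulr0 mul0r.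
    by move: Nn; rewrite Nj ltnNge -ltnS ltn_ord.
  have NN : (N t w <= N (t + dl) w)%N by apply: (counting_path_le (cpN w)).
  rewrite (bigD1 (Ordinal (Nn : (N (t + dl) w < n.+1)%N))) //= big1 ?addr0; last first.
    move=> j jn; rewrite /Y; case: eqP => [Nj|_]; last by rewrite mulr0 mul0r.
    by case/negP: jn; apply/eqP/val_inj.
  have ltn1 : (N t w < n.+1)%N by rewrite ltnS (leq_trans NN).
  rewrite (bigD1 (Ordinal ltn1)) //=.
  apply: ler_wpDr; first by rewrite sumr_ge0.
  rewrite /Z /Y /J !eqxx !mulr1.
  set e := \1_B _; have e00 : 0 <= e by rewrite /e.
  move: NN; rewrite leq_eqVlt => /predU1P[<-|].
    by rewrite ltnn !mulr0 addr0; apply: ler_wpDr => //; rewrite ltnNge ltnW ?mulr0.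
  move=> lt1; rewrite lt1 mulr1.
  move: lt1; rewrite leq_eqVlt => /predU1P[E|lt2]; last first.
    rewrite lt2 mulr1; apply: ler_wpDl.
      by rewrite addr_ge0 // !mulr_ge0 ?subr_ge0 ?e0.
    have [->|en] := eqVneq e 0; first by rewrite mul0r mulr0.
    rewrite mulrC ler_wpM2r //; apply: (VL td0 (lexx _) Nn).
    by rewrite /Y eqxx mulr1.
  rewrite -E ltnn !mulr0 addr0.
  have -> : e * V (N t w) (t + dl) w + (c - 1) * (e * V (N t w) (t + dl) w) =
     e * (c * V (N t w) (t + dl) w) by ring.
  rewrite ler_wpM2l // /c /V -expRD ler_expR.
  rewrite /hist_intens intens_recr.
  set l := intens _ _ _ _ _ _ _.
  have tt : expR (- beta * (t + dl - jump_time N (N t w).+1 w)) <= 1.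
    rewrite expR_le1 mulNr oppr_le0 mulr_ge0 ?(ltW beta0) // subr_ge0.
    by apply: jump_time_le => //; rewrite -E.
  have := ler_wpM2l kap0 (ler_wpM2l alpha0 tt).
  rewrite -natr1; lra.
apply: (@le_trans _ _ (\sum_(i < n.+1) \int[P]_w
   (Z i w + (c - 1) * (Z i w * J i w) + vmax * (Y i t w * J i.+1 w)))).
  have bD (i : 'I_n.+1) : bounded_mfun (fun w => Y i (t + dl) w * V i (t + dl) w).
    by apply: bYV => //; rewrite -ltnS.
  have bT' (i : 'I_n.+1) : bounded_mfun (fun w =>
    Z i w + (c - 1) * (Z i w * J i w) + vmax * (Y i t w * J i.+1 w)).
    by apply: bT; rewrite -ltnS.
  rewrite /G -!expect_sum //.
  by apply: ler_expect => //; exact: bounded_mfun_sum.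
have -> : C1 * dl ^+ 2 = \sum_(i < n.+1) (C2 + vmax * C3) * dl ^+ 2.
  by rewrite sumr_const card_ord -mulr_natl /C1 mulrA.
rewrite /G mulr_sumr -big_split /=.
apply: ler_sum => i _; have ni : (i <= n)%N by rewrite -ltnS.
have bZ : bounded_mfun (Z i) by exact: bYV.
have bZJ : bounded_mfun (fun w => Z i w * J i w) by exact: bounded_mfunM.
have bYJ : bounded_mfun (fun w => Y i t w * J i.+1 w).
  by apply: bounded_mfunM => //; exact: bY.
have ZP w : Z i w != 0 -> N t w = i /\ lambda0 w <= b.
  by move=> Zn; apply: (@YP i t); apply: contraNneq Zn => h; rewrite /Z h mul0r.
rewrite !expectD //; try (exact: bounded_mfunZ); last first.
  by apply: bounded_mfunD => //; exact: bounded_mfunZ.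
rewrite !expectZ //.
have Zb : exists M, forall w, Z i w <= M by exists vmax => w; exact: YVle.
have Yb : exists M, forall w, Y i t w <= M by exists 1 => w; have /andP[] := Y01 i t w.
have jl := expect_jump_le xi0 alpha0 beta0 hawkesN b0 t0 (mYV i (t + dl) t0) (Z0 i)
  Zb ZP dl0 adl.
have dj := expect_double_jump_le xi0 alpha0 beta0 hawkesN b0 t0 (mY i t0) (Y0 i t)
  Yb (@YP i t) dl0 adl.
have bZl : bounded_mfun (fun w => Z i w * lam i t w).
  exact: (weight_bounded_intens xi0 alpha0 beta0 hawkesN b0 t0 (mYV i (t + dl) t0) (Z0 i)
  Zb ZP (lexx t)).
have EY : \int[P]_w Y i t w <= 1.
  rewrite -[leRHS](expect_cst P 1); apply: ler_expect; first exact: bY.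
    exact: bounded_mfun_cst.
  by move=> w; have /andP[] := Y01 i t w.
have EY0 : 0 <= \int[P]_w Y i t w by apply: expect_ge0.
have d3 : vmax * \int[P]_w (Y i t w * J i.+1 w) <= vmax * C3 * dl ^+ 2.
  rewrite -mulrA ler_wpM2l ?e0 //; apply: (le_trans dj).
  rewrite -[leRHS]mulr1; apply: ler_pM => //.
  - by rewrite mulr_ge0 // sqr_ge0.
  - rewrite ler_wpM2r ?sqr_ge0 // /C3 ler_sqr ?nnegrE ?mulr_ge0 ?addr_ge0 ?mulr_ge0 //.
    by rewrite ler_wpM2l // lerD2l ler_wpM2l // ler_nat.
have d2 : \int[P]_w Z i w + (c - 1) * \int[P]_w (Z i w * J i w) <=
   expR (rho * dl) * \int[P]_w (Y i t w * V i t w) + C2 * dl ^+ 2.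
  apply: (@le_trans _ _ (\int[P]_w (Z i w + (c - 1) * (dl * (1 + 2 * alpha * dl)) * (Z i w * lam i t w)))).
    rewrite expectD //; last exact: bounded_mfunZ.
    by rewrite expectZ // lerD2l -mulrA ler_wpM2l // subr_ge0.
  rewrite -[X in _ <= X + _]expectZ; last exact: bYV.
  rewrite -[X in _ <= _ + X](expect_cst P) -expectD; last 2 first.
    by apply: bounded_mfunZ; exact: bYV.
    exact: bounded_mfun_cst.
  apply: ler_expect.
  - by apply: bounded_mfunD => //; exact: bounded_mfunZ.
  - apply: bounded_mfunD; last exact: bounded_mfun_cst.
    by apply: bounded_mfunZ; exact: bYV.
  - move=> w; have := step_pointwise w t0 dl0 dl1 ni; rewrite -/(Z i w).
    by rewrite mulrDr mulr1 [Z i w * (_ * lam i t w)]mulrCA.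
by rewrite [X in _ <= _ + X]mulrDl addrA; exact: lerD.
Qed.

Let G0 : G 0 <= expR (kap * b) * \int[P]_w \1_B (lambda0 w).
Proof.
have bB : bounded_mfun (fun w => \1_B (lambda0 w) : R).
  split; first by apply: (@measurableT_comp _ _ _ _ _ _ (\1_B : R -> R)) => //.
  by exists 1 => w; rewrite indicE; case: (_ \in _); rewrite ?normr1 // normr0 ler01.
rewrite -expectZ // /G -expect_sum; last first.
  by move=> i; apply: bYV => //; rewrite -ltnS.
apply: ler_expect.
- by apply: bounded_mfun_sum => i; apply: bYV => //; rewrite -ltnS.
- exact: bounded_mfunZ.
move=> w; rewrite (bigD1 ord0) //= big1 ?addr0; last first.
  move=> i i0; rewrite /Y (counting_path0 (cpN w)).
  by case: eqP => [E|]; [case/eqP: i0; apply/val_inj|rewrite mulr0 mul0r].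
rewrite /Y (counting_path0 (cpN w)) eqxx mulr1 mulrC indicE.
have [/set_mem/Bb wb|_] := boolP (lambda0 w \in B); last by rewrite !mulr0.
rewrite !mulr1 /V mulr0 add0r ler_expR ler_wpM2l //.
by rewrite /hist_intens /intens big_geq // addr0 mulr0 expR0 mulr1 subrKC.
Qed.

(** A discrete Gronwall argument: [G t * expR (- rho * t)] grows by at most [C1 * dl ^+ 2] per step,
    so [quad_iter] applies. Although [C1] depends on the truncation [n], the resulting bound does
    not. *)
Lemma exponential_moment_le (S : R) : 0 <= S ->
  \sum_(i < n.+1) \int[P]_w (\1_B (lambda0 w) * (N S w == i)%:R *
     expR (th * i%:R + kap * lam i S w)) <=
  expR (kap * beta * xi * S) * (expR (kap * b) * \int[P]_w \1_B (lambda0 w)).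
Proof.
move=> S0; rewrite -/(G S) -/rho.
suff H : G S * expR (- rho * S) <= G 0.
  rewrite mulrC -ler_pdivrMr ?expR_gt0 // -expRN -mulNr.
  exact: le_trans H G0.
apply/ler_addgt0Pr => e e0.
pose d0 := Num.min 1 (2 * alpha + 1)^-1.
have a1 : 0 < 2 * alpha + 1 by rewrite ltr_wpDl // mulr_ge0.
have C10 : 0 <= C1.
  have vm0 : 0 <= vmax by exact: expR_ge0.
  apply: mulr_ge0 => //; apply: addr_ge0; last by apply: mulr_ge0 => //; exact: sqr_ge0.
  apply: addr_ge0.
    by apply: mulr_ge0; apply: mulr_ge0 => //; exact: expR_ge0.
  by apply: mulr_ge0 => //; apply: mulr_ge0 => //; apply: mulr_ge0; rewrite ?subr_ge0 // mulr_ge0.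
have [|||e' /andP[e'0 e'e] H] :=
    @quad_iter R (fun t e => G t * expR (- rho * t) <= G 0 + e) S C1 d0 S0 _ C10 _ _ e e0.
- by rewrite lt_min ltr01 invr_gt0.
- move=> t dl e1 t0 dl0 + _ e10 IH; rewrite le_min => /andP[dl1 dla].
  have adl : alpha * dl <= 2^-1.
    exact: mul_step_size.
  have := step t0 dl0 dl1 adl.
  move/(ler_wpM2r (expR_ge0 (- rho * (t + dl)))) => /le_trans; apply.
  rewrite mulrDl addrA; apply: lerD.
    rewrite mulrAC -expRD (_ : _ + _ = - rho * t); last by ring.
    by rewrite mulrC.
  rewrite ler_piMr //; first by rewrite mulr_ge0 // sqr_ge0.
  by rewrite expR_le1 mulNr oppr_le0 mulr_ge0 // addr_ge0 // ltW.
- by rewrite mulr0 expR0 mulr1 addr0.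
- by apply: le_trans H _; rewrite lerD2l.
Qed.

End exponential_moment.

(** * Uniqueness of weighted image measures, and translations *)

Section weighted_uniqueness.
Local Open Scope ereal_scope.
Context (R : realType) dV (V : measurableType dV) d1 d2 (T1 : measurableType d1)
  (T2 : measurableType d2) (m1 : {measure set T1 -> \bar R})
  (m2 : {measure set T2 -> \bar R}).
Variables (Y1 : T1 -> V) (Y2 : T2 -> V) (w1 : T1 -> R) (w2 : T2 -> R).
Hypothesis mY1 : measurable_fun setT Y1.
Hypothesis mY2 : measurable_fun setT Y2.
Hypothesis mw1 : measurable_fun setT w1.
Hypothesis mw2 : measurable_fun setT w2.
Hypothesis w10 : forall x, (0 <= w1 x)%R.
Hypothesis w20 : forall x, (0 <= w2 x)%R.

Let I1 D := \int[m1]_(x in Y1 @^-1` D) (w1 x)%:E.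
Let I2 D := \int[m2]_(x in Y2 @^-1` D) (w2 x)%:E.

Let splitC d (T : measurableType d) (m : {measure set T -> \bar R}) (Y : T -> V)
    (w : T -> R) D : measurable_fun setT Y -> measurable_fun setT w ->
  (forall x, (0 <= w x)%R) -> measurable D ->
  \int[m]_x (w x)%:E = \int[m]_(x in Y @^-1` D) (w x)%:E +
    \int[m]_(x in Y @^-1` (~` D)) (w x)%:E.
Proof.
move=> mY mw w0 mD; rewrite -ge0_integral_setU //.
- by rewrite -preimage_setU setUv preimage_setT.
- by rewrite -[X in measurable X]setTI; exact: mY.
- by rewrite -[X in measurable X]setTI; apply: mY => //; exact: measurableC.
- exact/measurable_EFinP/measurable_funTS.
- by move=> x _; rewrite lee_fin.
- by apply/disj_setPS => x /= [].

Qed.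

(** Dynkin's argument for the images under [Y1] and [Y2] of the measures with densities [w1] and
    [w2]. Finite total mass permits the subtraction for complements. *)
Lemma eq_integral_weighted_preimage (G : set (set V)) :
  setI_closed G -> G `<=` measurable ->
  (\int[m1]_x (w1 x)%:E < +oo) ->
  \int[m1]_x (w1 x)%:E = \int[m2]_x (w2 x)%:E ->
  (forall D, G D -> I1 D = I2 D) -> forall D, <<s G>> D -> I1 D = I2 D.
Proof.
move=> GI Gm fin1 eqT eqG.
have mp d (T : measurableType d) (Y : T -> V) D : measurable_fun setT Y ->
    measurable D -> measurable (Y @^-1` D).
  by move=> mY mD; rewrite -[X in measurable X]setTI; exact: mY.
suff dyn : dynkin [set D | measurable D /\ I1 D = I2 D].
  move=> D sD; suff [] : [set D | measurable D /\ I1 D = I2 D] D by [].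
  move: D sD; apply: lambda_system_subset => //.
  - exact/dynkin_lambda_system.
  - by move=> D GD /=; split; [exact: Gm|exact: eqG].
split=> /=.
- by split => //; rewrite /I1 /I2 !preimage_setT.
- move=> D [mD eqD]; split; first exact: measurableC.
  have e1 := splitC m1 mY1 mw1 w10 mD; have e2 := splitC m2 mY2 mw2 w20 mD.
  have I10 : 0 <= I1 D by apply: integral_ge0 => x _; rewrite lee_fin.
  have I1C0 : 0 <= I1 (~` D) by apply: integral_ge0 => x _; rewrite lee_fin.
  have fD : I1 D \is a fin_num.
    rewrite ge0_fin_numE //; apply: le_lt_trans fin1.
    by rewrite e1 leeDl.
  move: eqT; rewrite e1 e2 -/(I1 D) -/(I2 D) -/(I1 (~` D)) -/(I2 (~` D)) -eqD => h.
  have /(congr1 (fun x => x - I1 D)) := h.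
  by rewrite addeAC subee // add0e addeAC subee // add0e.
- move=> F tF mF; split; first by apply: bigcupT_measurable => n; case: (mF n).
  have tp d (T : measurableType d) (Y : T -> V) (k : nat -> set T) :
      (forall n, k n = Y @^-1` F n) -> trivIset setT k.
    by move=> kE i j _ _ [x []]; rewrite !kE => Fi Fj; apply: tF => //; exists (Y x).
  have e d (T : measurableType d) (m : {measure set T -> \bar R}) (Y : T -> V) (w : T -> R) :
      measurable_fun setT Y -> measurable_fun setT w -> (forall x, (0 <= w x)%R) ->
      \int[m]_(x in Y @^-1` (\bigcup_k F k)) (w x)%:E =
      \sum_(n <oo) \int[m]_(x in Y @^-1` (F n)) (w x)%:E.
    move=> mY mw w0; rewrite preimage_bigcup ge0_integral_bigcup //.
    - by move=> n; apply: mp => //; case: (mF n).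
    - exact/measurable_EFinP/measurable_funTS.
    - by move=> x _; rewrite lee_fin.
    - exact: tp.
  rewrite /I1 /I2 !e //; apply: eq_eseriesr => n _; by case: (mF n).
Qed.

End weighted_uniqueness.

Section lebesgue_translation.
Context (R : realType).
Local Notation mu := (@lebesgue_measure R).

Let shift (h : R) : measurableTypeR R -> measurableTypeR R := fun x => x + h.

Let measurable_shift h : measurable_fun setT (shift h).
Proof. by apply: (@measurable_funD _ _ R) => //; exact: measurable_cst. Qed.

HB.instance Definition _ (h : R) :=
  isMeasurableFun.Build _ _ _ _ (shift h) (measurable_shift h).

(** Translations preserve the length of half-open intervals, and this determines the measure. *)
Lemma lebesgue_measure_translation (h : R) (A : set R) : measurable A ->
  pushforward mu (shift h) A = mu A.
Proof.
move=> mA; apply/esym/lebesgue_measure_unique => //= _ [[a b]] _ <-.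
rewrite /pushforward (_ : _ @^-1` _ = `]a - h, b - h]%classic); last first.
  by apply/seteqP; split => x /=; rewrite !in_itv /= ltrBlDr lerBrDr.
rewrite /= !lebesgue_measure_itv /= !lte_fin ltrD2r -!EFinB.
by case: ifP => // _; congr (_%:E); ring.
Qed.

Lemma ge0_integral_translation (h : R) (D : set R) (f : R -> \bar R) :
  measurable D -> measurable_fun setT f -> (forall x, 0 <= f x)%E ->
  (\int[mu]_(u in D) f u = \int[mu]_(u in [set u | D (u + h)%R]) f (u + h)%R)%E.
Proof.
move=> mD mf f0.
have := @ge0_integral_pushforward _ _ _ _ R _ (measurable_shift h) mu D f mD (measurable_funTS mf).
move=> /(_ (fun x _ => f0 x)) <-.
by apply: eq_measure_integral => A mA _; apply/esym/lebesgue_measure_translation.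
Qed.

End lebesgue_translation.

(** * Tail of the number of jumps *)

Section tail_estimate.
Context (R : realType) d (T : measurableType d) (P : probability T R).
Context (xi alpha beta : R) (F : R -> set (set T)).
Context (lambda0 : {RV P >-> R}) (N : R -> T -> nat).
Hypothesis xi0 : 0 < xi.
Hypothesis alpha0 : 0 <= alpha.
Hypothesis beta0 : 0 < beta.
Hypothesis hawkesN : hawkes_process xi alpha beta F lambda0 N.
Local Notation lam := (hist_intens xi alpha beta lambda0 N).
Let lam_ge0 := hist_intens_ge0 xi0 alpha0 hawkesN.
Let lam_le := hist_intens_le alpha0 beta0 hawkesN.
Let mlam := measurable_hist_intens hawkesN.
Let mcount := count_measurable hawkesN.

(** The exponential Markov inequality, used on [q <= N S w <= n] because the moment bound is
    truncated at [n]; then [n] tends to infinity, the bound being uniform in [n]. *)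
Lemma count_tail_le (b th kap : R) (B : set R) (q : nat) (S : R) :
  0 <= b -> 0 <= th -> 0 <= kap -> expR (th + kap * alpha) - 1 <= kap * beta ->
  measurable B -> (forall y, B y -> y <= b) -> 0 <= S ->
  \int[P]_w (\1_B (lambda0 w) * (q <= N S w)%N%:R) <=
  expR (- th * q%:R) * (expR (kap * beta * xi * S) *
    (expR (kap * b) * \int[P]_w \1_B (lambda0 w))).
Proof.
move=> b0 th0 kap0 thkap mB Bb S0.
set C := (X in _ <= X).
pose f n w : R := \1_B (lambda0 w) * (q <= N S w <= n)%N%:R.
have m1 : measurable_fun setT (fun w => \1_B (lambda0 w) : R).
  by apply: (@measurableT_comp _ _ _ _ _ _ (\1_B : R -> R)).
have b1 : bounded_mfun (fun w => \1_B (lambda0 w) : R).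
  by split => //; exists 1 => w; rewrite indicE; case: (_ \in _); rewrite ?normr1 // normr0 ler01.
have bf n : bounded_mfun (f n).
  apply: bounded_mfunM => //; apply: bounded_mfun_bool.
  exact: (mcount [set m | (q <= m <= n)%N]).
have bq : bounded_mfun (fun w => \1_B (lambda0 w) * (q <= N S w)%N%:R : R).
  apply: bounded_mfunM => //; apply: bounded_mfun_bool.
  exact: (mcount [set m | (q <= m)%N]).
have fC n : \int[P]_w f n w <= C.
  have := exponential_moment_le xi0 alpha0 beta0 hawkesN n b0 th0 kap0 thkap mB Bb S0.
  move/(ler_wpM2l (expR_ge0 (- th * q%:R))); apply: le_trans.
  set g := fun (i : 'I_n.+1) w => \1_B (lambda0 w) * (N S w == i)%:R *
    expR (th * i%:R + kap * lam i S w) : R.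
  have bg i : bounded_mfun (g i).
    split.
      apply: measurable_funM.
        apply: measurable_funM => //; apply: measurable_bool_nat.
        have := mcount [set m : nat | m = i :> nat] S0; congr measurable.
        by apply/seteqP; split => w /= /eqP.
      apply: measurableT_comp; first exact: measurable_expR.
      by apply: measurable_funD => //; apply: measurable_funM => //; exact: mlam.
    exists (expR (th * i%:R + kap * (b + alpha * i%:R))) => w.
    rewrite ger0_norm /g ?mulr_ge0 ?expR_ge0 //.
    have [wB|wB] := boolP (lambda0 w \in B); last first.
      by rewrite indicE (negbTE wB) !mul0r expR_ge0.
    case: eqP => [Ni|_]; last by rewrite mulr0 mul0r expR_ge0.
    rewrite indicE wB !mul1r ler_expR lerD2l ler_wpM2l // lam_le // ?Ni //.
    by apply: Bb; exact: set_mem.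
  rewrite -expect_sum // -expectZ; last exact: bounded_mfun_sum.
  apply: ler_expect => // [|w].
    by apply: bounded_mfunZ; exact: bounded_mfun_sum.
  have g0 i : 0 <= g i w by rewrite !mulr_ge0 ?expR_ge0.
  rewrite /f; case: (boolP (q <= N S w <= n)%N) => [/andP[qN Nn]|_]; last first.
    by rewrite mulr0 mulr_ge0 ?expR_ge0 // sumr_ge0.
  rewrite (bigD1 (Ordinal (Nn : (N S w < n.+1)%N))) //=.
  apply: (@le_trans _ _ (expR (- th * q%:R) * g (Ordinal (Nn : (N S w < n.+1)%N)) w)).
    rewrite /g /= eqxx !mulr1 mulrCA ler_peMr // -expRD.
    apply: le_trans (expR_ge1Dx _); rewrite lerDl.
    have h1 : th * q%:R <= th * (N S w)%:R by rewrite ler_wpM2l // ler_nat.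
    have h2 : 0 <= kap * lam (N S w) S w by rewrite mulr_ge0.
    by rewrite mulNr; move: h1 h2; set x := th * _; set y := th * _; set z := kap * _; lra.
  by rewrite ler_wpM2l ?expR_ge0 // lerDl sumr_ge0.
rewrite -lee_fin -expect_EFin //.
have lim : (\int[P]_w (f n w)%:E @[n --> \oo] -->
    \int[P]_w (\1_B (lambda0 w) * (q <= N S w)%N%:R)%:E)%E.
  have := @dominated_convergence _ _ _ P setT measurableT (fun n w => (f n w)%:E)
    (fun w => (\1_B (lambda0 w) * (q <= N S w)%N%:R)%:E) (cst 1%E).
  case => //.
  - by move=> n; apply/measurable_EFinP; case: (bf n).
  - by apply/measurable_EFinP; case: bq.
  - apply: aeW => w _; apply: cvg_near_cst; exists (N S w) => // n /= Nn.
    by rewrite /f Nn andbT.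
  - exact: (bounded_mfun_integrable P (bounded_mfun_cst T 1)).
  - apply: aeW => w n _; rewrite /= lee_fin /f indicE -natrM mulnb.
    by case: (_ && _); rewrite ?normr1 // normr0 ler01.
apply: (@lee_cvg_to _ \oo _ _ _ (cst C%:E) _ _ lim); first exact: cvg_cst.
by apply: nearW => n; rewrite expect_EFin // lee_fin.
Qed.

End tail_estimate.

(** * The law of the next jump time *)

(** [E] stands for the weight that jumps during a step, [r] for the jump rate at its beginning, [Eu]
    for the rate computed with the intensity at its end, and [EZ] for the total weight. *)
Lemma first_order_error (R : realType) (al be L C3 dl r E Eu EZ : R) :
  E <= dl * (1 + 2 * al * dl) * r ->
  dl * Eu <= E + C3 * dl ^+ 2 * EZ ->
  C3 * dl ^+ 2 * EZ <= C3 * dl ^+ 2 ->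
  0 <= C3 * dl ^+ 2 ->
  2 * al * dl ^+ 2 * r <= 2 * al * dl ^+ 2 * L ->
  dl * (r - be * dl * L) <= dl * Eu ->
  0 <= be * L * dl ^+ 2 ->
  0 <= al * L * dl ^+ 2 ->
  `|E - dl * r| <= (2 * al * L + be * L + C3) * dl ^+ 2.
Proof.
move=> up lo c3 C30 a1 a2 a3 a4.
rewrite ler_norml; apply/andP; split; lra.
Qed.

Section first_jump.
Context (R : realType) d (T : measurableType d) (P : probability T R).
Context (xi alpha beta : R) (F : R -> set (set T)).
Context (lambda0 : {RV P >-> R}) (N : R -> T -> nat).
Hypothesis xi0 : 0 < xi.
Hypothesis alpha0 : 0 <= alpha.
Hypothesis beta0 : 0 < beta.
Hypothesis hawkesN : hawkes_process xi alpha beta F lambda0 N.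
Local Notation FT t := (g_sigma_algebraType (F t)).
Local Notation lam := (hist_intens xi alpha beta lambda0 N).
Let filF := hawkes_filtration hawkesN.
Let cpN := hawkes_counting hawkesN.
Let l0ge := hawkes_lambda0_ge hawkesN.
Let lam_ge0 := hist_intens_ge0 xi0 alpha0 hawkesN.
Let lam_le := hist_intens_le alpha0 beta0 hawkesN.
Let mtau := measurable_jump_time hawkesN.
Let mcount := count_measurable hawkesN.

(** Joint measurability in path and time: for [u >= 0], having made [k] jumps by [u] means making
    [k] jumps at some time and having [jump_time N k w <= u]. The set [ever] removes the paths on
    which the jump time is junk. *)
Lemma measurable_count_ge_joint k :
  measurable [set x : T * R | 0 <= x.2 /\ (k <= N x.2 x.1)%N].
Proof.
pose ever := \bigcup_n [set w | (k <= N n%:R w)%N].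
have mever : measurable ever.
  by apply: bigcupT_measurable => n; exact: (mcount [set m | (k <= m)%N]).
have mT1 : measurable_fun setT (fun x : T * R => jump_time N k x.1).
  by apply: (measurableT_comp (mtau k)).
rewrite (_ : [set x | _] = [set x : T * R | 0 <= x.2] `&`
    ((fst @^-1` ever) `&` [set x : T * R | jump_time N k x.1 <= x.2])).
  apply: measurableI.
    rewrite -[X in measurable X]setTI; apply: (@measurable_fun_le _ _ R _ (cst 0)) => //.
  apply: measurableI; first by rewrite -[X in measurable X]setTI; exact: measurable_fst.
  by rewrite -[X in measurable X]setTI; apply: measurable_fun_le.
apply/seteqP; split=> -[w u] /= [u0].
  move=> kN; split => //; split; last exact: jump_time_le.
  exists (Num.truncn u).+1 => //=; apply: (leq_trans kN).
  by apply: (counting_path_le (cpN w)) => //; apply/ltW/truncnS_gt.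
move=> [[n _ /= kn] Tu]; split => //.
by rewrite (leq_countP (cpN w) _ kn).
Qed.

(** The condition [0 <= u] is built in because nothing is known of [N] at negative times; the
    indicator is then jointly measurable on all of [T * R]. *)
Definition count_ind (k : nat) (u : R) (w : T) : R :=
  ((0 <= u) && (N u w == k))%:R.
Local Notation J := count_ind.

Lemma count_indE k u w : 0 <= u -> J k u w = (N u w == k)%:R.
Proof. by rewrite /count_ind => ->. Qed.

Lemma measurable_count_ind k : measurable_fun setT (fun x : T * R => J k x.2 x.1).
Proof.
apply: measurable_bool_nat.
rewrite (_ : [set x | _] = [set x : T * R | 0 <= x.2 /\ (k <= N x.2 x.1)%N] `\`
   [set x : T * R | 0 <= x.2 /\ (k.+1 <= N x.2 x.1)%N]).
  by apply: measurableD; exact: measurable_count_ge_joint.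
apply/seteqP; split=> -[w u] /=.
  by move=> /andP[u0 /eqP ->]; rewrite leqnn ltnn; split => // -[].
move=> [[u0 kN] H]; rewrite u0 /= eqn_leq kN andbT leqNgt.
by apply/negP => h; apply: H.
Qed.

Lemma measurable_hist_intens_joint k :
  measurable_fun setT (fun x : T * R => lam k x.2 x.1).
Proof.
apply: (@intens_measurable_fun _ xi alpha beta _ _ _ k snd (lambda0 \o fst)
  (fun i x => jump_time N i x.1)) => //.
  by apply: measurableT_comp.
by move=> i _; apply: (measurableT_comp (mtau i)).
Qed.

Section rate.
Variables (b : R) (k : nat) (t0 : R) (W : T -> R).
Hypothesis b0 : 0 <= b.
Hypothesis t00 : 0 <= t0.
Hypothesis mW : measurable_fun setT W.
Hypothesis W01 : forall w, 0 <= W w <= 1.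
Hypothesis Wb : forall w, W w != 0 -> lambda0 w <= b.
Hypothesis Wk : forall u, t0 <= u ->
  measurable_fun (T := FT u) [set w | N u w = k] W.

Let W0 w : 0 <= W w. Proof. by have /andP[] := W01 w. Qed.
Let W1 w : W w <= 1. Proof. by have /andP[] := W01 w. Qed.
Let L := b + alpha * k%:R.
Let L0 : 0 <= L. Proof. by rewrite addr_ge0 // mulr_ge0. Qed.

(** The density at [u] of the time of jump [k.+1], weighted by [W]. The weight stands for
    information on the first [k] jumps, so it is [F u]-measurable only on the event [N u w = k]. *)
Definition jump_rate (u : R) : R := \int[P]_w (W w * J k u w * lam k u w).
Local Notation r := jump_rate.

Let Z u w := (N u w == k)%:R * W w.

Let mZ u : t0 <= u -> measurable_fun setT (Z u : FT u -> R).
Proof.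
by move=> tu; apply: (weight_adapted hawkesN); [exact: le_trans tu|exact: Wk].
Qed.

Let Z0 u w : 0 <= Z u w. Proof. by rewrite mulr_ge0. Qed.
Let Z1 u w : Z u w <= 1. Proof. by rewrite /Z; case: (_ == _); rewrite ?mul1r ?mul0r. Qed.
Let ZM u : exists M, forall w, Z u w <= M. Proof. by exists 1. Qed.
Let ZP u w : Z u w != 0 -> N u w = k /\ lambda0 w <= b.
Proof.
rewrite /Z; have [-> h|_] := eqVneq (N u w) k; last by rewrite mul0r eqxx.
by split => //; apply: Wb; rewrite mul1r in h.
Qed.

Let rE u : t0 <= u -> r u = \int[P]_w (Z u w * lam k u w).
Proof.
move=> tu; apply: eq_Rintegral => w _; rewrite count_indE; last exact: le_trans tu.
by rewrite /Z (mulrC (W w)).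
Qed.

Let bZl u v : t0 <= u -> u <= v -> bounded_mfun (fun w => Z u w * lam k v w).
Proof.
move=> tu uv; have u0 := le_trans t00 tu.
exact: (weight_bounded_intens xi0 alpha0 beta0 hawkesN b0 u0 (mZ tu) (Z0 u) (ZM u) (@ZP u)).
Qed.

Let Zl u v w : t0 <= u -> u <= v -> Z u w * lam k v w <= Z u w * L.
Proof.
move=> tu uv; have [->|/ZP[Nu lb]] := eqVneq (Z u w) 0; first by rewrite !mul0r.
rewrite ler_wpM2l // lam_le //.
  by rewrite (le_trans t00) // (le_trans tu).
rewrite -Nu; apply: (counting_path_le (cpN w)) => //; exact: le_trans tu.
Qed.

Let bZ u : t0 <= u -> bounded_mfun (Z u).
Proof.
move=> tu; have u0 := le_trans t00 tu.
split; first exact: (measurableT_comp (mZ tu) (measurable_filtration_id filF u0)).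
by exists 1 => w; rewrite ger0_norm.
Qed.

Let EZ1 u : t0 <= u -> \int[P]_w Z u w <= 1.
Proof.
move=> tu; rewrite -[leRHS](expect_cst P 1); apply: ler_expect => //.
  exact: bZ.
exact: bounded_mfun_cst.
Qed.

Lemma jump_rate_bounds u : t0 <= u -> 0 <= r u <= L.
Proof.
move=> tu; rewrite rE //; apply/andP; split.
  by apply: expect_ge0 => w; rewrite mulr_ge0.
rewrite -[leRHS](expect_cst P L); apply: ler_expect; first exact: bZl.
  exact: bounded_mfun_cst.
by move=> w; rewrite (le_trans (Zl _ tu (lexx u))) // ler_piMl.
Qed.

Let C3 := (2 * (b + alpha * k.+1%:R)) ^+ 2.

Let Y j u w : R := (N u w == j)%:R * \1_`]-oo, b] (lambda0 w).

Let mY j u : 0 <= u -> measurable_fun setT (Y j u : FT u -> R).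
Proof.
move=> u0; apply: (weight_adapted hawkesN) => //; apply: measurable_funTS.
exact: (lambda0_indic_adapted hawkesN).
Qed.

Let Y0 j u w : 0 <= Y j u w. Proof. by rewrite mulr_ge0. Qed.
Let Y1 j u w : Y j u w <= 1.
Proof. by rewrite /Y indicE -natrM mulnb; case: (_ && _). Qed.
Let YP j u w : Y j u w != 0 -> N u w = j /\ lambda0 w <= b.
Proof.
rewrite /Y indicE -natrM mulnb; case: (boolP (_ && _)); last by rewrite eqxx.
by move=> /andP[/eqP -> /set_mem /=]; rewrite in_itv.
Qed.
Let YM j u : exists M, forall w, Y j u w <= M. Proof. by exists 1. Qed.

Let bY j u : 0 <= u -> bounded_mfun (Y j u).
Proof.
move=> u0; split; first exact: (measurableT_comp (mY j u0) (measurable_filtration_id filF u0)).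
by exists 1 => w; rewrite ger0_norm.
Qed.

Let EY1 j u : 0 <= u -> \int[P]_w Y j u w <= 1.
Proof.
move=> u0; rewrite -[leRHS](expect_cst P 1); apply: ler_expect => //.
  exact: bY.
exact: bounded_mfun_cst.
Qed.

Let bcount (p : nat -> bool) t : 0 <= t -> bounded_mfun (fun w => (p (N t w))%:R : R).
Proof. by move=> t_0; apply: bounded_mfun_bool; exact: (mcount [set n | p n]). Qed.

Let jump_prob j t dl : 0 <= t -> 0 < dl -> alpha * dl <= 2^-1 -> (j <= k)%N ->
  \int[P]_w (Y j t w * (j < N (t + dl) w)%N%:R) <= 2 * L * dl.
Proof.
move=> t_0 dl0 adl jk.
apply: (le_trans (expect_jump_le xi0 alpha0 beta0 hawkesN b0 t_0 (mY j t_0) (Y0 j t)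
  (YM j t) (@YP j t) dl0 adl)).
have bl := weight_bounded_intens xi0 alpha0 beta0 hawkesN b0 t_0 (mY j t_0) (Y0 j t)
  (YM j t) (@YP j t) (lexx t).
have h1 : \int[P]_w (Y j t w * lam j t w) <= L.
  rewrite -[leRHS](expect_cst P L); apply: ler_expect => //.
    exact: bounded_mfun_cst.
  move=> w; have [->|/YP[Nt lb]] := eqVneq (Y j t w) 0; first by rewrite mul0r.
  rewrite -[leRHS]mul1r ler_pM // (le_trans (lam_le t_0 lb _)) ?Nt //.
  by rewrite lerD2l ler_wpM2l // ler_nat.
have h0 : 0 <= \int[P]_w (Y j t w * lam j t w).
  by apply: expect_ge0 => w; rewrite mulr_ge0.
have ad0 : 0 <= alpha * dl by rewrite mulr_ge0 // ltW.
rewrite [leRHS]mulrAC; apply: ler_pM => //.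
  by rewrite mulr_ge0 ?(ltW dl0) // -mulrA addr_ge0 // mulr_ge0.
by rewrite mulrC ler_wpM2r ?(ltW dl0) // -mulrA; lra.
Qed.

Let double_prob j t dl : 0 <= t -> 0 < dl -> alpha * dl <= 2^-1 -> (j <= k)%N ->
  \int[P]_w (Y j t w * (j.+1 < N (t + dl) w)%N%:R) <= C3 * dl ^+ 2.
Proof.
move=> t_0 dl0 adl jk.
apply: (le_trans (expect_double_jump_le xi0 alpha0 beta0 hawkesN b0 t_0 (mY j t_0) (Y0 j t)
  (YM j t) (@YP j t) dl0 adl)).
have EY0 : 0 <= \int[P]_w Y j t w by apply: expect_ge0.
rewrite -[leRHS]mulr1; apply: ler_pM => //; first by rewrite mulr_ge0 ?sqr_ge0.
  rewrite ler_wpM2r ?sqr_ge0 // /C3 ler_sqr ?nnegrE ?mulr_ge0 ?addr_ge0 ?mulr_ge0 //.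
  by rewrite ler_wpM2l // lerD2l ler_wpM2l // ler_nat.
exact: EY1.
Qed.

(** Level [k] is skipped only by making at least two jumps from some level [j < k], and each of
    these [k] levels contributes at most [C3 * dl ^+ 2]. *)
Lemma skip_level_prob t dl : 0 <= t -> 0 < dl -> alpha * dl <= 2^-1 ->
  \int[P]_w (\1_`]-oo, b] (lambda0 w) * (N t w < k < N (t + dl) w)%N%:R) <=
  k%:R * (C3 * dl ^+ 2).
Proof.
move=> t_0 dl0 adl; have td0 : 0 <= t + dl by rewrite addr_ge0 // ltW.
apply: (@le_trans _ _ (\int[P]_w (\sum_(j < k) (Y j t w * (j.+1 < N (t + dl) w)%N%:R)))).
  have bS (j : 'I_k) : bounded_mfun (fun w => Y j t w * (j.+1 < N (t + dl) w)%N%:R : R).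
    by apply: bounded_mfunM; [exact: bY|exact: (bcount (fun n => j.+1 < n)%N)].
  apply: ler_expect; last 2 first.
  - exact: bounded_mfun_sum.
  - move=> w; case: (boolP (N t w < k < N (t + dl) w)%N) => [/andP[Nk kN]|_]; last first.
      by rewrite mulr0 sumr_ge0 // => j _; rewrite mulr_ge0.
    rewrite (bigD1 (Ordinal Nk)) //= (leq_ltn_trans Nk kN) !mulr1 /Y eqxx mul1r.
    by rewrite lerDl sumr_ge0 // => j _; rewrite !mulr_ge0.
  apply: bounded_mfunM.
    split; first by apply: (@measurableT_comp _ _ _ _ _ _ (\1_`]-oo, b] : R -> R)).
    by exists 1 => w; rewrite indicE; case: (_ \in _); rewrite ?normr1 // normr0 ler01.
  apply: bounded_mfun_bool.
  rewrite (_ : [set w | _] = [set w | (N t w < k)%N] `&` [set w | (k < N (t + dl) w)%N]).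
    by apply: measurableI; [exact: (mcount [set n | (n < k)%N])|exact: (mcount [set n | (k < n)%N])].
  by apply/seteqP; split => w /= /andP.
rewrite expect_sum; last first.
  by move=> j; apply: bounded_mfunM; [exact: bY|exact: (bcount (fun n => j.+1 < n)%N)].
rewrite mulr_natl -[X in _ *+ X]card_ord -sumr_const; apply: ler_sum => j _.
by apply: double_prob => //; exact: ltnW.
Qed.

Let jump_expect t dl : t0 <= t -> 0 < dl -> alpha * dl <= 2^-1 ->
  `|\int[P]_w (Z t w * (k < N (t + dl) w)%N%:R) - dl * r t| <=
  (2 * alpha * L + beta * L + C3) * dl ^+ 2.
Proof.
move=> tt dl0 adl; have t_0 := le_trans t00 tt.
have dl0' := ltW dl0.
have tdl : t <= t + dl by rewrite lerDl.
have /andP[r0 rL] := jump_rate_bounds tt.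
have up := expect_jump_le xi0 alpha0 beta0 hawkesN b0 t_0 (mZ tt) (Z0 t) (ZM t) (@ZP t) dl0 adl.
have lo := expect_jump_ge xi0 alpha0 beta0 hawkesN b0 t_0 (mZ tt) (Z0 t) (ZM t) (@ZP t) dl0 adl.
rewrite -rE // in up.
have C30 : 0 <= C3 * dl ^+ 2 by rewrite mulr_ge0 ?sqr_ge0.
have c3 : C3 * dl ^+ 2 * \int[P]_w Z t w <= C3 * dl ^+ 2.
  by rewrite ler_piMr // EZ1.
have lip : r t - beta * dl * L <= \int[P]_w (Z t w * lam k (t + dl) w).
  rewrite rE // -[X in _ - X](expect_cst P) -expectB; [|exact: bZl|exact: bounded_mfun_cst].
  apply: ler_expect; [|exact: bZl|].
    by apply: bounded_mfunB; [exact: bZl|exact: bounded_mfun_cst].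
  move=> w; rewrite lerBlDr -lerBlDl -mulrBr.
  have := intens_lip xi0 alpha0 beta0 k (fun i => jump_time N i w) (l0ge w) tdl.
  rewrite (_ : t + dl - t = dl); last by ring.
  move/(ler_wpM2l (Z0 t w)) => /le_trans; apply.
  rewrite mulrCA ler_wpM2l ?mulr_ge0 ?(ltW beta0) ?(ltW dl0) //.
  by rewrite (le_trans (Zl _ tt (lexx t))) // ler_piMl.
have a1 : 2 * alpha * dl ^+ 2 * r t <= 2 * alpha * dl ^+ 2 * L.
  by rewrite ler_wpM2l // !mulr_ge0 ?sqr_ge0.
have a2 := ler_wpM2l (ltW dl0) lip.
have a3 : 0 <= beta * L * dl ^+ 2 by rewrite !mulr_ge0 ?sqr_ge0 ?(ltW beta0).
have a4 : 0 <= alpha * L * dl ^+ 2 by rewrite !mulr_ge0 ?sqr_ge0.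
exact: (first_order_error up lo c3 C30 a1 a2 a3 a4).
Qed.

Local Notation mu := (@lebesgue_measure R).

Let integrand_joint_measurable :
  measurable_fun setT (fun x : T * R => (W x.1 * J k x.2 x.1 * lam k x.2 x.1)%:E : \bar R).
Proof.
apply/measurable_EFinP; apply: measurable_funM; last exact: measurable_hist_intens_joint.
apply: measurable_funM; last exact: measurable_count_ind.
exact: (measurableT_comp mW).
Qed.

Lemma measurable_jump_rate : measurable_fun setT r.
Proof.
apply: (measurableT_comp (fine_measurable measurableT)).
apply: (measurable_fun_fubini_tonelli_G (m1 := P)
  (fun x : T * R => (W x.1 * J k x.2 x.1 * lam k x.2 x.1)%:E)).
  exact: integrand_joint_measurable.
by move=> x; rewrite lee_fin !mulr_ge0.
Qed.

Let CL := beta * L + L * (k.+1%:R * (2 * L)).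

(** Without a jump in the step the intensity changes by at most [beta * dl * L]. A jump from a level
    [j <= k] has probability at most [2 * L * dl], and then the integrands differ by at most [L];
    [CL] collects this over the [k.+1] levels. *)
Lemma jump_rate_lip u dl : t0 <= u -> 0 < dl -> alpha * dl <= 2^-1 ->
  `|r (u + dl) - r u| <= CL * dl.
Proof.
move=> tu dl0 adl; have dl0' := ltW dl0; have u0 := le_trans t00 tu.
have udl : u <= u + dl by rewrite lerDl.
have td : t0 <= u + dl := le_trans tu udl.
have v0 : 0 <= u + dl := le_trans t00 td.
have bS (j : 'I_k.+1) : bounded_mfun (fun w => Y j u w * (j < N (u + dl) w)%N%:R : R).
  by apply: bounded_mfunM; [exact: bY|exact: (bcount (fun n => j < n)%N)].
pose g w := beta * dl * L + L * \sum_(j < k.+1) (Y j u w * (j < N (u + dl) w)%N%:R).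
have bg : bounded_mfun g.
  apply: bounded_mfunD; first exact: bounded_mfun_cst.
  by apply: bounded_mfunZ; exact: bounded_mfun_sum.
have pw w : `|Z (u + dl) w * lam k (u + dl) w - Z u w * lam k u w| <= g w.
  have s0 : 0 <= \sum_(j < k.+1) (Y j u w * (j < N (u + dl) w)%N%:R).
    by apply: sumr_ge0 => j _; rewrite mulr_ge0.
  have g0 : 0 <= g w by rewrite addr_ge0 // !mulr_ge0 // ltW.
  have [Wz|Wn] := eqVneq (W w) 0.
    by rewrite /Z Wz !mulr0 !mul0r subr0 normr0.
  have lb := Wb Wn.
  have NN : (N u w <= N (u + dl) w)%N by apply: (counting_path_le (cpN w)).
  have jump : (N u w <= k)%N -> (N u w < N (u + dl) w)%N -> L <= g w.
    move=> Nk lt1; rewrite /g -[leLHS]add0r; apply: lerD.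
      by rewrite !mulr_ge0 // ltW.
    rewrite -[leLHS]mulr1; apply: ler_wpM2l => //.
    rewrite (bigD1 (Ordinal (Nk : (N u w < k.+1)%N))) //= lt1 mulr1 /Y eqxx mul1r indicE mem_set.
      by rewrite lerDl sumr_ge0 // => j _; rewrite !mulr_ge0.
    by rewrite /= in_itv.
  have bnd v : t0 <= v -> 0 <= Z v w * lam k v w <= L.
    move=> tv; rewrite mulr_ge0 //= (le_trans (Zl _ tv (lexx v))) // ler_piMl //.
  have /andP[l1 l2] := bnd _ tu; have /andP[l3 l4] := bnd _ td.
  have [Nk|Nk] := ltnP k (N u w).
    rewrite /Z (gtn_eqF Nk) (gtn_eqF (leq_trans Nk NN)) !mul0r subr0 normr0 //.
  move: NN; rewrite leq_eqVlt => /predU1P[NE|lt1]; last first.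
    apply: le_trans (jump Nk lt1); rewrite ler_norml; apply/andP; split; lra.
  rewrite /Z NE; case: eqP => [Nvk|_]; last by rewrite !mul0r subr0 normr0.
  rewrite mul1r -mulrBr normrM ger0_norm //.
  apply: (@le_trans _ _ `|lam k (u + dl) w - lam k u w|); first by rewrite ler_piMl.
  have mono : lam k (u + dl) w <= lam k u w by exact: intens_nonincr.
  rewrite ler0_norm ?subr_le0 // opprB.
  apply: (le_trans (intens_lip xi0 alpha0 beta0 k (fun i => jump_time N i w) (l0ge w) udl)).
  rewrite (_ : u + dl - u = dl); last by ring.
  rewrite /g; apply: ler_wpDr; first by rewrite mulr_ge0.
  rewrite ler_wpM2l ?mulr_ge0 ?(ltW beta0) // lam_le // NE Nvk //.
have Eg : \int[P]_w g w <= CL * dl.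
  rewrite /g expectD; [|exact: bounded_mfun_cst|by apply: bounded_mfunZ; exact: bounded_mfun_sum].
  rewrite expect_cst expectZ; last exact: bounded_mfun_sum.
  rewrite (_ : CL * dl = beta * dl * L + L * (k.+1%:R * (2 * L * dl))); last first.
    by rewrite /CL; ring.
  rewrite lerD2l; apply: ler_wpM2l => //.
  rewrite expect_sum // mulr_natl -[X in _ *+ X]card_ord -sumr_const.
  by apply: ler_sum => j _; apply: jump_prob => //; rewrite -ltnS.
have b1 := bZl td (lexx _); have b2 := bZl tu (lexx _).
apply: le_trans Eg; rewrite !rE // -expectB //.
have bd := bounded_mfunB b1 b2.
rewrite ler_norml; apply/andP; split.
  rewrite -mulN1r -expectZ //; apply: ler_expect => //; first exact: bounded_mfunZ.
  by move=> w; rewrite mulN1r; have := pw w; rewrite ler_norml => /andP[].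
apply: ler_expect => // w.
by have := pw w; rewrite ler_norml => /andP[].
Qed.

Lemma jump_rate_integrable t : t0 <= t ->
  mu.-integrable `[t0, t] (EFin \o r).
Proof.
move=> tt; apply: measurable_bounded_integrable => //.
- by rewrite /= lebesgue_measure_itv /=; case: ifP => // _; rewrite -EFinB ltry.
- exact: measurable_funTS measurable_jump_rate.
exists L; split; first exact: num_real.
move=> x Lx u /=; rewrite in_itv /= => /andP[tu _].
have /andP[r0 rL] := jump_rate_bounds tu.
by rewrite ger0_norm // (le_trans rL) // ltW.
Qed.

Lemma jump_rate_integral_step t dl : t0 <= t -> 0 < dl -> alpha * dl <= 2^-1 ->
  `|\int[mu]_(u in `[t0, t + dl]) r u - \int[mu]_(u in `[t0, t]) r u - dl * r t|
  <= CL * dl ^+ 2.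
Proof.
move=> tt dl0 adl; have dl0' := ltW dl0; have tdl : t <= t + dl by rewrite lerDl.
have td := le_trans tt tdl.
have ir := jump_rate_integrable td.
rewrite Rintegral_itvB ?bnd_simp //.
have itv : mu.-integrable `]t, t + dl] (EFin \o r).
  apply: integrableS ir => // u /=.
  by rewrite !in_itv /= => /andP[/ltW tu ->]; rewrite (le_trans tt).
have ic (c : R) : mu.-integrable `]t, t + dl] (EFin \o (fun=> c)).
  apply: measurable_bounded_integrable => //.
    by rewrite /= lebesgue_measure_itv /=; case: ifP => // _; rewrite -EFinB ltry.
  exact: bounded_cst.
have muE : fine (mu `]t, t + dl]) = dl.
  by rewrite /= lebesgue_measure_itv /= lte_fin ltrDl dl0 -EFinD /=; ring.
have near u : t < u -> u <= t + dl -> `|r u - r t| <= CL * dl.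
  move=> tu udl; have := @jump_rate_lip t (u - t) tt.
  rewrite subr_gt0 tu subrKC => /(_ isT) H.
  apply: (le_trans (H _)).
    by apply: le_trans adl; rewrite ler_wpM2l //; lra.
  apply: ler_wpM2l; first by apply: addr_ge0; rewrite !mulr_ge0 // ltW.
  lra.
have lo : (r t - CL * dl) * dl <= \int[mu]_(u in `]t, t + dl]) r u.
  rewrite -{2}muE -(Rintegral_cst mu) //; apply: le_Rintegral => // u /=.
  rewrite in_itv /= => /andP[tu udl]; have := near u tu udl.
  by rewrite ler_norml => /andP[h _]; lra.
have up : \int[mu]_(u in `]t, t + dl]) r u <= (r t + CL * dl) * dl.
  rewrite -{3}muE -(Rintegral_cst mu) //; apply: le_Rintegral => // u /=.
  rewrite in_itv /= => /andP[tu udl]; have := near u tu udl.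
  by rewrite ler_norml => /andP[_ h]; lra.
move: lo up; set I := \int[mu]_(u in _) _; move: (r t) I CL => {}r0 I CL0 lo up.
by rewrite ler_norml; apply/andP; split; lra.
Qed.

(** Both sides have the same increments to first order, so their difference changes by at most
    [C * dl ^+ 2] per step and is zero by [quad_iter]. *)
Lemma first_jump_time t1 : t0 <= t1 ->
  \int[P]_w (W w * (N t0 w <= k < N t1 w)%N%:R) =
  \int[mu]_(u in `[t0, t1]) r u.
Proof.
move=> t01.
pose E t := \int[P]_w (W w * (N t0 w <= k < N t w)%N%:R).
pose I t := \int[mu]_(u in `[t0, t]) r u.
pose C := 2 * alpha * L + beta * L + C3 + k%:R * C3 + CL.
have C0 : 0 <= C.
  have h3 : 0 <= C3 by exact: sqr_ge0.
  have hb : 0 <= beta * L by rewrite mulr_ge0 // ltW.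
  have h1 : 0 <= 2 * alpha * L by rewrite !mulr_ge0.
  have h2 : 0 <= k%:R * C3 by rewrite mulr_ge0.
  have h4 : 0 <= CL by apply: addr_ge0 => //; rewrite !mulr_ge0.
  exact: (addr_ge0 (addr_ge0 (addr_ge0 (addr_ge0 h1 hb) h3) h2) h4).
have step t dl : t0 <= t -> 0 < dl -> alpha * dl <= 2^-1 ->
    `|(E (t + dl) - I (t + dl)) - (E t - I t)| <= C * dl ^+ 2.
  move=> tt dl0 adl; have dl0' := ltW dl0; have tdl : t <= t + dl by rewrite lerDl.
  have t_0 := le_trans t00 tt; have td0 := le_trans t_0 tdl.
  have h1 := jump_expect tt dl0 adl.
  have h2 := jump_rate_integral_step tt dl0 adl.
  have h3 := skip_level_prob t_0 dl0 adl.
  have bW : bounded_mfun W by split => //; exists 1 => w; rewrite ger0_norm.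
  have mb (p : nat -> nat -> bool) s s' : 0 <= s -> 0 <= s' ->
      bounded_mfun (fun w => W w * (p (N s w) (N s' w))%:R).
    move=> s0 s0'; apply: bounded_mfunM => //; apply: bounded_mfun_bool.
    rewrite (_ : [set w | _] = \bigcup_n ([set w | N s w = n] `&` [set w | p n (N s' w)])).
      apply: bigcupT_measurable => n; apply: measurableI; first exact: (mcount [set m | m = n]).
      exact: (mcount [set m | p n m]).
    apply/seteqP; split => w /=; first by move=> pw; exists (N s w).
    by move=> [n _ [<-]].
  pose S := \int[P]_w (W w * (N t w < k < N (t + dl) w)%N%:R).
  (* Passing beyond level [k] during the step means either leaving it or skipping it from below. *)
  have ED : E (t + dl) = E t + (\int[P]_w (Z t w * (k < N (t + dl) w)%N%:R) + S).
    have bE s : t0 <= s -> bounded_mfun (fun w => W w * (N t0 w <= k < N s w)%N%:R).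
      by move=> ts; apply: (mb (fun a c => (a <= k < c)%N)) => //; exact: le_trans ts.
    have b1 : bounded_mfun (fun w => Z t w * (k < N (t + dl) w)%N%:R).
      apply: bounded_mfunM; first exact: bZ.
      exact: (bcount (fun n => k < n)%N).
    have b2 : bounded_mfun (fun w => W w * (N t w < k < N (t + dl) w)%N%:R).
      exact: (mb (fun a c => (a < k < c)%N)).
    rewrite /E /S -expectD // -expectD; [|exact: bE|exact: bounded_mfunD].
    apply: eq_Rintegral => w _.
    have n1 : (N t0 w <= N t w)%N by apply: (counting_path_le (cpN w)).
    have n2 : (N t w <= N (t + dl) w)%N by apply: (counting_path_le (cpN w)).
    rewrite /Z (mulrC _ (W w)) -mulrA -!mulrDr; congr (_ * _).
    rewrite -natrM -!natrD; congr (_%:R).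
    move: n1 n2; case: (ltngtP (N t w) k) => Nk n1 n2 /=.
    - by rewrite (leq_trans n1 (ltnW Nk)) /= ?(leq_gtF (ltnW Nk)) mul0n.
    - by rewrite (leq_trans Nk n2) !andbT mul0n !addn0.
    - by rewrite -Nk n1 /= mul1n addn0.
  have S0 : 0 <= S by apply: expect_ge0 => w; rewrite mulr_ge0.
  have SC : S <= k%:R * C3 * dl ^+ 2.
    rewrite -mulrA; apply: le_trans h3; apply: ler_expect.
    - exact: (mb (fun a c => (a < k < c)%N)).
    - apply: bounded_mfunM.
        split; first by apply: (@measurableT_comp _ _ _ _ _ _ (\1_`]-oo, b] : R -> R)).
        by exists 1 => w; rewrite indicE; case: (_ \in _); rewrite ?normr1 // normr0 ler01.
      apply: bounded_mfun_bool.
      rewrite (_ : [set w | _] = [set w | (N t w < k)%N] `&` [set w | (k < N (t + dl) w)%N]).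
        by apply: measurableI; [exact: (mcount [set n | (n < k)%N])|exact: (mcount [set n | (k < n)%N])].
      by apply/seteqP; split => w /= /andP.
    - move=> w; have [->|/Wb lb] := eqVneq (W w) 0; first by rewrite mul0r mulr_ge0.
      by rewrite ler_wpM2r // indicE mem_set //= in_itv.
  rewrite {}ED; move: h1 h2 SC S0; rewrite -/(I (t + dl)) -/(I t) /C.
  set E1 := \int[P]_w (Z t w * _); set c1 := 2 * alpha * L + beta * L + C3.
  move: (E t) (I (t + dl)) (I t) E1 S (r t) c1 (k%:R * C3) CL.
  move=> a1 a2 a3 a4 a5 a6 a7 a8 a9; rewrite !ler_norml => /andP[? ?] /andP[? ?] ? ?.
  by apply/andP; split; lra.
have E00 : E t0 - I t0 = 0.
  rewrite /E /I (@eq_Rintegral _ _ _ P _ (fun=> 0)); last first.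
    by move=> w _; case: ltngtP; rewrite ?mulr0.
  by rewrite expect_cst set_itv1 Rintegral_set1 subrr.
suff : `|E t1 - I t1| <= 0 by rewrite normr_le0 subr_eq0 => /eqP.
apply/ler_addgt0Pr => e e0; rewrite add0r.
have [||||e' /andP[_ e'e] H] := @quad_iter R
   (fun t e => `|E (t0 + t) - I (t0 + t)| <= e) (t1 - t0) C (2 * alpha + 1)^-1
   _ _ C0 _ _ e e0.
- by rewrite subr_ge0.
- by rewrite invr_gt0 ltr_wpDl // mulr_ge0.
- move=> t dl e1 t_0 dl0 dla _ e10 IH.
  have tt : t0 <= t0 + t by rewrite lerDl.
  have := step _ _ tt dl0 (mul_step_size alpha0 dla); rewrite addrA.
  set x := E (t0 + t + dl) - _ => h.
  rewrite -(subrK (E (t0 + t) - I (t0 + t)) x); apply: (le_trans (ler_normD _ _)).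
  by rewrite addrC; exact: lerD.
- by rewrite addr0 E00 normr0.
- by apply: le_trans e'e; rewrite subrKC in H.
Qed.

End rate.
End first_jump.

Lemma integral_preimage_indic (R : realType) d dV (T : measurableType d)
    (V : measurableType dV) (m : {measure set T -> \bar R}) (Y : T -> V)
    (w : T -> R) (D : set V) :
  (\int[m]_(x in Y @^-1` D) (w x)%:E = \int[m]_x ((w x)%:E * (\1_D (Y x))%:E))%E.
Proof.
rewrite integral_mkcond; apply: eq_integral => x _; rewrite patchE indicE.
have -> : (x \in Y @^-1` D) = (Y x \in D) by apply/idP/idP; rewrite !inE.
by case: (Y x \in D); rewrite ?mule1 ?mule0.
Qed.

Section first_jump_law.
Context (R : realType) d (T : measurableType d) (P : probability T R).
Context (xi alpha beta : R) (F : R -> set (set T)).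
Context (lambda0 : {RV P >-> R}) (N : R -> T -> nat).
Hypothesis xi0 : 0 < xi.
Hypothesis alpha0 : 0 <= alpha.
Hypothesis beta0 : 0 < beta.
Hypothesis hawkesN : hawkes_process xi alpha beta F lambda0 N.
Local Notation FT t := (g_sigma_algebraType (F t)).
Local Notation lam := (hist_intens xi alpha beta lambda0 N).
Let cpN := hawkes_counting hawkesN.
Let lam_ge0 := hist_intens_ge0 xi0 alpha0 hawkesN.
Let lam_le := hist_intens_le alpha0 beta0 hawkesN.
Let mlam := measurable_hist_intens hawkesN.
Let mtau := measurable_jump_time hawkesN.
Let mcount := count_measurable hawkesN.

Local Notation mu := (@lebesgue_measure R).
Local Notation J := (count_ind N).

Variables (b : R) (k : nat) (t0 t1 : R).
Hypothesis b0 : 0 <= b.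
Hypothesis t00 : 0 <= t0.
Hypothesis t01 : t0 <= t1.

Section half_lines.
Variable W : T -> R.
Hypothesis mW : measurable_fun setT W.
Hypothesis W01 : forall w, 0 <= W w <= 1.
Hypothesis Wb : forall w, W w != 0 -> lambda0 w <= b.
Hypothesis Wk : forall u, t0 <= u ->
  measurable_fun (T := FT u) [set w | N u w = k] W.

Let W0 w : 0 <= W w. Proof. by have /andP[] := W01 w. Qed.

Lemma jump_rate_EFin u : t0 <= u ->
  (\int[P]_w (W w * J k u w * lam k u w)%:E =
   (jump_rate xi alpha beta lambda0 N k W u)%:E)%E.
Proof.
move=> tu; have u0 := le_trans t00 tu; rewrite expect_EFin //; split.
  apply: measurable_funM; last exact: mlam.
  apply: measurable_funM => //; apply: measurable_bool_nat; rewrite u0 /=.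
  have := mcount [set m | m = k] u0; congr measurable.
  by apply/seteqP; split => w /= /eqP.
exists (b + alpha * k%:R) => w.
have L0 : 0 <= b + alpha * k%:R by rewrite addr_ge0 // mulr_ge0.
rewrite ger0_norm ?mulr_ge0 //.
have [->|/Wb lb] := eqVneq (W w) 0; first by rewrite !mul0r.
have /andP[_ w1] := W01 w.
rewrite /count_ind u0 /=; case: eqP => [Nu|_]; last by rewrite mulr0 mul0r.
by rewrite mulr1 -[leRHS]mul1r ler_pM // lam_le // Nu.
Qed.

(** Jump [k.+1] occurs after [v] exactly when the count at [v] is still at most [k], so the
    half-line reduces to [first_jump_time] started at [max v t0]. *)
Lemma first_jump_half_line (v : R) :
  (\int[P]_w ((W w * (N t0 w <= k < N t1 w)%N%:R)%:E *
      (\1_`]v, +oo[ (jump_time N k.+1 w))%:E) =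
   \int[P \x mu]_x ((W x.1 * J k x.2 x.1 * lam k x.2 x.1 * \1_`[t0, t1] x.2)%:E *
      (\1_`]v, +oo[ x.2)%:E))%E.
Proof.
have t10 := le_trans t00 t01.
pose f (x : T * R) := ((W x.1 * J k x.2 x.1 * lam k x.2 x.1 * \1_`[t0, t1] x.2)%:E *
      (\1_`]v, +oo[ x.2)%:E)%E : \bar R.
have mind (A : set R) : measurable A -> measurable_fun setT (fun x : T * R => \1_A x.2 : R).
  by move=> mA; apply: (@measurableT_comp _ _ _ _ _ _ (\1_A : R -> R)).
have mf : measurable_fun setT f.
  apply: emeasurable_funM; apply/measurable_EFinP; last exact: mind.
  apply: measurable_funM; last exact: mind.
  apply: measurable_funM; last exact: (measurable_hist_intens_joint hawkesN).
  apply: measurable_funM; last exact: (measurable_count_ind hawkesN).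
  exact: (measurableT_comp mW).
have f0 x : (0 <= f x)%E.
  by rewrite mule_ge0 // lee_fin // !mulr_ge0.
have jump w : (k < N t1 w)%N -> jump_time N k.+1 w <= t1 by exact: jump_time_le.
have [tv|vt] := leP t1 v.
  rewrite !integral0_eq //.
  - move=> [w u] _ /=; rewrite -EFinM; congr EFin.
    rewrite !indicE; case: (boolP (u \in `[t0, t1]%classic)) => [|_]; last by rewrite mulr0 mul0r.
    rewrite inE /= in_itv /= => /andP[_ ut]; rewrite memNset ?mulr0 //=.
    by rewrite in_itv /= andbT ltNge (le_trans ut).
  - move=> w _; rewrite -EFinM; congr EFin; case: (boolP (_ <= k < _)%N) => [/andP[_ kN]|_]; last first.
      by rewrite mulr0 mul0r.
    rewrite indicE memNset ?mulr0 //= in_itv /= andbT ltNge.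
    by rewrite (le_trans (jump _ kN)).
pose v' := Num.max v t0.
have v'0 : t0 <= v' by rewrite le_max lexx orbT.
have v'00 := le_trans t00 v'0.
have v't : v' <= t1 by rewrite ge_max t01 ltW.
have Wk' u : v' <= u -> measurable_fun (T := FT u) [set w | N u w = k] W.
  by move=> vu; apply: Wk; exact: le_trans vu.
have lhs w : W w * (N t0 w <= k < N t1 w)%N%:R * \1_`]v, +oo[ (jump_time N k.+1 w) =
    W w * (N v' w <= k < N t1 w)%N%:R.
  have Nv : (N t0 w <= N v' w)%N by apply: (counting_path_le (cpN w)).
  case: (boolP (k < N t1 w)%N) => kN; last by rewrite !andbF !mulr0 mul0r.
  have NE s : 0 <= s -> (N s w <= k)%N = (s < jump_time N k.+1 w).
    by move=> s0; rewrite ltNge -(leq_countP (cpN w) t10 kN s0) -leqNgt.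
  rewrite !andbT !NE // -mulrA indicE -natrM mulnb; congr (_ * _%:R).
  rewrite gt_max andbC; congr (nat_of_bool (_ && _)).
  by apply/idP/idP; rewrite inE /= in_itv /= andbT.
rewrite [LHS](_ : _ = (\int[P]_w (W w * (N v' w <= k < N t1 w)%N%:R)%:E)%E); last first.
  by apply: eq_integral => w _; rewrite -EFinM lhs.
have bl : bounded_mfun (fun w => W w * (N v' w <= k < N t1 w)%N%:R).
  apply: bounded_mfunM; first by split => //; exists 1 => w; have /andP[? ?] := W01 w; rewrite ger0_norm.
  apply: bounded_mfun_bool.
  rewrite (_ : [set w | _] = [set w | (N v' w <= k)%N] `&` [set w | (k < N t1 w)%N]).
    by apply: measurableI; [exact: (mcount [set n | (n <= k)%N])|exact: (mcount [set n | (k < n)%N])].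
  by apply/seteqP; split => w /= /andP.
rewrite expect_EFin // (first_jump_time xi0 alpha0 beta0 hawkesN b0 v'00 mW W01 Wb Wk' v't).
have -> := fubini_tonelli2 (m1 := P) (m2 := mu) f mf f0.
set r := jump_rate xi alpha beta lambda0 N k W.
pose D := `[t0, t1]%classic `&` `]v, +oo[%classic.
rewrite (_ : (\int[mu]_y fubini_G P f y)%E = (\int[mu]_(u in D) (r u)%:E)%E); last first.
  rewrite [RHS]integral_mkcond; apply: eq_integral => u _; rewrite patchE.
  case: (boolP (u \in D)) => [|uD].
    rewrite inE => -[/= + vu]; rewrite in_itv /= => /andP[tu ut].
    rewrite /r -jump_rate_EFin // /fubini_G; apply: eq_integral => w _.
    by rewrite /f /= !indicE !mem_set ?mulr1 ?mule1 //= in_itv /= tu.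
  rewrite /fubini_G integral0_eq // => w _; rewrite /f /= -EFinM; congr EFin.
  have : (u \in `[t0, t1]%classic) && (u \in `]v, +oo[%classic) = false.
    by rewrite -in_setI; exact: negbTE.
  rewrite !indicE; case: (u \in `[t0, t1]%classic); last by rewrite mulr0 mul0r.
  by case: (u \in _) => //= _; rewrite mulr0.
have mr := measurable_jump_rate xi0 alpha0 hawkesN k mW W01.
rewrite -/r in mr.
have -> : (\int[mu]_(u in D) (r u)%:E = \int[mu]_(u in `[v', t1]) (r u)%:E)%E.
  have [vt0|t0v] := ltP v t0.
    have -> : v' = t0 by apply/max_idPr/ltW.
    congr (integral _ _ _); apply/seteqP; split=> [u []|u] //= h; split => //.
    by move: h; rewrite /= !in_itv /= andbT => /andP[h _]; exact: lt_le_trans h.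
  have -> : v' = v by apply/max_idPl.
  rewrite -integral_itv_obnd_cbnd; last exact/measurable_EFinP/measurable_funTS.
  congr (integral _ _ _); apply/seteqP; split=> [u []|u] /=; rewrite !in_itv /= ?andbT.
    by move=> /andP[_ ->] ->.
  by move=> /andP[vu ut]; split; rewrite /= ?in_itv /= ?andbT // ut (le_trans t0v (ltW vu)).
rewrite fineK //; apply: integrable_fin_num => //.
exact: (jump_rate_integrable xi0 alpha0 beta0 hawkesN b0 v'00 mW W01 Wb Wk').
Qed.

End half_lines.

Section joint_law.
Context dU (U : measurableType dU).
Variables (W : T -> R) (Y : T -> U).
Hypothesis mW : measurable_fun setT W.
Hypothesis W01 : forall w, 0 <= W w <= 1.
Hypothesis Wb : forall w, W w != 0 -> lambda0 w <= b.
Hypothesis Wk : forall u, t0 <= u ->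
  measurable_fun (T := FT u) [set w | N u w = k] W.
Hypothesis mY : measurable_fun setT Y.
Hypothesis Yk : forall u, t0 <= u ->
  measurable_fun (T := FT u) [set w | N u w = k] Y.

Let W0 w : 0 <= W w. Proof. by have /andP[] := W01 w. Qed.
Let t10 : 0 <= t1. Proof. exact: le_trans t01. Qed.

Let w1 w : R := W w * (N t0 w <= k < N t1 w)%N%:R.
Let w2 (x : T * R) : R := W x.1 * J k x.2 x.1 * lam k x.2 x.1 * \1_`[t0, t1] x.2.
Let w10 w : 0 <= w1 w. Proof. by rewrite mulr_ge0. Qed.
Let w20 x : 0 <= w2 x. Proof. by rewrite !mulr_ge0. Qed.

Let mind (A : set R) : measurable A -> measurable_fun setT (fun x : T * R => \1_A x.2 : R).
Proof. by move=> mA; apply: (@measurableT_comp _ _ _ _ _ _ (\1_A : R -> R)). Qed.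

Let mw1 : measurable_fun setT w1.
Proof.
apply: measurable_funM => //; apply: measurable_bool_nat.
rewrite (_ : [set w | _] = [set w | (N t0 w <= k)%N] `&` [set w | (k < N t1 w)%N]).
  by apply: measurableI; [exact: (mcount [set n | (n <= k)%N])|exact: (mcount [set n | (k < n)%N])].
by apply/seteqP; split => w /= /andP.
Qed.

Let mw2 : measurable_fun setT w2.
Proof.
apply: measurable_funM; last exact: mind.
apply: measurable_funM; last exact: (measurable_hist_intens_joint hawkesN).
apply: measurable_funM; last exact: (measurable_count_ind hawkesN).
exact: (measurableT_comp mW).
Qed.

(** The factor [\1_A (Y w)] is absorbed into the weight. There remain half-lines in the time
    coordinate, which are stable under intersection and generate the Borel sets. *)
Let law_rectangle (A : set U) (B : set R) : measurable A -> measurable B ->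
  (\int[P]_(w in jump_time N k.+1 @^-1` B) (w1 w * \1_A (Y w))%:E =
   \int[P \x mu]_(x in snd @^-1` B) (w2 x * \1_A (Y x.1))%:E)%E.
Proof.
move=> mA mB.
have mAY : measurable_fun setT (fun w => \1_A (Y w) : R).
  by apply: (@measurableT_comp _ _ _ _ _ _ (\1_A : U -> R)).
pose WA w := W w * \1_A (Y w).
have A01 w : 0 <= (\1_A (Y w) : R) <= 1.
  by rewrite indicE; case: (_ \in _); rewrite ?lexx ?ler01.
have mWA : measurable_fun setT WA by exact: measurable_funM.
have WA01 w : 0 <= WA w <= 1.
  have /andP[a0 a1] := A01 w; have /andP[c0 c1] := W01 w.
  by rewrite mulr_ge0 //= mulr_ile1.
have WAb w : WA w != 0 -> lambda0 w <= b.
  by move=> h; apply: Wb; apply: contraNneq h => h; rewrite /WA h mul0r.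
have WAk u : t0 <= u -> measurable_fun (T := FT u) [set w | N u w = k] WA.
  move=> tu; apply: measurable_funM; first exact: Wk.
  by apply: (@measurableT_comp _ _ _ _ _ _ (\1_A : U -> R)) => //; exact: Yk.
have half v := first_jump_half_line mWA WA01 WAb WAk v.
have E1 v : (\int[P]_(w in jump_time N k.+1 @^-1` `]v, +oo[) (w1 w * \1_A (Y w))%:E =
    \int[P \x mu]_(x in snd @^-1` `]v, +oo[) (w2 x * \1_A (Y x.1))%:E)%E.
  rewrite !integral_preimage_indic.
  have h := half v.
  rewrite [LHS](_ : _ = (\int[P]_w ((WA w * (N t0 w <= k < N t1 w)%N%:R)%:E *
      (\1_`]v, +oo[ (jump_time N k.+1 w))%:E))%E); last first.
    by apply: eq_integral => w _; rewrite /w1 /WA (mulrAC (W w)).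
  rewrite h; apply: eq_integral => x _; rewrite /w2 /WA; congr (_%:E * _)%E; ring.
have mw1A : measurable_fun setT (fun w => w1 w * \1_A (Y w)) by exact: measurable_funM.
have mw2A : measurable_fun setT (fun x => w2 x * \1_A (Y x.1)).
  by apply: measurable_funM => //; exact: (measurableT_comp mAY).
have A0 w : 0 <= (\1_A (Y w) : R) by have /andP[] := A01 w.
have full1 : (\int[P]_w (w1 w * \1_A (Y w))%:E = \int[P \x mu]_x (w2 x * \1_A (Y x.1))%:E)%E.
  (* Jump times and the times in the window are nonnegative, so the half-line from [- 1] yields
     equality of the total masses. *)
  have one (x : R) : 0 <= x -> \1_`]-1, +oo[%classic x = 1 :> R.
    by move=> x0; rewrite indicE mem_set //= in_itv /= andbT (lt_le_trans _ x0).
  have := E1 (- 1); rewrite !integral_preimage_indic.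
  rewrite [X in X = _ -> _](_ : _ = (\int[P]_w (w1 w * \1_A (Y w))%:E)%E); last first.
    by apply: eq_integral => w _; rewrite one ?mule1 // jump_time_nneg.
  move=> ->; apply: eq_integral => x _; rewrite -EFinM; congr EFin.
  rewrite /w2 [\1_`[t0, t1] _]indicE.
  case: (boolP (x.2 \in `[t0, t1]%classic)) => [|_]; last by rewrite mulr0 !mul0r.
  rewrite inE /= in_itv /= => /andP[tx _].
  by rewrite one ?mulr1 // (le_trans t00).
have p1 w : 0 <= w1 w * \1_A (Y w) by rewrite mulr_ge0.
have p2 x : 0 <= w2 x * \1_A (Y x.1) by rewrite mulr_ge0.
have uniq := eq_integral_weighted_preimage (m1 := P) (m2 := (P \x mu)%E) (mtau k.+1)
  (@measurable_snd _ _ T R) mw1A mw2A p1 p2 (G := @RGenOInfty.G R).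
apply: uniq.
- move=> _ _ [x ->] [y ->]; exists (Num.max x y).
  by apply/seteqP; split => u /=; rewrite !in_itv /= !andbT gt_max => /andP.
- by move=> _ [x ->]; exact: measurable_itv.
- have b1 : bounded_mfun (fun w => w1 w * \1_A (Y w)).
    split => //; exists 1 => w; rewrite ger0_norm ?mulr_ge0 //.
    have /andP[a0 a1] := A01 w; have /andP[c0 c1] := W01 w.
    by rewrite /w1 mulr_ile1 ?mulr_ge0 // mulr_ile1 //; case: (_ <= k < _)%N.
  by rewrite expect_EFin // ltry.
- exact: full1.
- by move=> _ [x ->]; exact: E1.
- have : (@ocitv R).-sigma.-measurable B by exact: mB.
  by rewrite RGenOInfty.measurableE.
Qed.

(** The joint law of a functional [Y] of the first [k] jumps and of the next jump time. Rectangles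
    determine it, and [le_integral_weighted] in both directions extends the equality to nonnegative
    functions. *)
Lemma first_jump_law (psi : U * R -> R) : measurable_fun setT psi ->
  (forall x, 0 <= psi x) ->
  (\int[P]_w ((W w * (N t0 w <= k < N t1 w)%N%:R)%:E *
     (psi (Y w, jump_time N k.+1 w))%:E) =
   \int[P \x mu]_x ((W x.1 * J k x.2 x.1 * lam k x.2 x.1 * \1_`[t0, t1] x.2)%:E *
     (psi (Y x.1, x.2))%:E))%E.
Proof.
move=> mpsi psi0.
have mY1 : measurable_fun setT (fun w => (Y w, jump_time N k.+1 w)).
  exact: measurable_fun_pair.
have mY2 : measurable_fun setT (fun x : T * R => (Y x.1, x.2)).
  by apply: measurable_fun_pair => //; exact: (measurableT_comp mY).
have E (D : set (U * R)) : measurable D ->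
   (\int[P]_(w in (fun w => (Y w, jump_time N k.+1 w)) @^-1` D) (w1 w)%:E =
    \int[P \x mu]_(x in (fun x : T * R => (Y x.1, x.2)) @^-1` D) (w2 x)%:E)%E.
  rewrite measurable_prod_measurableType.
  have rect (A : set U) (B : set R) : measurable A -> measurable B ->
     (\int[P]_(w in (fun w => (Y w, jump_time N k.+1 w)) @^-1` (A `*` B)) (w1 w)%:E =
    \int[P \x mu]_(x in (fun x : T * R => (Y x.1, x.2)) @^-1` (A `*` B)) (w2 x)%:E)%E.
    move=> mA mB; have := law_rectangle mA mB; rewrite !integral_preimage_indic.
    have iE y z : \1_(A `*` B) (y, z) = \1_A y * \1_B z :> R.
      by rewrite !indicE in_setX /= -natrM mulnb.
    rewrite [X in X = _ -> _](_ : _ =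
      (\int[P]_x ((w1 x)%:E * (\1_(A `*` B) (Y x, jump_time N k.+1 x))%:E))%E); last first.
      by apply: eq_integral => w _; rewrite iE -!EFinM mulrA.
    by move=> ->; apply: eq_integral => x _; rewrite iE -!EFinM mulrA.
  have uniq := eq_integral_weighted_preimage (m1 := P) (m2 := (P \x mu)%E)
    mY1 mY2 mw1 mw2 w10 w20 (G := [set A `*` B | A in measurable & B in measurable]).
  apply: uniq.
  - move=> _ _ [A mA [B mB] <-] [A' mA' [B' mB'] <-]; exists (A `&` A'); first exact: measurableI.
    exists (B `&` B'); first exact: measurableI.
    by apply/seteqP; split => -[y z] /= [[? ?] [? ?]].
  - by move=> _ [A mA [B mB] <-]; exact: measurableX.
  - have b1 : bounded_mfun w1.
      split => //; exists 1 => w; rewrite ger0_norm //.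
      by have /andP[c0 c1] := W01 w; rewrite /w1 mulr_ile1 //; case: (_ <= k < _)%N.
    by rewrite expect_EFin // ltry.
  - have := rect _ _ (@measurableT _ U) (@measurableT _ R).
    by rewrite setXTT !preimage_setT.
  - by move=> _ [A mA [B mB] <-]; exact: rect.
have EI D : measurable D ->
   (\int[P]_w ((w1 w)%:E * (\1_D (Y w, jump_time N k.+1 w))%:E) =
    \int[P \x mu]_x ((w2 x)%:E * (\1_D (Y x.1, x.2))%:E))%E.
  by move=> /E; rewrite !integral_preimage_indic.
apply/eqP; rewrite eq_le; apply/andP; split.
  have le := le_integral_weighted (m1 := P) (m2 := (P \x mu)%E)
    mY1 mY2 mw1 mw2 w10 w20 _ (phi := EFin \o psi).
  apply: le => [D /EI -> //||x]; first exact/measurable_EFinP.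
  by rewrite lee_fin.
have le := le_integral_weighted (m1 := (P \x mu)%E) (m2 := P)
  mY2 mY1 mw2 mw1 w20 w10 _ (phi := EFin \o psi).
apply: le => [D /EI -> //||x]; first exact/measurable_EFinP.
by rewrite lee_fin.
Qed.

Definition jump_density (psi : U * R -> R) (u : R) : R :=
  \int[P]_w (W w * J k u w * lam k u w * psi (Y w, u)).

Section bounded_test.
Variables (psi : U * R -> R) (M : R).
Hypothesis mpsi : measurable_fun setT psi.
Hypothesis psi0 : forall x, 0 <= psi x.
Hypothesis psiM : forall x, psi x <= M.

Let mjoint : measurable_fun setT (fun x : T * R =>
  (W x.1 * J k x.2 x.1 * lam k x.2 x.1 * psi (Y x.1, x.2))%:E : \bar R).
Proof.
apply/measurable_EFinP; apply: measurable_funM; last first.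
  apply: (measurableT_comp mpsi); apply: measurable_fun_pair => //.
  exact: (measurableT_comp mY).
apply: measurable_funM; last exact: (measurable_hist_intens_joint hawkesN).
apply: measurable_funM; last exact: (measurable_count_ind hawkesN).
exact: (measurableT_comp mW).
Qed.

Lemma measurable_jump_density : measurable_fun setT (jump_density psi).
Proof.
apply: (measurableT_comp (fine_measurable measurableT)).
apply: (measurable_fun_fubini_tonelli_G (m1 := P)
  (fun x : T * R => (W x.1 * J k x.2 x.1 * lam k x.2 x.1 * psi (Y x.1, x.2))%:E)).
  exact: mjoint.
by move=> x; rewrite lee_fin !mulr_ge0.
Qed.

Lemma bounded_jump_density u : t0 <= u ->
  bounded_mfun (fun w => W w * J k u w * lam k u w * psi (Y w, u)).
Proof.
move=> tu; have u0 := le_trans t00 tu; split.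
  apply: measurable_funM; last first.
    by apply: (measurableT_comp mpsi); apply: measurable_fun_pair.
  apply: measurable_funM; last exact: mlam.
  apply: measurable_funM => //; apply: measurable_bool_nat; rewrite u0 /=.
  have := mcount [set m | m = k] u0; congr measurable.
  by apply/seteqP; split => w /= /eqP.
exists ((b + alpha * k%:R) * M) => w.
have L0 : 0 <= b + alpha * k%:R by rewrite addr_ge0 // mulr_ge0.
rewrite ger0_norm ?mulr_ge0 //; apply: ler_pM => //; first by rewrite !mulr_ge0.
have [->|/Wb lb] := eqVneq (W w) 0; first by rewrite !mul0r.
have /andP[_ w1'] := W01 w.
rewrite /count_ind u0 /=; case: eqP => [Nu|_]; last by rewrite mulr0 mul0r.
by rewrite mulr1 -[leRHS]mul1r ler_pM // lam_le // Nu.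
Qed.

Lemma first_jump_expect :
  ((\int[P]_w (W w * (N t0 w <= k < N t1 w)%N%:R * psi (Y w, jump_time N k.+1 w)))%:E =
   \int[mu]_(u in `[t0, t1]) (jump_density psi u)%:E)%E.
Proof.
have := first_jump_law mpsi psi0.
rewrite [X in X = _ -> _](_ : _ = (\int[P]_w (W w * (N t0 w <= k < N t1 w)%N%:R *
   psi (Y w, jump_time N k.+1 w)))%:E); last first.
  rewrite -expect_EFin //; split.
    apply: measurable_funM => //.
    by apply: (measurableT_comp mpsi); apply: measurable_fun_pair.
  exists M => w; have /andP[c0 c1] := W01 w.
  rewrite ger0_norm ?mulr_ge0 // -[leRHS]mul1r ler_pM // ?mulr_ge0 //.
  by rewrite mulr_ile1 //; case: (_ <= k < _)%N.
move=> ->.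
pose f (x : T * R) := ((W x.1 * J k x.2 x.1 * lam k x.2 x.1 * \1_`[t0, t1] x.2)%:E *
     (psi (Y x.1, x.2))%:E)%E : \bar R.
have mf : measurable_fun setT f.
  apply: emeasurable_funM; apply/measurable_EFinP => //.
  apply: (measurableT_comp mpsi); apply: measurable_fun_pair => //.
  exact: (measurableT_comp mY).
have f0 x : (0 <= f x)%E by rewrite mule_ge0 // lee_fin // !mulr_ge0.
have -> := fubini_tonelli2 (m1 := P) (m2 := mu) f mf f0.
rewrite [RHS]integral_mkcond; apply: eq_integral => u _; rewrite patchE.
case: (boolP (u \in `[t0, t1]%classic)) => [uI|uI].
  move: (uI); rewrite inE /= in_itv /= => /andP[tu _].
  rewrite /jump_density -expect_EFin; last exact: bounded_jump_density.
  by apply: eq_integral => w _; rewrite /f /= indicE uI mulr1 -EFinM.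
rewrite /fubini_G integral0_eq // => w _.
by rewrite /f /= indicE (negbTE uI) mulr0 mul0e.
Qed.

End bounded_test.
End joint_law.
End first_jump_law.

(** * Shifting the jump times *)

Section shifted_history.
Context (R : realType) d (T : measurableType d) (P : probability T R).
Context (xi alpha beta : R) (F : R -> set (set T)).
Context (lambda0 : {RV P >-> R}) (N : R -> T -> nat).
Hypothesis xi0 : 0 < xi.
Hypothesis alpha0 : 0 <= alpha.
Hypothesis beta0 : 0 < beta.
Hypothesis hawkesN : hawkes_process xi alpha beta F lambda0 N.
Local Notation FT t := (g_sigma_algebraType (F t)).
Let mtau := measurable_jump_time hawkesN.

Variable n : nat.
Local Notation U := (R * n.-tuple R)%type.

(* The state [(lambda0, T_1 - g, .., T_k - g, 0, .., 0)] of the process after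
   its k-th jump, the jump times being read from time [g] on. *)
Definition shifted_hist (k : nat) (g : R) (w : T) : U :=
  (lambda0 w : R, [tuple if (i < k)%N then jump_time N i.+1 w - g else 0 | i < n]).

Definition add_jump (j : nat) (x : U) (u : R) : U :=
  (x.1, [tuple if i == j :> nat then u else tnth x.2 i | i < n]).

(** The state stores the jump times from index 0 on while [intens] reads them from index 1 on, hence
    [i.-1]. *)
Definition state_intens (k : nat) (x : U) (u : R) : R :=
  intens xi alpha beta k u x.1 (fun i => nth 0 x.2 i.-1).

Lemma shifted_histS j g w :
  shifted_hist j.+1 g w = add_jump j (shifted_hist j g w) (jump_time N j.+1 w - g).
Proof.
congr pair; apply: eq_from_tnth => i; rewrite !tnth_mktuple /= ltnS leq_eqVlt.
by case: eqP => [->|].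
Qed.

Lemma state_intens_shifted k g w u : (k <= n)%N ->
  state_intens k (shifted_hist k g w) u =
  intens xi alpha beta k u (lambda0 w) (fun i => jump_time N i w - g).
Proof.
move=> kn; apply: eq_intens => i /andP[i0 ik].
have ik' : (i.-1 < k)%N by rewrite prednK.
have i_n := leq_trans ik' kn.
by rewrite (nth_mktuple _ 0 (Ordinal i_n)) /= ik' prednK.
Qed.

Lemma measurable_state_intens k u : (k <= n)%N ->
  measurable_fun setT (fun x : U => state_intens k x u).
Proof.
move=> kn; apply: (@intens_measurable_fun _ xi alpha beta _ U setT k (cst u) fst
  (fun i x => nth 0 x.2 i.-1)) => // i /andP[i0 ik].
have ik' : (i.-1 < n)%N by rewrite (leq_trans _ kn) ?prednK.
apply: (@eq_measurable_fun _ _ _ _ _ ((@tnth n R)^~ (Ordinal ik') \o snd)).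
  by move=> x _; rewrite /= (tnth_nth 0).
by apply: measurableT_comp; [exact: measurable_tnth|exact: measurable_snd].
Qed.

Lemma measurable_add_jump j d' (V : measurableType d') (x : V -> U) (u : V -> R) :
  measurable_fun setT x -> measurable_fun setT u ->
  measurable_fun setT (fun v => add_jump j (x v) (u v)).
Proof.
move=> mx mU; apply: measurable_fun_pair; first exact: (measurableT_comp measurable_fst).
apply/measurable_fun_tnthP => i.
rewrite (_ : _ \o _ = fun v => if i == j :> nat then u v else tnth (x v).2 i); last first.
  by apply/funext => v; rewrite /= tnth_mktuple.
case: eqP => // _.
exact: (measurableT_comp (measurable_tnth i) (measurableT_comp measurable_snd mx)).
Qed.

Lemma measurable_shifted_hist k g : measurable_fun setT (shifted_hist k g).
Proof.
apply: measurable_fun_pair => //; apply/measurable_fun_tnthP => i.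
rewrite (_ : _ \o _ = fun w => if (i < k)%N then jump_time N i.+1 w - g else 0); last first.
  by apply/funext => w; rewrite /= tnth_mktuple.
by case: (i < k)%N => //; apply: measurable_funB.
Qed.

(** Only the first [k] jump times enter the state, and they are known at time [u] when [N u w = k].
    Elsewhere the entries are replaced by zeros to obtain a function that is measurable
    everywhere. *)
Lemma shifted_hist_adapted k g u : 0 <= u ->
  measurable_fun (T := FT u) [set w | N u w = k] (shifted_hist k g).
Proof.
move=> u0.
pose Y (w : FT u) : U := (lambda0 w : R,
  [tuple (N u w == k)%:R * (if (i < k)%N then jump_time N i.+1 w - g else 0) | i < n]).
apply: (@eq_measurable_fun _ _ (FT u) _ _ Y).
  move=> w; rewrite inE /= => Nk; congr pair; apply: eq_from_tnth => i.
  by rewrite !tnth_mktuple Nk eqxx mul1r.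
apply: measurable_funTS; apply: measurable_fun_pair; first exact: (lambda0_adapted hawkesN).
apply/measurable_fun_tnthP => i.
rewrite (_ : _ \o _ = fun w : FT u =>
   (N u w == k)%:R * (if (i < k)%N then jump_time N i.+1 w - g else 0)); last first.
  by apply/funext => w; rewrite /= tnth_mktuple.
apply: (weight_adapted hawkesN) => //; case: (ltnP i k) => // ik.
by apply: measurable_funB => //; exact: (jump_time_adapted hawkesN).
Qed.

End shifted_history.

(** Balance of a weight [z] over one step, with counts [m] before and [m'] after: what was at level
    [k], minus what leaves it, plus what reaches or crosses it from below. The two bounds differ by
    [c] on the paths that skip the level. *)
Lemma level_step (R : realDomainType) (k m m' : nat) (z c : R) :
  0 <= z -> z <= c -> (m <= m')%N ->
  z * (m' == k)%:R <= (m == k)%:R * z - (m == k)%:R * z * (k < m')%N%:R +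
    z * (m < k <= m')%N%:R /\
  (m == k)%:R * z - (m == k)%:R * z * (k < m')%N%:R + z * (m < k <= m')%N%:R
    - c * (m < k < m')%N%:R <= z * (m' == k)%:R.
Proof.
move=> z0 zc mm; have [mk|km|mk] := ltngtP m k; last first.
- rewrite andFb !mul1r mulr0 addr0 mulr0 subr0.
  rewrite mk in mm; rewrite eq_sym; have [km'|mk'|_] := ltngtP k m'.
  + by rewrite mulr1 mulr0 subrr.
  + by move: mm; rewrite leqNgt mk'.
  + by rewrite mulr0 mulr1 subr0.
- by rewrite (gtn_eqF (leq_trans km mm)) !andFb !mul0r !mulr0 subrr addr0 subr0.
- rewrite !mul0r subrr add0r !andTb; have [mk'|km'|_] := ltngtP m' k; last first.
  + by rewrite ?mulr0 subr0.
  + by rewrite mulr0 !mulr1 subr_le0.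
  + by rewrite !mulr0 subr0.
Qed.

(** * Balance at a given level over one step *)

Section shift_step.
Context (R : realType) d (T : measurableType d) (P : probability T R).
Context (xi alpha beta : R) (F : R -> set (set T)).
Context (lambda0 : {RV P >-> R}) (N : R -> T -> nat).
Hypothesis xi0 : 0 < xi.
Hypothesis alpha0 : 0 <= alpha.
Hypothesis beta0 : 0 < beta.
Hypothesis hawkesN : hawkes_process xi alpha beta F lambda0 N.
Local Notation FT t := (g_sigma_algebraType (F t)).
Local Notation lam := (hist_intens xi alpha beta lambda0 N).
Let filF := hawkes_filtration hawkesN.
Let cpN := hawkes_counting hawkesN.
Let mcount := count_measurable hawkesN.
Let acount := count_adapted hawkesN.

Variables (n : nat) (b : R).
Hypothesis b0 : 0 <= b.
Local Notation U := (R * n.-tuple R)%type.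
Local Notation X := (@shifted_hist R d T P lambda0 N n).

(** For [g = 0] the second factor is 1, since [N 0 w = 0]; for [g = h] it selects the paths without
    jump up to [h], whose history can be read from [h] on. *)
Definition start_weight (g : R) (w : T) : R :=
  \1_`]-oo, b] (lambda0 w) * (N g w == 0)%N%:R.

Local Notation wt := start_weight.

Lemma start_weight01 g w : 0 <= wt g w <= 1.
Proof.
rewrite /start_weight indicE; case: (_ \in _); case: (_ == _);
  by rewrite ?mulr0 ?mulr1 ?lexx ?ler01.
Qed.

Lemma start_weight_le g w : wt g w <= \1_`]-oo, b] (lambda0 w).
Proof. by rewrite /start_weight ler_piMr //; case: (_ == _). Qed.

Lemma start_weight_supp g w : wt g w != 0 -> lambda0 w <= b.
Proof.
rewrite /start_weight indicE; case: (boolP (_ \in _)) => [|_]; last by rewrite mul0r eqxx.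
by rewrite inE /= in_itv.
Qed.

Lemma start_weight_adapted g u : 0 <= g -> g <= u ->
  measurable_fun setT (wt g : FT u -> R).
Proof.
move=> g0 gu; have u0 := le_trans g0 gu; apply: measurable_funM.
  exact: (lambda0_indic_adapted hawkesN).
apply: measurable_bool_nat; apply/(filtrationP filF _ u0)/(filtration_le filF g0 gu).
rewrite (_ : [set w | _] = [set w | [set 0%N] (N g w)]); last first.
  by apply/seteqP; split => w /= /eqP.
exact: acount.
Qed.

Lemma start_weight_measurable g : 0 <= g -> measurable_fun setT (wt g).
Proof.
move=> g0; have := start_weight_adapted g0 (lexx g).
exact: (weight_measurable hawkesN).
Qed.

(** Here [t] is the time on a clock started at [g], so the process is observed at [t + g]. *)
Definition at_level (g : R) (k : nat) (phi : U -> R) (t : R) (w : T) : R :=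
  (N (t + g) w == k)%:R * (wt g w * phi (X k g w)).

Definition level_expect g k phi t := \int[P]_w at_level g k phi t w.

Definition level_source (g : R) (k : nat) (phi : U -> R) (t dl : R) : R :=
  \int[P]_w (wt g w * phi (X k g w) * (N (t + g) w < k <= N (t + dl + g) w)%N%:R).

Section test_function.
Variables (g : R) (phi : U -> R) (M : R).
Hypothesis g0 : 0 <= g.
Hypothesis mphi : measurable_fun setT phi.
Hypothesis phi0 : forall x, 0 <= phi x.
Hypothesis phiM : forall x, phi x <= M.

Let wt0 w : 0 <= wt g w. Proof. by have /andP[] := start_weight01 g w. Qed.
Let M0 : 0 <= M.
Proof. exact: le_trans (phi0 (0, [tuple 0 | i < n])) (phiM _). Qed.

Let bwt : bounded_mfun (wt g).
Proof.
split; first exact: start_weight_measurable.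
by exists 1 => w; have /andP[? ?] := start_weight01 g w; rewrite ger0_norm.
Qed.

Let bphi k : bounded_mfun (fun w => phi (X k g w)).
Proof.
split; first by apply: (measurableT_comp mphi); exact: (measurable_shifted_hist hawkesN).
by exists M => w; rewrite ger0_norm.
Qed.

Let bcount (p : pred nat) t : 0 <= t -> bounded_mfun (fun w => (p (N t w))%:R : R).
Proof. by move=> t0; apply: bounded_mfun_bool; exact: (mcount p). Qed.

Lemma at_level_ge0 k t w : 0 <= at_level g k phi t w.
Proof. by rewrite mulr_ge0 // mulr_ge0. Qed.

Lemma at_level_adapted k t : 0 <= t ->
  measurable_fun setT (at_level g k phi t : FT (t + g) -> R).
Proof.
move=> t0; have tg0 : 0 <= t + g by rewrite addr_ge0.
apply: (weight_adapted hawkesN) => //; apply: measurable_funM.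
  by apply: measurable_funTS; apply: start_weight_adapted => //; rewrite lerDr.
by apply: (measurableT_comp mphi); exact: (shifted_hist_adapted hawkesN).
Qed.

Lemma at_level_le k t w : at_level g k phi t w <= M.
Proof.
have /andP[_ w1] := start_weight01 g w.
rewrite /at_level -[leRHS]mul1r ler_pM ?mulr_ge0 //; first by case: (_ == _).
by rewrite -[leRHS]mul1r ler_pM.
Qed.

Lemma at_level_bounded k t : exists M', forall w, at_level g k phi t w <= M'.
Proof. by exists M; exact: at_level_le. Qed.

Lemma at_level_supp k t w : at_level g k phi t w != 0 ->
  N (t + g) w = k /\ lambda0 w <= b.
Proof.
rewrite /at_level; case: (N (t + g) w =P k) => [-> h|_]; last by rewrite mul0r eqxx.
split => //; apply: (@start_weight_supp g w); apply: contraNneq h => ->.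
by rewrite mul0r mulr0.
Qed.

Lemma bounded_at_level k t : 0 <= t -> bounded_mfun (at_level g k phi t).
Proof.
move=> t0; have tg0 : 0 <= t + g by rewrite addr_ge0.
exact: (weight_bounded hawkesN tg0 (at_level_adapted k t0) (at_level_ge0 k t)
  (at_level_bounded k t)).
Qed.

Lemma level_expect_ge0 k t : 0 <= level_expect g k phi t.
Proof. by apply: expect_ge0 => w; exact: at_level_ge0. Qed.

Lemma level_expect_le k t : 0 <= t -> level_expect g k phi t <= M.
Proof.
move=> t0; rewrite -[leRHS](expect_cst P); apply: ler_expect.
- exact: bounded_at_level.
- exact: bounded_mfun_cst.
- exact: at_level_le.
Qed.

Section step.
Variables (k : nat) (t dl : R).
Hypothesis t0 : 0 <= t.
Hypothesis dl0 : 0 < dl.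
Hypothesis adl : alpha * dl <= 2^-1.

Local Notation Z := (at_level g k phi t).
Local Notation K2 := ((2 * (b + alpha * k.+1%:R)) ^+ 2).

Let tg0 : 0 <= t + g. Proof. by rewrite addr_ge0. Qed.
Let tg_le : t + g <= t + dl + g. Proof. by rewrite lerD2r lerDl ltW. Qed.
Let tdl : t + dl + g = t + g + dl. Proof. by rewrite addrAC. Qed.
Let tdg0 : 0 <= t + dl + g. Proof. exact: le_trans tg_le. Qed.

Let z w : R := wt g w * phi (X k g w).
Let z0 w : 0 <= z w. Proof. by rewrite mulr_ge0. Qed.
Let zM w : z w <= \1_`]-oo, b] (lambda0 w) * M.
Proof. by rewrite ler_pM // start_weight_le. Qed.
Let bz : bounded_mfun z. Proof. exact: bounded_mfunM. Qed.

Let N_le w : (N (t + g) w <= N (t + dl + g) w)%N.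
Proof. exact: (counting_path_le (cpN w)). Qed.

Let bZ : bounded_mfun Z. Proof. exact: bounded_at_level. Qed.
Let bZj : bounded_mfun (fun w => Z w * (k < N (t + dl + g) w)%N%:R).
Proof. by apply: bounded_mfunM => //; exact: (bcount (fun m => k < m)%N). Qed.
Let bsrc : bounded_mfun (fun w => z w * (N (t + g) w < k <= N (t + dl + g) w)%N%:R).
Proof.
apply: bounded_mfunM => //; apply: bounded_mfun_bool.
rewrite (_ : [set w | _] = [set w | (N (t + g) w < k)%N] `&` [set w | (k <= N (t + dl + g) w)%N]).
  by apply: measurableI; [exact: (mcount [set m | (m < k)%N])|exact: (mcount [set m | (k <= m)%N])].
by apply/seteqP; split => w /= /andP.
Qed.
Let bskip : bounded_mfun (fun w => \1_`]-oo, b] (lambda0 w) *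
   (N (t + g) w < k < N (t + dl + g) w)%N%:R : R).
Proof.
apply: bounded_mfunM.
  split; first by apply: (@measurableT_comp _ _ _ _ _ _ (\1_`]-oo, b] : R -> R)).
  by exists 1 => w; rewrite indicE; case: (_ \in _); rewrite ?normr1 // normr0 ler01.
apply: bounded_mfun_bool.
rewrite (_ : [set w | _] = [set w | (N (t + g) w < k)%N] `&` [set w | (k < N (t + dl + g) w)%N]).
  by apply: measurableI; [exact: (mcount [set m | (m < k)%N])|exact: (mcount [set m | (k < m)%N])].
by apply/seteqP; split => w /= /andP.
Qed.

(** The loss is evaluated with the intensity at the end of the step, the form in which
    [expect_jump_ge] bounds it from below. Paths that skip level [k] are counted in the source,
    which is harmless in this direction. *)
Lemma level_step_le :
  level_expect g k phi (t + dl) <=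
  level_expect g k phi t - dl * (\int[P]_w (Z w * lam k (t + dl + g) w)) +
  K2 * dl ^+ 2 * M + level_source g k phi t dl.
Proof.
have lo := expect_jump_ge xi0 alpha0 beta0 hawkesN b0 tg0 (at_level_adapted k t0)
  (at_level_ge0 k t) (at_level_bounded k t) (@at_level_supp k t) dl0 adl.
rewrite -tdl in lo.
apply: (@le_trans _ _ (\int[P]_w (Z w - Z w * (k < N (t + dl + g) w)%N%:R +
    z w * (N (t + g) w < k <= N (t + dl + g) w)%N%:R))).
  apply: ler_expect.
  - by apply: bounded_at_level; rewrite addr_ge0 // ltW.
  - by apply: bounded_mfunD => //; exact: bounded_mfunB.
  - move=> w; have [+ _] := level_step k (z0 w) (zM w) (N_le w).
    by rewrite /at_level [X in X <= _ -> _]mulrC.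
rewrite expectD //; last exact: bounded_mfunB.
rewrite expectB // /level_expect lerD2r -(addrA _ (- (dl * _))) lerD2l.
rewrite lerNl opprD opprK lerBlDr.
apply: (le_trans lo); rewrite lerD2l ler_wpM2l //; last exact: level_expect_le.
by apply: mulr_ge0; exact: sqr_ge0.
Qed.

(** The loss is bounded from above with the intensity at the beginning of the step, and the paths
    that skip level [k] have to be subtracted. *)
Lemma level_step_ge :
  level_expect g k phi t
    - dl * (1 + 2 * alpha * dl) * (\int[P]_w (Z w * lam k (t + g) w))
    + level_source g k phi t dl - M * (k%:R * (K2 * dl ^+ 2)) <=
  level_expect g k phi (t + dl).
Proof.
have up := expect_jump_le xi0 alpha0 beta0 hawkesN b0 tg0 (at_level_adapted k t0)
  (at_level_ge0 k t) (at_level_bounded k t) (@at_level_supp k t) dl0 adl.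
have sk := skip_level_prob xi0 alpha0 beta0 hawkesN k b0 tg0 dl0 adl.
rewrite -tdl in up sk.
apply: (@le_trans _ _ (\int[P]_w (Z w - Z w * (k < N (t + dl + g) w)%N%:R +
    z w * (N (t + g) w < k <= N (t + dl + g) w)%N%:R -
    M * (\1_`]-oo, b] (lambda0 w) * (N (t + g) w < k < N (t + dl + g) w)%N%:R)))); last first.
  apply: ler_expect.
  - apply: bounded_mfunB; last by apply: bounded_mfunZ.
    by apply: bounded_mfunD => //; exact: bounded_mfunB.
  - by apply: bounded_at_level; rewrite addr_ge0 // ltW.
  - move=> w; have [_ +] := level_step k (z0 w) (zM w) (N_le w).
    by rewrite (mulrC _ M) -(mulrA M) [X in _ <= X -> _]mulrC.
rewrite expectB; last 2 first.
- by apply: bounded_mfunD => //; exact: bounded_mfunB.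
- exact: bounded_mfunZ.
rewrite expectD //; last exact: bounded_mfunB.
rewrite expectB // expectZ //.
have := ler_wpM2l M0 sk.
move: up; rewrite /level_expect /level_source.
set A := \int[P]_w _; set B := \int[P]_w _; set D := \int[P]_w _; set E := \int[P]_w _.
by move=> up sk'; rewrite lerB // lerD2r lerD2l lerN2.
Qed.

End step.
End test_function.
End shift_step.

(** The process read from time 0 has the values [x0'], [x1] and the source [S0]; the one read from
    [h] has [y], [x0], [x1'] and the source [S1]. The test function of [x0'] and [y] contains the
    survival factor of the step. *)
Lemma shift_step_error (R : realType) (c e dl x0 x0' x1 x1' y I S0 S1 K2 C' kk : R) :
  0 <= c -> x1 <= x0' + K2 * dl ^+ 2 + S0 -> x0' <= c * y + e ->
  y <= x0 - I + C' * dl ^+ 2 -> S0 <= c * S1 ->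
  x0 - I + S1 - kk * (K2 * dl ^+ 2) <= x1' ->
  x1 <= c * x1' + (e + (K2 + c * C' + c * (kk * K2)) * dl ^+ 2).
Proof.
move=> c0 h1 h2 h3 h4 h5.
have a1 := ler_wpM2l c0 h3; have a2 := ler_wpM2l c0 h5.
move: h1 h2 h4 a1 a2; rewrite !mulrDr !mulrN !mulrDl; lra.
Qed.

(** [l] and [l'] are the intensities of the delayed process at the two ends of the step, and [cl] is
    the larger one computed from the translated history. *)
Lemma translate_step_pointwise (R : realDomainType) (al be L dl z l l' cl : R) :
  0 <= al -> 0 <= dl -> 0 <= be * dl * L ->
  l - l' <= be * dl * l -> l' <= cl -> 0 <= l -> l <= L -> 0 <= z -> z <= 1 ->
  be * dl * l <= be * dl * L ->
  z * (1 - dl * cl) <=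
  z - dl * (1 + 2 * al * dl) * (z * l) + (be + 2 * al) * L * dl ^+ 2.
Proof.
move=> al0 dl0 bL lip lc l0 lL z0 z1 bl.
have h1 : l - be * dl * L <= cl by lra.
have zdl0 : 0 <= z * dl by exact: mulr_ge0.
have h2 := ler_wpM2l zdl0 h1.
have h3 := ler_wpM2r (mulr_ge0 bL dl0) z1.
have zl : z * l <= L by rewrite -[leRHS]mul1r ler_pM.
have a0 : 0 <= 2 * al * dl ^+ 2 by rewrite !mulr_ge0 ?sqr_ge0.
have h4 := ler_wpM2l a0 zl.
move: h2 h3 h4; lra.
Qed.

(** * Comparison of the law of the history with its translates *)

Section shift_claim.
Context (R : realType) d (T : measurableType d) (P : probability T R).
Context (xi alpha beta : R) (F : R -> set (set T)).
Context (lambda0 : {RV P >-> R}) (N : R -> T -> nat).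
Hypothesis xi0 : 0 < xi.
Hypothesis alpha0 : 0 <= alpha.
Hypothesis beta0 : 0 < beta.
Hypothesis hawkesN : hawkes_process xi alpha beta F lambda0 N.
Local Notation FT t := (g_sigma_algebraType (F t)).
Local Notation lam := (hist_intens xi alpha beta lambda0 N).
Let cpN := hawkes_counting hawkesN.
Let l0ge := hawkes_lambda0_ge hawkesN.
Let lam_ge0 := hist_intens_ge0 xi0 alpha0 hawkesN.
Let lam_le := hist_intens_le alpha0 beta0 hawkesN.
Let mcount := count_measurable hawkesN.

Local Notation mu := (@lebesgue_measure R).
Local Notation J := (count_ind N).

Variables (n : nat) (b : R).
Hypothesis b0 : 0 <= b.
Local Notation U := (R * n.-tuple R)%type.
Local Notation X := (@shifted_hist R d T P lambda0 N n).
Local Notation wt := (start_weight lambda0 N b).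
Local Notation LE g := (@level_expect R d T P lambda0 N n b g).
Local Notation Z g := (@at_level R d T P lambda0 N n b g).
Local Notation src g := (@level_source R d T P lambda0 N n b g).
Local Notation intx := (@state_intens R xi alpha beta n).

(** The density of arrivals at level [j.+1] at time [u] of the clock started at [g], with the new
    jump appended to the state. *)
Definition source_density (g : R) (j : nat) (phi : U -> R) (u : R) : R :=
  \int[P]_w (wt g w * J j (u + g) w * lam j (u + g) w * phi (add_jump j (X j g w) u)).

Section source.
Variables (g : R) (phi : U -> R) (M : R).
Hypothesis g0 : 0 <= g.
Hypothesis mphi : measurable_fun setT phi.
Hypothesis phi0 : forall x, 0 <= phi x.
Hypothesis phiM : forall x, phi x <= M.
Variable j : nat.

Let psi (x : U * R) : R := phi (add_jump j x.1 (x.2 - g)).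

Let mpsi : measurable_fun setT psi.
Proof.
apply: (measurableT_comp mphi); apply: measurable_add_jump => //.
by apply: measurable_funB => //; exact: measurable_snd.
Qed.

Let psi0 x : 0 <= psi x. Proof. exact: phi0. Qed.
Let psiM x : psi x <= M. Proof. exact: phiM. Qed.

Let mwt := start_weight_measurable hawkesN b g0.
Let wt01 := start_weight01 lambda0 N b g.
Let wtb := @start_weight_supp R d T P lambda0 N b g.
Let mX : measurable_fun setT (X j g). Proof. exact: (measurable_shifted_hist hawkesN). Qed.

Let densityE u : source_density g j phi u =
  jump_density xi alpha beta lambda0 N j (wt g) (X j g) psi (u + g).
Proof. by apply: eq_Rintegral => w _; rewrite /psi /= addrK. Qed.

Lemma measurable_source_density : measurable_fun setT (source_density g j phi).
Proof.
have m := measurable_jump_density xi0 alpha0 hawkesN j mwt wt01 mX mpsi psi0.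
rewrite (_ : source_density _ _ _ =
  jump_density xi alpha beta lambda0 N j (wt g) (X j g) psi \o (fun u => u + g)).
  by apply: (measurableT_comp m); exact: measurable_funD.
by apply/funext => u; rewrite densityE.
Qed.

Lemma bounded_source_density u : 0 <= u -> bounded_mfun (fun w =>
  wt g w * J j (u + g) w * lam j (u + g) w * phi (add_jump j (X j g w) u)).
Proof.
move=> u0; have gu : g <= u + g by rewrite lerDr.
have := bounded_jump_density xi0 alpha0 beta0 hawkesN j b0 g0 mwt wt01 wtb mX mpsi psi0 psiM gu.
congr bounded_mfun; apply/funext => w; by rewrite /psi /= addrK.
Qed.

Lemma source_density_ge0 u : 0 <= source_density g j phi u.
Proof.
apply: expect_ge0 => w; have /andP[w0 _] := wt01 w.
by rewrite !mulr_ge0.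
Qed.

Lemma level_source_density (t dl : R) : 0 <= t -> 0 < dl ->
  ((src g j.+1 phi t dl)%:E =
   \int[mu]_(u in `[t, (t + dl)%R]) (source_density g j phi u)%:E)%E.
Proof.
move=> t0 dl0; have tg0 : 0 <= t + g by rewrite addr_ge0.
have tdl : t + g <= t + dl + g by rewrite lerD2r lerDl ltW.
have kn u : t + g <= u -> measurable_fun (T := FT u) [set w | N u w = j] (wt g).
  move=> tu; apply: measurable_funTS; apply: (start_weight_adapted hawkesN) => //.
  by rewrite (le_trans _ tu) // lerDr.
have kX u : t + g <= u -> measurable_fun (T := FT u) [set w | N u w = j] (X j g).
  by move=> tu; apply: (shifted_hist_adapted hawkesN); exact: le_trans tu.
have := first_jump_expect xi0 alpha0 beta0 hawkesN b0 tg0 tdl mwt wt01 wtb kn mX kX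
  mpsi psi0 psiM.
set D := jump_density _ _ _ _ _ _ _ _ _.
have mD : measurable_fun setT D.
  exact: (measurable_jump_density xi0 alpha0 hawkesN j mwt wt01 mX mpsi psi0).
rewrite (@ge0_integral_translation _ g `[t + g, t + dl + g] (EFin \o D)); last 3 first.
- exact: measurable_itv.
- exact/measurable_EFinP.
- move=> u; rewrite lee_fin; apply: expect_ge0 => w; have /andP[w0 _] := wt01 w.
  by rewrite !mulr_ge0.
rewrite (_ : [set u | _] = `[t, t + dl]%classic); last first.
  by apply/seteqP; split => u /=; rewrite !in_itv /= !lerD2r.
move=> E; rewrite [RHS](_ : _ = \int[mu]_(u in `[t, (t + dl)%R]) (EFin \o D) (u + g)%R)%E; last first.
  by apply: eq_integral => u _; rewrite densityE.
rewrite -E; congr EFin; apply: eq_Rintegral => w _.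
by rewrite shifted_histS mulrAC.
Qed.

End source.

(* Keeps test functions in [0, 1] off the range of the history. *)
Definition clamp (L x : R) : R := Num.max 0 (Num.min x L).

Lemma clamp_ge0 L x : 0 <= clamp L x. Proof. by rewrite le_max lexx. Qed.
Lemma clamp_le L x : 0 <= L -> clamp L x <= L.
Proof. by move=> L0; rewrite ge_max L0 ge_min lexx orbT. Qed.
Lemma clamp_id L x : 0 <= x -> x <= L -> clamp L x = x.
Proof. by move=> x0 xL; rewrite /clamp (min_idPl xL) (max_idPr x0). Qed.
Lemma clamp_le_id L x : 0 <= x -> clamp L x <= x.
Proof. by move=> x0; rewrite ge_max x0 ge_min lexx. Qed.
Lemma ge_clamp L x y : x <= y -> x <= L -> x <= clamp L y.
Proof. by move=> xy xL; rewrite le_max le_min xy xL orbT. Qed.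

Lemma measurable_clamp d' (V : measurableType d') L (f : V -> R) :
  measurable_fun setT f -> measurable_fun setT (fun v => clamp L (f v)).
Proof.
move=> mf; apply: (@measurable_maxr _ _ _ setT (cst 0)) => //.
exact: (@measurable_minr _ _ _ setT f (cst L)).
Qed.

Variable h : R.
Hypothesis h0 : 0 < h.
Hypothesis ah : alpha * h <= 2^-1.
Hypothesis bh : 4 * b * h <= 1.

Let h0' := ltW h0.
Let c k : R := 2 * expR (beta * h) ^+ k.
Let c0 k : 0 <= c k. Proof. by rewrite mulr_ge0 // exprn_ge0 // expR_ge0. Qed.

(** All test functions with values in [0, 1] are treated at once, because a time step and the
    passage to the next level each replace [phi] by another test function. *)
Definition shift_bound (k : nat) := forall t (phi : U -> R), 0 <= t ->
  measurable_fun setT phi -> (forall x, 0 <= phi x <= 1) ->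
  LE 0 k phi t <= c k * LE h k phi t.

(** At [t = 0] only level 0 is occupied, and a jump up to [h] has conditional probability at most
    [2 * h * b <= 1/2]. This is the origin of the factor 2 and of the hypothesis [bh]. *)
Let initial k (phi : U -> R) : measurable_fun setT phi -> (forall x, 0 <= phi x <= 1) ->
  LE 0 k phi 0 <= c k * LE h k phi 0.
Proof.
move=> mphi phi01.
have phi0 x : 0 <= phi x by have /andP[] := phi01 x.
have phi1 x : phi x <= 1 by have /andP[] := phi01 x.
have [->|k0] := eqVneq k 0%N; last first.
  rewrite /level_expect (_ : \int[P]_w _ = 0).
    by apply: mulr_ge0 (c0 k) _; exact: level_expect_ge0.
  rewrite (@eq_Rintegral _ _ _ P _ (cst 0)) ?expect_cst // => w _.
  by rewrite /at_level addr0 (counting_path0 (cpN w)) eq_sym (negbTE k0) mul0r.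
have N0 w : N 0 w = 0%N by exact: (counting_path0 (cpN w)).
have bz g : 0 <= g -> bounded_mfun (Z g 0 phi 0).
  by move=> g0; apply: (bounded_at_level hawkesN b g0 mphi phi0 phi1).
have up := expect_jump_le xi0 alpha0 beta0 hawkesN b0 _
  (at_level_adapted hawkesN b (lexx 0) mphi 0 (lexx 0)) (at_level_ge0 lambda0 N b 0 phi0 0 0)
  (at_level_bounded lambda0 N b 0 phi0 phi1 0 0) (@at_level_supp R d T P lambda0 N n b 0 phi 0 0) h0 ah.
rewrite !addr0 add0r in up; have {}up := up (lexx 0).
have EZ0 : 0 <= LE 0 0 phi 0 by exact: level_expect_ge0.
have EZl : \int[P]_w (Z 0 0 phi 0 w * lam 0 0 w) <= b * LE 0 0 phi 0.
  rewrite /level_expect -expectZ; last exact: bz.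
  have zl : bounded_mfun (fun w => Z 0 0 phi 0 w * lam 0 0 w).
    have := weight_bounded_intens xi0 alpha0 beta0 hawkesN b0 (addr_ge0 (lexx 0) (lexx 0))
      (at_level_adapted hawkesN b (lexx 0) mphi 0 (lexx 0)) (at_level_ge0 lambda0 N b 0 phi0 0 0)
      (at_level_bounded lambda0 N b 0 phi0 phi1 0 0) (@at_level_supp R d T P lambda0 N n b 0 phi 0 0).
    by apply; rewrite addr0.
  apply: ler_expect => //; first by apply: bounded_mfunZ; exact: bz.
  move=> w; have [->|/at_level_supp[_ lb]] := eqVneq (Z 0 0 phi 0 w) 0.
    by rewrite mul0r mulr0.
  rewrite mulrC ler_wpM2r //; first exact: at_level_ge0.
  by rewrite (le_trans (lam_le (lexx 0) lb (leq0n _))) // mulr0 addr0.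
have half : \int[P]_w (Z 0 0 phi 0 w * (0 < N h w)%N%:R) <= 2^-1 * LE 0 0 phi 0.
  apply: (le_trans up).
  have h2 : h * (1 + 2 * alpha * h) <= 2 * h.
    by rewrite mulrC ler_wpM2r //; move: ah; lra.
  apply: (@le_trans _ _ (2 * h * (b * LE 0 0 phi 0))).
    apply: ler_pM => //.
      by rewrite mulr_ge0 // addr_ge0 // !mulr_ge0.
    apply: expect_ge0 => w; rewrite mulr_ge0 //; exact: at_level_ge0.
  rewrite mulrA ler_wpM2r //; move: bh; lra.
have E : LE h 0 phi 0 = LE 0 0 phi 0 - \int[P]_w (Z 0 0 phi 0 w * (0 < N h w)%N%:R).
  rewrite /level_expect -expectB; last 2 first.
  - exact: bz.
  - apply: bounded_mfunM; first exact: bz.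
    by apply: bounded_mfun_bool; exact: (mcount [set m | (0 < m)%N]).
  apply: eq_Rintegral => w _; rewrite /at_level /start_weight !add0r N0 eqxx !mulr1 mul1r lt0n.
  rewrite (_ : X 0 h w = X 0 0 w); last first.
    by congr pair; apply: eq_from_tnth => i; rewrite !tnth_mktuple.
  by case: eqP => _; rewrite ?mulr1 ?mulr0 ?mul1r ?mul0r ?mulr0 ?subr0 ?subrr.
rewrite /c expr0 mulr1 E; lra.
Qed.

(** The density of arrivals at level [j.+1] is, up to the constant [L], a level [j] expectation
    whose test function is [phi] after appending the jump, times the intensity. The bound at level
    [j] applies to it, and [intens_translate_ge] supplies the additional factor of [c j.+1]. *)
Let source_compare j (t dl : R) (phi : U -> R) : (j < n)%N -> shift_bound j ->
  0 <= t -> 0 < dl ->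
  measurable_fun setT phi -> (forall x, 0 <= phi x <= 1) ->
  src 0 j.+1 phi t dl <= c j.+1 * src h j.+1 phi t dl.
Proof.
move=> jn IH t0 dl0 mphi phi01.
have phi0 x : 0 <= phi x by have /andP[] := phi01 x.
have phi1 x : phi x <= 1 by have /andP[] := phi01 x.
rewrite -lee_fin EFinM !(level_source_density _ mphi phi0 phi1) //.
have md g : 0 <= g -> measurable_fun setT (EFin \o source_density g j phi).
  by move=> g0; apply/measurable_EFinP; exact: (measurable_source_density g0 mphi phi0).
have s0 g u : 0 <= source_density g j phi u by exact: source_density_ge0.
rewrite -ge0_integralZl; last 4 first.
- exact: measurable_itv.
- by apply: measurable_funTS; exact: md.
- by move=> u _; rewrite lee_fin.
- by rewrite lee_fin.
apply: ge0_le_integral => //.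
- by move=> u _; rewrite lee_fin.
- by apply: measurable_funTS; exact: md.
- by apply: measurable_funTS; apply: measurable_funeM; exact: md.
move=> u /=; rewrite in_itv /= => /andP[tu _]; have u0 := le_trans t0 tu.
rewrite -EFinM lee_fin.
(* Dividing by [L] brings the test function into [0, 1]; the summand 1 makes [L] positive. *)
pose L : R := b + alpha * j%:R + 1.
have L0 : 0 < L by rewrite ltr_wpDl // addr_ge0 // mulr_ge0.
pose psi (x : U) : R := phi (add_jump j x u) * (clamp L (intx j x u) / L).
have psi01 x : 0 <= psi x <= 1.
  have c01 : 0 <= clamp L (intx j x u) / L by rewrite divr_ge0 ?clamp_ge0 // ltW.
  rewrite mulr_ge0 //= mulr_ile1 // ler_pdivrMr // mul1r clamp_le //; exact: ltW.
have psi0 x : 0 <= psi x by have /andP[] := psi01 x.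
have psi1 x : psi x <= 1 by have /andP[] := psi01 x.
have mpsi : measurable_fun setT psi.
  apply: measurable_funM.
    by apply: (measurableT_comp mphi); apply: measurable_add_jump.
  apply: measurable_funM => //; apply: measurable_clamp.
  by apply: measurable_state_intens; exact: ltnW.
have bZ g : 0 <= g -> bounded_mfun (Z g j psi u).
  by move=> g0; apply: (bounded_at_level hawkesN b g0 mpsi psi0 psi1).
have A : source_density 0 j phi u = L * LE 0 j psi u.
  rewrite /level_expect -expectZ; last exact: bZ.
  apply: eq_Rintegral => w _; rewrite /at_level addr0 /count_ind u0 /=.
  case: eqP => [Nj|_]; last by rewrite mulr0 !mul0r mulr0.
  have [->|/start_weight_supp lb] := eqVneq (wt 0 w) 0; first by rewrite !mul0r !mulr0.
  rewrite /psi state_intens_shifted; last exact: ltnW.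
  rewrite (_ : intens _ _ _ _ _ _ _ = lam j u w); last first.
    by apply: eq_intens => i _; rewrite subr0.
  rewrite clamp_id //; last first.
    by rewrite (le_trans (lam_le u0 lb _)) ?Nj // lerDl.
  rewrite mulr1 mul1r; set p := phi _; set q := lam _ _ _.
  rewrite [LHS](_ : _ = wt 0 w * p * q * (L / L)); first ring.
  by rewrite divff ?gt_eqF // mulr1; ring.
have B : L * LE h j psi u <= expR (beta * h) * source_density h j phi u.
  rewrite /level_expect /source_density -!expectZ; last 2 first.
  - exact: (bounded_source_density h0' mphi phi0 phi1).
  - exact: bZ.
  apply: ler_expect.
  - by apply: bounded_mfunZ; exact: bZ.
  - by apply: bounded_mfunZ; exact: (bounded_source_density h0' mphi phi0 phi1).
  move=> w; have uh0 : 0 <= u + h by rewrite addr_ge0.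
  rewrite /at_level /count_ind uh0 /=.
  case: eqP => [Nj|_]; last by rewrite !mul0r !mulr0 !mul0r mulr0.
  have /andP[w0 w1] := start_weight01 lambda0 N b h w.
  rewrite mulr1 mul1r /psi state_intens_shifted; last exact: ltnW.
  set x := intens _ _ _ _ _ _ _; set p := phi _.
  have p0 : 0 <= p by exact: phi0.
  have x0 : 0 <= x by apply: intens_ge0.
  rewrite (_ : L * _ = wt h w * p * clamp L x * (L / L)); last by ring.
  rewrite divff ?gt_eqF // mulr1.
  rewrite (_ : expR _ * _ = wt h w * p * (expR (beta * h) * lam j (u + h) w)); last by ring.
  rewrite ler_wpM2l ?mulr_ge0 // (le_trans (clamp_le_id L x0)) //.
  exact: intens_translate_ge.
rewrite A (le_trans (ler_wpM2l (ltW L0) (IH u psi u0 mpsi psi01))) // mulrCA.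
have -> : c j.+1 = c j * expR (beta * h) by rewrite /c exprSr mulrA.
by rewrite -(mulrA (c j)); exact: (ler_wpM2l (c0 j) B).
Qed.

(** By [intens_translate_le] the survival factor computed from the translated history is at most
    that of the delayed process. Passing from the intensity at the end of the step to the one at its
    beginning costs only order [dl ^+ 2]. *)
Let level_step_translate k t dl (phi : U -> R) (L : R) : (k <= n)%N ->
  L = b + alpha * k%:R -> dl * L <= 1 ->
  0 <= t -> 0 < dl -> alpha * dl <= 2^-1 ->
  measurable_fun setT phi -> (forall x, 0 <= phi x <= 1) ->
  LE h k (fun x => phi x * (1 - dl * clamp L (intx k x (t + dl)))) t <=
  LE h k phi t - dl * (1 + 2 * alpha * dl) *
    (\int[P]_w (Z h k phi t w * lam k (t + h) w)) +
  ((beta + 2 * alpha) * L) * dl ^+ 2.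
Proof.
move=> kn LE dL t0 dl0 adl mphi phi01.
have phi0 x : 0 <= phi x by have /andP[] := phi01 x.
have phi1 x : phi x <= 1 by have /andP[] := phi01 x.
have L0 : 0 <= L by rewrite LE addr_ge0 // mulr_ge0.
have th0 : 0 <= t + h by rewrite addr_ge0.
have tdl : t + h <= t + dl + h by rewrite lerD2r lerDl ltW.
have tdl0 := le_trans th0 tdl.
have bZ : bounded_mfun (Z h k phi t) by apply: (bounded_at_level hawkesN b h0' mphi phi0 phi1).
have bZl : bounded_mfun (fun w => Z h k phi t w * lam k (t + h) w).
  have := weight_bounded_intens xi0 alpha0 beta0 hawkesN b0 th0
    (at_level_adapted hawkesN b h0' mphi k t0) (at_level_ge0 lambda0 N b h phi0 k t)
    (at_level_bounded lambda0 N b h phi0 phi1 k t) (@at_level_supp R d T P lambda0 N n b h phi k t).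
  by apply.
have mc : measurable_fun setT (fun x => phi x * (1 - dl * clamp L (intx k x (t + dl)))).
  apply: measurable_funM => //; apply: measurable_funB => //; apply: measurable_funM => //.
  by apply: measurable_clamp; exact: measurable_state_intens.
have c01 x : 0 <= phi x * (1 - dl * clamp L (intx k x (t + dl))) <= 1.
  have u0 : 0 <= dl * clamp L (intx k x (t + dl)) by rewrite mulr_ge0 ?clamp_ge0 // ltW.
  have u1 : dl * clamp L (intx k x (t + dl)) <= 1.
    by apply: (le_trans _ dL); rewrite ler_wpM2l ?clamp_le // ltW.
  by rewrite mulr_ge0 ?subr_ge0 //= mulr_ile1 ?subr_ge0 // lerBlDr lerDl.
have cge0 x : 0 <= phi x * (1 - dl * clamp L (intx k x (t + dl))) by have /andP[] := c01 x.
have cle1 x : phi x * (1 - dl * clamp L (intx k x (t + dl))) <= 1 by have /andP[] := c01 x.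
pose K := (beta + 2 * alpha) * L * dl ^+ 2.
rewrite [leRHS](_ : _ = \int[P]_w (Z h k phi t w -
    dl * (1 + 2 * alpha * dl) * (Z h k phi t w * lam k (t + h) w) + K)); last first.
  rewrite expectD ?expect_cst; last 2 first.
  - by apply: bounded_mfunB => //; exact: bounded_mfunZ.
  - exact: bounded_mfun_cst.
  by rewrite expectB ?expectZ //; exact: bounded_mfunZ.
apply: ler_expect.
- exact: (bounded_at_level hawkesN b h0' mc cge0 cle1).
- apply: bounded_mfunD; last exact: bounded_mfun_cst.
  by apply: bounded_mfunB => //; exact: bounded_mfunZ.
move=> w; set cl := fun x => _.
have E : Z h k cl t w = Z h k phi t w * (1 - dl * clamp L (intx k (X k h w) (t + dl))).
  by rewrite /at_level /cl !mulrA.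
have z0 := at_level_ge0 lambda0 N b h phi0 k t w.
have z1 := at_level_le lambda0 N b h phi0 phi1 k t w.
rewrite E; move: z0 z1; have [-> _ _|zn z0 z1] := eqVneq (Z h k phi t w) 0.
  rewrite !mul0r mulr0 subr0 add0r; apply: mulr_ge0; last exact: sqr_ge0.
  by rewrite mulr_ge0 // addr_ge0 ?mulr_ge0 // ltW.
have [Nk lb] := at_level_supp zn.
have lL u : t + h <= u -> lam k u w <= L.
  move=> tu; have u0 := le_trans th0 tu; rewrite LE lam_le //.
  by rewrite -Nk (counting_path_le (cpN w)).
have lip := intens_lip xi0 alpha0 beta0 k (fun i => jump_time N i w) (l0ge w) tdl.
rewrite (_ : t + dl + h - (t + h) = dl) in lip; last by ring.
have cl1 : lam k (t + dl + h) w <= clamp L (intx k (X k h w) (t + dl)).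
  by apply: ge_clamp; [rewrite state_intens_shifted //; exact: intens_translate_le|exact: lL].
have bL : 0 <= beta * dl * L by rewrite !mulr_ge0 // ltW.
have l0 := lam_ge0 k (t + h) w; have l1 := lL _ (lexx _).
have := ler_wpM2l (mulr_ge0 (ltW beta0) (ltW dl0)) l1.
move: lip cl1 l0 l1 z0 z1; rewrite -/(lam k (t + h) w) -/(lam k (t + dl + h) w).
exact: (translate_step_pointwise alpha0 (ltW dl0) bL).
Qed.

(** Arrivals during a step are compared by hypothesis, and survivors by the same inequality at the
    earlier time for the test function times the survival factor. Hence [quad_iter] is applied to
    the property [Pr], which is quantified over all test functions. *)
Let shift_bound_of_source k : (k <= n)%N ->
  (forall t dl (phi : U -> R), 0 <= t -> 0 < dl ->
    measurable_fun setT phi -> (forall x, 0 <= phi x <= 1) ->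
    src 0 k phi t dl <= c k * src h k phi t dl) -> shift_bound k.
Proof.
move=> kn Hs t phi t0 mphi phi01; apply/ler_addgt0Pr => e e0.
pose Pr (t e : R) := forall phi : U -> R, measurable_fun setT phi ->
  (forall x, 0 <= phi x <= 1) -> LE 0 k phi t <= c k * LE h k phi t + e.
pose L : R := b + alpha * k%:R.
have L0 : 0 <= L by rewrite addr_ge0 // mulr_ge0.
pose K2 : R := (2 * (b + alpha * k.+1%:R)) ^+ 2.
have K20 : 0 <= K2 by exact: sqr_ge0.
have C'0 : 0 <= (beta + 2 * alpha) * L by rewrite mulr_ge0 // addr_ge0 ?mulr_ge0 // ltW.
pose C : R := K2 + c k * ((beta + 2 * alpha) * L) + c k * (k%:R * K2).
have C0 : 0 <= C.
  apply: addr_ge0; first by apply: addr_ge0 => //; exact: (mulr_ge0 (c0 k) C'0).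
  by apply: (mulr_ge0 (c0 k)); exact: mulr_ge0.
have aL0 : 0 <= alpha + L by rewrite addr_ge0.
(* Below this step size both [alpha * dl <= 1/2] and [dl * L <= 1] hold; the latter keeps the
   survival factor nonnegative. *)
have d00 : 0 < (2 * (alpha + L) + 1)^-1 by rewrite invr_gt0 ltr_wpDl // mulr_ge0.
have step (u dl e1 : R) : 0 <= u -> 0 < dl -> dl <= (2 * (alpha + L) + 1)^-1 ->
    u + dl <= t -> 0 <= e1 -> Pr u e1 -> Pr (u + dl) (e1 + C * dl ^+ 2).
  move=> u0 dl0 dld0 _ _ IH psi mpsi psi01.
  have := mul_step_size aL0 dld0; rewrite mulrDl => aLdl.
  have adl : alpha * dl <= 2^-1.
    by apply: le_trans aLdl; rewrite lerDl mulr_ge0 // ltW.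
  have dL : dl * L <= 1.
    rewrite mulrC; apply: le_trans (_ : 2^-1 <= 1); last by rewrite invf_le1 // ler1n.
    by apply: le_trans aLdl; rewrite lerDr mulr_ge0 // ltW.
  have psi0 x : 0 <= psi x by have /andP[] := psi01 x.
  have psi1 x : psi x <= 1 by have /andP[] := psi01 x.
  pose psi' x := psi x * (1 - dl * clamp L (intx k x (u + dl))).
  have mc : measurable_fun setT psi'.
    apply: measurable_funM => //; apply: measurable_funB => //; apply: measurable_funM => //.
    by apply: measurable_clamp; exact: measurable_state_intens.
  have c01 x : 0 <= psi' x <= 1.
    have v0 : 0 <= dl * clamp L (intx k x (u + dl)) by rewrite mulr_ge0 ?clamp_ge0 // ltW.
    have v1 : dl * clamp L (intx k x (u + dl)) <= 1.
      by apply: (le_trans _ dL); rewrite ler_wpM2l ?clamp_le // ltW.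
    by rewrite mulr_ge0 ?subr_ge0 //= mulr_ile1 ?subr_ge0 // lerBlDr lerDl.
  have h1 := level_step_le xi0 alpha0 beta0 hawkesN b0 (lexx 0) mpsi psi0 psi1 k u0 dl0 adl.
  have h2 := IH psi' mc c01.
  have h3 := level_step_translate kn (erefl L) dL u0 dl0 adl mpsi psi01.
  have h4 := Hs u dl psi u0 dl0 mpsi psi01.
  have h5 := level_step_ge xi0 alpha0 beta0 hawkesN b0 h0' mpsi psi0 psi1 k u0 dl0 adl.
  rewrite mul1r in h5; rewrite mulr1 in h1.
  (* For the history read from time 0 the clamp is inactive on the support of the weight, so the
     loss is absorbed exactly into the test function. *)
  have E : LE 0 k psi' u = LE 0 k psi u -
      dl * \int[P]_w (Z 0 k psi u w * lam k (u + dl + 0) w).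
    have u00 : 0 <= u + 0 by rewrite addr0.
    have bZ : bounded_mfun (Z 0 k psi u).
      by apply: (bounded_at_level hawkesN b (lexx 0) mpsi psi0 psi1).
    have bZl : bounded_mfun (fun w => Z 0 k psi u w * lam k (u + dl + 0) w).
      have := weight_bounded_intens xi0 alpha0 beta0 hawkesN b0 u00
        (at_level_adapted hawkesN b (lexx 0) mpsi k u0) (at_level_ge0 lambda0 N b 0 psi0 k u)
        (at_level_bounded lambda0 N b 0 psi0 psi1 k u) (@at_level_supp R d T P lambda0 N n b 0 psi k u).
      by apply; rewrite !addr0 lerDl ltW.
    rewrite /level_expect -expectZ // -expectB //; last exact: bounded_mfunZ.
    apply: eq_Rintegral => w _; rewrite addr0.
    have ZE : Z 0 k psi' u w = Z 0 k psi u w * (1 - dl * clamp L (intx k (X k 0 w) (u + dl))).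
      by rewrite /at_level /psi' !mulrA.
    have [z0|zn] := eqVneq (Z 0 k psi u w) 0.
      by rewrite ZE z0 !mul0r mulr0 subr0.
    have [Nk lb] := at_level_supp zn; rewrite addr0 in Nk.
    have udl : u <= u + dl by rewrite lerDl ltW.
    have cE : clamp L (intx k (X k 0 w) (u + dl)) = lam k (u + dl) w.
      rewrite state_intens_shifted // (_ : intens _ _ _ _ _ _ _ = lam k (u + dl) w).
        by rewrite clamp_id // lam_le // ?addr_ge0 // ?ltW // -Nk (counting_path_le (cpN w)).
      by apply: eq_intens => i _; rewrite subr0.
    by rewrite ZE cE; ring.
  rewrite -E in h1.
  exact: (shift_step_error (c0 k) h1 h2 h3 h4 h5).
have [|e' /andP[_ e'e] Pe'] := quad_iter t0 d00 C0 step _ e0.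
  by move=> psi mpsi psi01; rewrite addr0; exact: initial.
by apply: (le_trans (Pe' phi mphi phi01)); rewrite lerD2l.
Qed.

(** Level 0 has no source, and the source of level [k.+1] is governed by level [k]. *)
Lemma shift_bound_all k : (k <= n)%N -> shift_bound k.
Proof.
elim: k => [|k IH] kn; apply: shift_bound_of_source => //.
  move=> t dl phi t0 dl0 mphi phi01.
  rewrite /level_source (@eq_Rintegral _ _ _ P _ (cst 0)) ?expect_cst; last first.
    by move=> w _; rewrite ltn0 mulr0.
  apply: (mulr_ge0 (c0 0%N)).
  apply: expect_ge0 => w; have /andP[? _] := start_weight01 lambda0 N b h w.
  by have /andP[? _] := phi01 (X 0 h w); rewrite !mulr_ge0.
move=> t dl phi t0 dl0 mphi phi01.
by apply: source_compare => //; apply: IH; exact: ltnW.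
Qed.

End shift_claim.

(** * Averaging over the shifts *)

Section decreasing_window.
Context (R : realType).
Local Notation mu := (@lebesgue_measure R).
Variable f : R -> R.
Hypothesis f0 : forall u, 0 <= f u.
Hypothesis f_npos : forall u : R, u <= 0 -> f u = 0.
Hypothesis f_decr : forall u v : R, 0 < u -> u <= v -> f v <= f u.

(** On each of the half-lines [u <= 0] and [u > 0] a sublevel set is an interval. *)
Lemma measurable_decr : measurable_fun setT f.
Proof.
apply: (measurable_fun_sublevel measurableT) => x; rewrite setTI.
rewrite (_ : [set u | _] = ([set u | u <= 0] `&` [set u | f u <= x]) `|`
    [set u | 0 < u /\ f u <= x]); last first.
  apply/seteqP; split => [u /= fu|u /= [[]|[]]] //.
  by have [u0|u0] := leP u 0; [left|right].
apply: measurableU; apply: is_interval_measurable => u v /=.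
  move=> [u0 fu] [v0 fv] z /andP[_ zv]; have z0 := le_trans zv v0.
  by split => //; rewrite f_npos // -(f_npos v0).
move=> [u0 fu] [v0 fv] z /andP[uz _]; split; first exact: lt_le_trans uz.
by apply: le_trans fu; exact: f_decr u0 uz.
Qed.

(* The support of [F0] has diameter at most [D], and on a window of length [D]
   the integral of a decreasing function is largest when the window starts at 0. *)
Lemma window_integral_le (F0 : R -> R) (r D : R) : measurable_fun setT f ->
  measurable_fun setT F0 -> (forall h, 0 <= F0 h <= f (h + r)) -> 0 <= D ->
  (forall h h', F0 h != 0 -> F0 h' != 0 -> h' - h <= D) ->
  (\int[mu]_h (F0 h)%:E <= \int[mu]_(u in `]0%R, D]) (f u)%:E)%E.
Proof.
move=> mf mF F01 D0 diam.
have f0' (A : set R) : (0 <= \int[mu]_(u in A) (f u)%:E)%E.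
  by apply: integral_ge0 => u _; rewrite lee_fin.
have [[h1 Fh1]|noh] := pselect (exists h, F0 h != 0); last first.
  rewrite integral0_eq // => h _; congr EFin; apply/eqP/negP => /negP Fh.
  by apply: noh; exists h.
pose S := [set h | F0 h != 0].
have S_lb : lbound S (h1 - D) by move=> h Fh; rewrite lerBlDr -lerBlDl diam.
have S_inf : has_inf S by split; [exists h1|exists (h1 - D)].
pose a := inf S.
have aS h : S h -> a <= h by move=> Sh; apply: ge_inf => //; exists (h1 - D).
have Sa h : S h -> h <= a + D.
  move=> Sh; rewrite -lerBlDr; apply: lb_le_inf; first by exists h1.
  by move=> h' Sh'; rewrite lerBlDr -lerBlDl diam.
(* [F0] vanishes where [h + r <= 0], so adding [r] moves the window starting at [a] into the
   nonnegative half-line. *)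
have ar0 : 0 <= a + r.
  rewrite -(lerBlDr) sub0r; apply: lb_le_inf; first by exists h1.
  move=> h /= Fh; rewrite leNgt; apply/negP => hr; move/eqP: Fh; apply.
  have /andP[F0h Ff] := F01 h; apply/eqP; rewrite eq_le F0h andbT.
  by rewrite (le_trans Ff) // f_npos // -lerBrDr sub0r ltW.
have mfr : measurable_fun setT (fun h : R => f (h + r)).
  by apply: (measurableT_comp mf); exact: measurable_funD.
apply: (@le_trans _ _ (\int[mu]_(h in `[a, (a + D)%R]) (f (h + r)%R)%:E)%E).
  rewrite [leRHS]integral_mkcond; apply: ge0_le_integral => //.
  - by move=> h _; rewrite lee_fin; have /andP[] := F01 h.
  - exact/measurable_EFinP.
  - apply/(measurable_restrictT _ _).1 => //; apply: measurable_funTS.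
    exact/measurable_EFinP.
  move=> h _; rewrite patchE; have /andP[F0h Ff] := F01 h.
  case: ifPn => [_|]; first by rewrite lee_fin.
  have [->//|Fh] := eqVneq (F0 h) 0.
  by move/negP; case; rewrite inE /= in_itv /= aS //= Sa.
rewrite -integral_itv_obnd_cbnd; last exact/measurable_EFinP/measurable_funTS.
pose g (u : R) : \bar R := (f (u + r))%:E.
rewrite (@ge0_integral_translation _ a `]a, (a + D)%R] g) //; last 2 first.
- exact/measurable_EFinP.
- by move=> u; rewrite lee_fin.
rewrite (_ : [set u | _] = `]0, D]%classic); last first.
  apply/seteqP; split => u /=; rewrite !in_itv /= => /andP[? ?]; apply/andP; split; lra.
apply: ge0_le_integral => //.
- by move=> u _; rewrite lee_fin.
- apply: measurable_funTS; apply/measurable_EFinP; apply: (measurableT_comp mfr).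
  exact: measurable_funD.
- by apply: measurable_funTS; exact/measurable_EFinP.
move=> u /=; rewrite in_itv /= => /andP[u0 _]; rewrite lee_fin f_decr //.
by rewrite -addrA lerDl.
Qed.

End decreasing_window.

(** The way back from integrals over conditioning events to a pointwise bound on a conditional
    expectation: within [E], the set where [g] exceeds [c] is covered by the sets [B m], which the
    assumed inequality forces to be null. *)
Lemma ae_le_of_integral (R : realType) d (T : measurableType d)
    (mu : {finite_measure set T -> \bar R}) (E : set T) (g : T -> \bar R) (c : R) :
  measurable E -> measurable_fun setT g -> (forall x, (0 <= g x)%E) -> 0 <= c ->
  (forall B, measurable B -> B `<=` E -> (\int[mu]_(x in B) g x <= c%:E * mu B)%E) ->
  {ae mu, forall x, E x -> (g x <= c%:E)%E}.
Proof.
move=> mE mg g0 c0 H.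
pose B m := E `&` [set x | ((c + m.+1%:R^-1)%:E <= g x)%E].
have mB m : measurable (B m).
  apply: measurableI => //; rewrite -[X in measurable X]setTI.
  exact: emeasurable_fun_c_infty.
have B0 m : mu (B m) = 0.
  have h1 := H _ (mB m) (@subIsetl _ _ _).
  have h2 : ((c + m.+1%:R^-1)%:E * mu (B m) <= \int[mu]_(x in B m) g x)%E.
    rewrite -integral_cst //; apply: ge0_le_integral => //.
    - by move=> x _; rewrite lee_fin addr_ge0.
    - exact: measurable_funTS.
    - by move=> x [].
  have fB : mu (B m) \is a fin_num by exact: fin_num_measure.
  have := le_trans h2 h1; rewrite -(fineK fB) -!EFinM lee_fin => h3.
  have p0 : 0 <= fine (mu (B m)) by apply: fine_ge0.
  congr EFin; apply/eqP; rewrite eq_le p0 andbT.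
  have i0 : 0 < (m.+1%:R : R)^-1 by rewrite invr_gt0.
  by move: h3; rewrite mulrDl gerDl pmulr_rle0.
suff : mu.-negligible (~` [set x | E x -> (g x <= c%:E)%E]) by [].
apply: (negligibleS (A := \bigcup_m B m)).
  move=> x /=; rewrite not_implyE => -[Ex /negP]; rewrite -ltNge => cg.
  have [m cm] : exists m : nat, ((c + m.+1%:R^-1)%:E <= g x)%E.
    move: cg; case: (g x) => [y| |] //; rewrite ?lte_fin; last by exists 0%N; exact: leey.
    move=> cy; have yc : 0 < y - c by rewrite subr_gt0.
    exists (Num.truncn (y - c)^-1); rewrite lee_fin -lerBrDl.
    rewrite -[leRHS]invrK lef_pV2 ?posrE ?invr_gt0 //; exact/ltW/truncnS_gt.
  by exists m.
apply: negligible_bigcup => m; apply/negligibleP; [exact: mB|exact: B0].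
Qed.

Lemma lt_invr_mul (R : realFieldType) (x y z A : R) : 0 < A -> 0 < y -> x / y <= z -> z < A ->
  A^-1 * x < y.
Proof.
move=> A0 y0 h1 h2; rewrite mulrC ltr_pdivrMr // mulrC -ltr_pdivrMr //.
exact: le_lt_trans h2.
Qed.

(** At [kap = 0] the functions [expR (kap * al)] and [1 + kap * be] agree, and the second has the
    larger slope because [al < be]. A small [kap] thus leaves a gap between them, and [th] is chosen
    to fill it exactly. *)
Lemma subcritical_exponents (R : realType) (xi al be eps b : R) :
  0 < xi -> 0 <= al -> al < be -> 0 < eps -> 0 <= b ->
  exists kap th eta : R, [/\ 0 < kap, 0 < th, kap * be * xi <= eps,
    expR (th + kap * al) - 1 <= kap * be &
    [/\ 0 < eta, be * eta <= th / 2, al * eta <= 2^-1 & 4 * b * eta <= 1]].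
Proof.
move=> xi0 al0 ab eps0 b0.
have be0 : 0 < be by exact: le_lt_trans ab.
have ba : 0 < be - al by rewrite subr_gt0.
have p1 : 0 <= be * xi / eps by rewrite divr_ge0 ?mulr_ge0 // ltW.
have p2 : 0 <= al * be / (be - al) by rewrite divr_ge0 ?mulr_ge0 // ltW.
(* The summands of [A] are requirements on [kap = A^-1]: [k1] keeps the growth rate below [eps], and
   [k3] gives [(1 + kap * be) * (1 - kap * al) > 1], hence [th > 0]. *)
pose A := be * xi / eps + al + al * be / (be - al) + 1.
have A0 : 0 < A by rewrite ltr_wpDl // !addr_ge0.
pose kap := A^-1; have kap0 : 0 < kap by rewrite invr_gt0.
have k1 : kap * (be * xi) < eps.
  by apply: (lt_invr_mul A0 eps0 (lexx _)); rewrite /A; lra.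
have k2 : kap * al < 1.
  by apply: (@lt_invr_mul _ _ _ al); rewrite ?divr1 // /A; lra.
have k3 : kap * (al * be) < be - al.
  by apply: (lt_invr_mul A0 ba (lexx _)); rewrite /A; lra.
have kb : 0 < 1 + kap * be by rewrite ltr_pwDl // mulr_ge0 // ltW.
pose th := ln (1 + kap * be) - kap * al.
have E : expR (th + kap * al) = 1 + kap * be by rewrite /th subrK lnK.
have th0 : 0 < th.
  have h : 1 - kap * al <= expR (- (kap * al)) by exact: expR_ge1Dx.
  rewrite -ltr_expR expR0 /th expRD lnK //.
  apply: lt_le_trans (ler_wpM2l (ltW kb) h).
  have := mulr_gt0 kap0 (_ : 0 < be - al - kap * (al * be)).
  rewrite subr_gt0 => /(_ k3); lra.
have q1 : 0 <= be / th by rewrite divr_ge0 // ltW.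
(* [B] adds up the requirements on [eta = B^-1]; asking for [be * eta <= th / 2] leaves half of the
   exponent [th] after the cost of the shifts. *)
pose B := 2 * (be / th + al) + 4 * b + 1.
have B0 : 0 < B by rewrite ltr_wpDl // addr_ge0 ?mulr_ge0 // addr_ge0.
have eta0 : 0 < B^-1 by rewrite invr_gt0.
exists kap, th, B^-1; split => //.
- by rewrite -mulrA ltW.
- by rewrite E addrC addKr.
split => //.
- have th2 : be = be / th * th by rewrite divfK // gt_eqF.
  rewrite ler_pdivrMr // {1}th2 /B.
  have : 0 <= al * th by rewrite mulr_ge0 // ltW.
  have : 0 <= b * th by rewrite mulr_ge0 // ltW.
  move: th0; set r := be / th; lra.
- by rewrite ler_pdivrMr // /B; lra.
- by rewrite ler_pdivrMr // mul1r /B; lra.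
Qed.

Section positive_half_line.
Context (R : realType).
Local Notation mu := (@lebesgue_measure R).
Variable f1 : R -> R.
Hypothesis f1_ge0 : forall u, 0 < u -> 0 <= f1 u.
Hypothesis f1_decr : forall u v, 0 < u -> u <= v -> f1 v <= f1 u.

(* [f1 0] is arbitrary; it is irrelevant since [T_q = s] has probability 0. *)
Definition pos_part_fun (u : R) : R := if 0 < u then f1 u else 0.
Local Notation f := pos_part_fun.

Lemma pos_part_fun_ge0 u : 0 <= f u.
Proof. by rewrite /f; case: ifP => // /f1_ge0. Qed.

Lemma pos_part_fun_npos (u : R) : u <= 0 -> f u = 0.
Proof. by rewrite leNgt /f => /negbTE ->. Qed.

Lemma pos_part_fun_decr (u v : R) : 0 < u -> u <= v -> f v <= f u.
Proof. by move=> u0 uv; rewrite /f u0 (lt_le_trans u0 uv) f1_decr. Qed.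

Lemma measurable_pos_part_fun : measurable_fun setT f.
Proof.
exact: measurable_decr pos_part_fun_npos pos_part_fun_decr.
Qed.

(** Finiteness is the point. Near 0 it is the integrability hypothesis, and from [delta / 2] on the
    decreasing function is bounded by its value there. The extended integral can then be exchanged
    for the real one of the final bound. *)
Lemma pos_part_fun_integral (D : R) : 0 <= D ->
  (exists2 delta, 0 < delta & mu.-integrable `]0, delta[ (EFin \o f1)) ->
  (\int[mu]_(u in `]0%R, D]) (f u)%:E = (\int[mu]_(u in `[0%R, D]) f1 u)%:E)%E.
Proof.
move=> D0 [delta delta0 f1_int].
have f0 := pos_part_fun_ge0; have mf := measurable_pos_part_fun.
have mfE : measurable_fun setT (EFin \o f) by exact/measurable_EFinP.
have fE (A : set R) : A `<=` `]0, +oo[ -> {in A, (EFin \o f1) =1 (EFin \o f)}.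
  by move=> AI u /set_mem /AI /=; rewrite in_itv /= andbT /f => ->.
have I0 : `]0, D]%classic `<=` `]0%R, +oo[%classic.
  by move=> u /=; rewrite !in_itv /= andbT => /andP[].
have Id : `]0, delta[%classic `<=` `]0%R, +oo[%classic.
  by move=> u /=; rewrite !in_itv /= andbT => /andP[].
have E : (\int[mu]_(u in `[0%R, D]) (f1 u)%:E = \int[mu]_(u in `]0%R, D]) (f u)%:E)%E.
  rewrite -integral_itv_obnd_cbnd.
    by apply: eq_integral => u /(fE _ I0).
  apply: (@eq_measurable_fun _ _ _ _ _ (EFin \o f)); last exact: measurable_funTS.
  by move=> u /(fE _ I0).
rewrite /Rintegral E fineK //; apply/fin_numPlt; apply/andP; split.
  by apply: lt_le_trans (integral_ge0 _ _); rewrite ?ltNyr // => u _; rewrite lee_fin.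
have fin1 : (\int[mu]_(u in `]0%R, delta[) (f u)%:E < +oo)%E.
  have /integrableP[_] := f1_int; apply: le_lt_trans.
  apply: ge0_le_integral => //.
  - by move=> u _; rewrite lee_fin.
  - exact: measurable_funTS.
  - by apply/measurableT_comp => //; exact: measurable_int f1_int.
  by move=> u ud; have /= <- := fE _ Id u (mem_set ud); exact: lee_abs.
pose c := f (delta / 2).
have d2 : 0 < delta / 2 by rewrite divr_gt0.
apply: (@le_lt_trans _ _ (\int[mu]_(u in `]0%R, delta[) (f u)%:E +
   \int[mu]_(u in `]0%R, D]) c%:E)%E); last first.
  rewrite integral_cst //= lebesgue_measure_itv /= lte_fin.
  by rewrite lte_add_pinfty //; case: ifP => _; rewrite ?mule0 // -EFinB -EFinM ltry.
rewrite integral_mkcond [X in (_ <= X + _)%E]integral_mkcond.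
rewrite [X in (_ <= _ + X)%E]integral_mkcond -ge0_integralD //; last 4 first.
- by move=> ? _; apply: erestrict_ge0 => u _; rewrite lee_fin.
- by apply/(measurable_restrictT _ _).1 => //; exact: measurable_funTS.
- by move=> ? _; apply: erestrict_ge0 => u _; rewrite lee_fin; exact: f0.
- by apply/(measurable_restrictT _ _).1 => //; exact: measurable_funTS.
apply: ge0_le_integral => //.
- by move=> u _; apply: erestrict_ge0 => v _; rewrite lee_fin.
- by apply/(measurable_restrictT _ _).1 => //; exact: measurable_funTS.
- by apply: emeasurable_funD; apply/(measurable_restrictT _ _).1 => //; exact: measurable_funTS.
move=> u _; rewrite !patchE; case: ifPn => uD; last first.
  by case: ifP => _; rewrite ?adde0 // lee_fin.
move: uD; rewrite inE /= in_itv /= => /andP[u0 uD].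
case: ifPn => [_|]; first by rewrite -EFinD lee_fin lerDl; exact: f0.
rewrite notin_setE /= in_itv /= u0 /= => /negP; rewrite -leNgt => du.
by rewrite add0e lee_fin; apply: pos_part_fun_decr d2 _; lra.
Qed.

End positive_half_line.

(** * The functional [f2] and its support *)

Section tuple_functionals.
Context (R : realType) (p : nat).
Local Notation n := p.+1.
Local Notation mu := (@lebesgue_measure R).

(** In these coordinates a translation of all jump times changes only the first entry. *)
Definition diff_tuple (t : n.-tuple R) : n.-tuple R :=
  [tuple if i == 0 :> nat then tnth t ord0 else tnth t i - tnth t ord0 | i < n].

Lemma nonneg_tupleP (t : n.-tuple R) : nonneg_tuple t <-> forall k : nat, 0 <= nth 0 t k.
Proof.
split => [H k|H i]; last by rewrite (tnth_nth 0).
have [kn|kn] := ltnP k n; last by rewrite nth_default ?size_tuple.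
by have := H (Ordinal kn); rewrite (tnth_nth 0).
Qed.

Lemma measurable_tuple_nth k : measurable_fun setT (fun t : n.-tuple R => nth 0 t k).
Proof.
have [kn|kn] := ltnP k n.
  rewrite (_ : (fun t => _) = (@tnth n R)^~ (Ordinal kn)); first exact: measurable_tnth.
  by apply/funext => t; rewrite (tnth_nth 0).
by rewrite (_ : (fun t => _) = cst 0) //; apply/funext => t; rewrite nth_default ?size_tuple.
Qed.

Lemma measurable_nonneg_tuple : measurable [set t : n.-tuple R | nonneg_tuple t].
Proof.
rewrite (_ : [set t | _] = \bigcap_k [set t : n.-tuple R | 0 <= nth 0 t k]); last first.
  by apply/seteqP; split => t /=; rewrite nonneg_tupleP => H k; [move=> _|]; exact: H.
apply: bigcapT_measurable => k.
rewrite (_ : [set t | _] = (fun t : n.-tuple R => nth 0 t k) @^-1` `[0, +oo[); last first.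
  by apply/seteqP; split => t /=; rewrite in_itv /= andbT.
by rewrite -[X in measurable X]setTI; apply: measurable_tuple_nth => //; exact: measurable_itv.
Qed.

Lemma measurable_diff_tuple : measurable_fun setT diff_tuple.
Proof.
apply/measurable_fun_tnthP => i.
rewrite (_ : _ \o _ = fun t => if i == 0 :> nat then tnth t ord0 else tnth t i - tnth t ord0).
  case: (i == 0 :> nat); first exact: measurable_tnth.
  by apply: measurable_funB; exact: measurable_tnth.
by apply/funext => t; rewrite /= tnth_mktuple.
Qed.

Lemma head_diff_tuple (t : n.-tuple R) : head 0 (diff_tuple t) = tnth t ord0.
Proof. by rewrite -nth0 (nth_mktuple _ 0 ord0). Qed.

Lemma behead_diff_tuple (t t' : n.-tuple R) :
  (forall i, tnth t i - tnth t ord0 = tnth t' i - tnth t' ord0) ->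
  behead_tuple (diff_tuple t) = behead_tuple (diff_tuple t').
Proof.
move=> H; apply: eq_from_tnth => i; rewrite !(tnth_nth 0) /= !nth_behead.
have i1 : (i.+1 < n)%N by rewrite ltnS.
by rewrite !(nth_mktuple _ 0 (Ordinal i1)) /= H.
Qed.

Variable f2 : n.-tuple R -> R.
Hypothesis f2_meas : measurable_fun [set t : n.-tuple R | nonneg_tuple t] f2.
Hypothesis f2_ge0 : forall t : n.-tuple R, nonneg_tuple t -> 0 <= f2 t.

(** [f2] is controlled on nonnegative tuples only and is extended by 0; translating a history may
    produce negative entries. *)
Definition diff_functional (t : n.-tuple R) : R :=
  (f2 \_ [set t | nonneg_tuple t]) (diff_tuple t).

Lemma measurable_diff_functional : measurable_fun setT diff_functional.
Proof.
apply: measurableT_comp; last exact: measurable_diff_tuple.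
by apply/(measurable_restrictT _ _).1 => //; exact: measurable_nonneg_tuple.
Qed.

Lemma diff_functional_ge0 t : 0 <= diff_functional t.
Proof. by rewrite /diff_functional patchE; case: ifPn => // /set_mem /f2_ge0. Qed.

Lemma diff_functional_le (K : R) t : 0 <= K ->
  (forall t : n.-tuple R, nonneg_tuple t -> f2 t <= K) -> diff_functional t <= K.
Proof.
by move=> K0 fK; rewrite /diff_functional patchE; case: ifPn => // /set_mem /fK.
Qed.

Variables (J : p.-tuple R -> interval R) (Jbar : R).
Hypothesis J_length : forall t : p.-tuple R, nonneg_tuple t ->
  (mu [set` J t] <= Jbar%:E)%E.
Hypothesis f2_supp : forall t : n.-tuple R, nonneg_tuple t -> f2 t != 0 ->
  head 0 t \in J (behead_tuple t).
Hypothesis Jbar0 : 0 <= Jbar.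

(** Tuples with the same differences from the first entry determine the same interval [J], which
    contains both first entries and hence the segment between them. This bounds the diameter of the
    set of admissible shifts. *)
Lemma diff_functional_supp (t t' : n.-tuple R) :
  (forall i, tnth t i - tnth t ord0 = tnth t' i - tnth t' ord0) ->
  diff_functional t != 0 -> diff_functional t' != 0 ->
  tnth t ord0 - tnth t' ord0 <= Jbar.
Proof.
move=> tt'; rewrite /diff_functional !patchE.
case: ifPn => [/set_mem /= t0|_]; last by rewrite eqxx.
case: ifPn => [/set_mem /= t'0|_ _]; last by rewrite eqxx.
move=> /(f2_supp t0) + /(f2_supp t'0); rewrite !head_diff_tuple (behead_diff_tuple tt').
have b0 : nonneg_tuple (behead_tuple (diff_tuple t')).
  move=> i; rewrite (tnth_nth 0) /= nth_behead.
  by have /nonneg_tupleP := t'0; apply.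
have := J_length b0; set I := J _; set x := tnth t _; set y := tnth t' _.
move=> IJ xI yI; have [yx|xy] := leP y x; last by rewrite (le_trans _ Jbar0) // subr_le0 ltW.
have sub : `[y, x]%classic `<=` [set` I].
  move=> z /=; rewrite in_itv /= => yzx.
  exact: (@interval_is_interval _ I _ _ yI xI).
have : (mu `[y, x]%classic <= mu [set` I])%E.
  by apply: le_measure => //; rewrite inE; exact: measurable_itv.
move=> /le_trans /(_ IJ); rewrite lebesgue_measure_itv /= lte_fin.
move: yx; rewrite le_eqVlt => /orP[/eqP -> _|yx]; first by rewrite subrr.
by rewrite yx -EFinB lee_fin.
Qed.

End tuple_functionals.

(** * Averaged bound for a fixed number of jumps *)

Section averaged_shift.
Context (R : realType) d (T : measurableType d) (P : probability T R).
Context (xi alpha beta : R) (F : R -> set (set T)).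
Context (lambda0 : {RV P >-> R}) (N : R -> T -> nat).
Hypothesis xi0 : 0 < xi.
Hypothesis alpha0 : 0 <= alpha.
Hypothesis beta0 : 0 < beta.
Hypothesis hawkesN : hawkes_process xi alpha beta F lambda0 N.
Let cpN := hawkes_counting hawkesN.
Let mtau := measurable_jump_time hawkesN.
Let mcount := count_measurable hawkesN.

Local Notation mu := (@lebesgue_measure R).

Variable p : nat.
Local Notation n := p.+1.
Local Notation U := (R * n.-tuple R)%type.
Local Notation X := (@shifted_hist R d T P lambda0 N n n).

Variables (b : R) (B : set R) (eta s : R).
Hypothesis b0 : 0 <= b.
Hypothesis mB : measurable B.
Hypothesis Bb : forall y, B y -> y <= b.
Hypothesis eta0 : 0 < eta.
Hypothesis aeta : alpha * eta <= 2^-1.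
Hypothesis b_eta : 4 * b * eta <= 1.
Hypothesis s0 : 0 <= s.

Local Notation wt := (start_weight lambda0 N b).

Variables (f : R -> R) (g2 : n.-tuple R -> R) (K D : R).
Hypothesis f0 : forall u, 0 <= f u.
Hypothesis f_npos : forall u : R, u <= 0 -> f u = 0.
Hypothesis f_decr : forall u v : R, 0 < u -> u <= v -> f v <= f u.
Hypothesis mg2 : measurable_fun setT g2.
Hypothesis g20 : forall t, 0 <= g2 t.
Hypothesis g2K : forall t, g2 t <= K.
Hypothesis K0 : 0 < K.
Hypothesis D0 : 0 <= D.
Hypothesis g2_supp : forall t t' : n.-tuple R,
  (forall i, tnth t i - tnth t ord0 = tnth t' i - tnth t' ord0) ->
  g2 t != 0 -> g2 t' != 0 -> tnth t ord0 - tnth t' ord0 <= D.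

Definition state_functional (x : U) : R :=
  \1_B x.1 * (f (s - tnth x.2 ord_max) * g2 x.2).
Local Notation Phi := state_functional.

Let mf : measurable_fun setT f. Proof. exact: measurable_decr. Qed.

Lemma state_functional_ge0 x : 0 <= Phi x.
Proof. by rewrite !mulr_ge0. Qed.
Local Notation Phi0 := state_functional_ge0.

Lemma measurable_state_functional : measurable_fun setT Phi.
Proof.
apply: measurable_funM.
  by apply: (@measurableT_comp _ _ _ _ _ _ (\1_B : R -> R)) => //; exact: measurable_fst.
apply: measurable_funM; last exact: (measurableT_comp mg2 measurable_snd).
apply: (measurableT_comp mf); apply: measurable_funB => //.
exact: (measurableT_comp (measurable_tnth ord_max) measurable_snd).
Qed.
Local Notation mPhi := measurable_state_functional.

Lemma measurable_shifted_hist_joint :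
  measurable_fun setT (fun x : T * R => X x.2 x.1).
Proof.
apply: measurable_fun_pair; first exact: (measurableT_comp _ measurable_fst).
apply/measurable_fun_tnthP => i.
rewrite (_ : _ \o _ = fun x : T * R => jump_time N i.+1 x.1 - x.2); last first.
  by apply/funext => x; rewrite /= tnth_mktuple ltn_ord.
apply: measurable_funB; last exact: measurable_snd.
exact: (measurableT_comp (mtau _) measurable_fst).
Qed.

Let C1 : R := 2 * expR (beta * eta) ^+ n.
Let C10 : 0 <= C1. Proof. by rewrite mulr_ge0 // exprn_ge0 // expR_ge0. Qed.
Let seta0 : 0 <= s + eta. Proof. by rewrite addr_ge0 // ltW. Qed.

Let tail w : R := (n <= N (s + eta) w)%N%:R.
Let mtail : measurable_fun setT tail.
Proof. by apply: measurable_bool_nat; exact: (mcount [set m | (n <= m)%N]). Qed.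

Definition functional_integral : \bar R :=
  (\int[P]_w (((N s w == n)%:R)%:E * (Phi (X 0 w))%:E))%E.
Local Notation A := functional_integral.

(** [shift_bound_all] for indicators extends to the possibly unbounded [Phi] by
    [le_integral_weighted]. Since [N (s + h) w = n] implies at least [n] jumps by [s + eta], and
    [expR (beta * h)] is at most [expR (beta * eta)], the shift [h] remains only in the history,
    ready for averaging. *)
Lemma functional_integral_shift h : 0 < h -> h <= eta ->
  (A <= \int[P]_w (C1%:E * (tail w * Phi (X h w))%:E))%E.
Proof.
move=> h0 h_eta.
have ah : alpha * h <= 2^-1 by apply: le_trans aeta; rewrite ler_wpM2l.
have bh : 4 * b * h <= 1 by apply: le_trans b_eta; rewrite ler_wpM2l // mulr_ge0.
have mX g : measurable_fun setT (X g) by exact: (measurable_shifted_hist hawkesN).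
have mwt g : 0 <= g -> measurable_fun setT (wt g) by exact: (start_weight_measurable hawkesN).
have wt0 g w : 0 <= wt g w by have /andP[] := start_weight01 lambda0 N b g w.
have meq t : 0 <= t -> measurable_fun setT (fun w => (N t w == n)%:R : R).
  move=> t0; apply: measurable_bool_nat; have := mcount [set m | m = n] t0.
  by congr measurable; apply/seteqP; split => w /= /eqP.
have sh0 : 0 <= s + h by rewrite addr_ge0 // ltW.
pose c : R := 2 * expR (beta * h) ^+ n.
have c0 : 0 <= c by rewrite mulr_ge0 // exprn_ge0 // expR_ge0.
pose w1 w : R := (N (s + 0) w == n)%:R * wt 0 w.
pose w2 w : R := c * ((N (s + h) w == n)%:R * wt h w).
have mw1 : measurable_fun setT w1.
  by apply: measurable_funM; [rewrite addr0; exact: meq|exact: mwt].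
have mw2 : measurable_fun setT w2.
  by apply: measurable_funM => //; apply: measurable_funM; [exact: meq|exact/mwt/ltW].
have w10 w : 0 <= w1 w by rewrite mulr_ge0.
have w20 w : 0 <= w2 w by apply: mulr_ge0 => //; exact: mulr_ge0.
have sets (Q : set U) : measurable Q ->
   (\int[P]_w ((w1 w)%:E * (\1_Q (X 0 w))%:E) <= \int[P]_w ((w2 w)%:E * (\1_Q (X h w))%:E))%E.
  move=> mQ; pose phi : U -> R := \1_Q.
  have mphi : measurable_fun setT phi by exact: measurable_indic.
  have phi01 x : 0 <= phi x <= 1 by rewrite /phi indicE; case: (_ \in _); rewrite ?lexx ?ler01.
  have phi0 x : 0 <= phi x by have /andP[] := phi01 x.
  have phi1 x : phi x <= 1 by have /andP[] := phi01 x.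
  have bA g : 0 <= g -> bounded_mfun (at_level lambda0 N b g n phi s).
    by move=> g0; apply: (bounded_at_level hawkesN b g0 mphi phi0 phi1).
  have := shift_bound_all xi0 alpha0 beta0 hawkesN b0 h0 ah bh (leqnn n) s0 mphi phi01.
  rewrite -lee_fin /level_expect -expectZ; last exact/bA/ltW.
  rewrite -!expect_EFin; last 2 first.
  - by apply: bounded_mfunZ; exact/bA/ltW.
  - exact: bA.
  rewrite [X in (X <= _)%E -> _](_ : _ = (\int[P]_w ((w1 w)%:E * (phi (X 0 w))%:E))%E); last first.
    by apply: eq_integral => w _; rewrite -EFinM /at_level /w1 mulrA.
  rewrite [X in (_ <= X)%E -> _](_ : _ = (\int[P]_w ((w2 w)%:E * (phi (X h w))%:E))%E) //.
  by apply: eq_integral => w _; rewrite -EFinM /at_level /w2 !mulrA.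
have le := le_integral_weighted (m1 := P) (m2 := P) (mX 0) (mX h) mw1 mw2 w10 w20 sets
  (phi := EFin \o Phi).
have {}le : (\int[P]_w ((w1 w)%:E * (Phi (X 0 w))%:E) <=
    \int[P]_w ((w2 w)%:E * (Phi (X h w))%:E))%E.
  by apply: le => [|x]; [apply/measurable_EFinP; exact: mPhi|rewrite lee_fin Phi0].
have -> : A = (\int[P]_w ((w1 w)%:E * (Phi (X 0 w))%:E))%E.
  apply: eq_integral => w _; rewrite -!EFinM /w1 addr0 /start_weight (counting_path0 (cpN w)) eqxx mulr1.
  rewrite /Phi /=; congr EFin; have [lB|lB] := pselect (B (lambda0 w)).
    rewrite (_ : \1_`]-oo, b] _ = 1) ?mulr1 // indicE mem_set //= in_itv /=; exact: Bb.
  by rewrite [\1_B _]indicE memNset // !mul0r !mulr0.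
apply: (le_trans le); apply: ge0_le_integral => //.
- by move=> w _; rewrite -EFinM lee_fin mulr_ge0 // Phi0.
- apply: emeasurable_funM; apply/measurable_EFinP => //.
  exact: (measurableT_comp mPhi).
- apply: measurable_funeM; apply/measurable_EFinP; apply: measurable_funM => //.
  exact: (measurableT_comp mPhi).
move=> w _; rewrite -!EFinM lee_fin (mulrA C1) ler_wpM2r ?Phi0 // /w2.
have cC : c <= C1.
  rewrite /c /C1 ler_wpM2l // lerXn2r ?nnegrE ?expR_ge0 // ler_expR ler_wpM2l //; exact: ltW.
apply: ler_pM => //; first by rewrite mulr_ge0.
have /andP[_ w1'] := start_weight01 lambda0 N b h w.
rewrite /tail; case: eqP => [Nn|_]; last by rewrite mul0r.
have -> : (n <= N (s + eta) w)%N.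
  by rewrite -Nn; apply: (counting_path_le (cpN w)) => //; rewrite lerD2l.
by rewrite mul1r.
Qed.

(** For a fixed path [f] is evaluated at [h + r], and [g2] confines [h] to a set of diameter at most
    [D], so [window_integral_le] applies. Division by [K] makes the integrand at most
    [f (h + r)]. *)
Lemma window_functional_le w :
  (\int[mu]_(h in `]0%R, eta]) (C1%:E * (tail w * Phi (X h w))%:E) <=
   (C1 * K * (\1_B (lambda0 w) * tail w))%:E * \int[mu]_(u in `]0%R, D]) (f u)%:E)%E.
Proof.
have f0' : (0 <= \int[mu]_(u in `]0%R, D]) (f u)%:E)%E.
  by apply: integral_ge0 => u _; rewrite lee_fin.
pose c : R := C1 * K * (\1_B (lambda0 w) * tail w).
have c0 : 0 <= c.
  apply: mulr_ge0; first exact: (mulr_ge0 C10 (ltW K0)).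
  by rewrite /tail mulr_ge0.
have mXw : measurable_fun setT (fun h => X h w).
  apply: (@measurableT_comp _ _ _ _ _ _ (fun x : T * R => X x.2 x.1) _ (fun h => (w, h))).
    exact: measurable_shifted_hist_joint.
  exact: measurable_fun_pair.
have tX h i : tnth (X h w).2 i = jump_time N i.+1 w - h.
  by rewrite tnth_mktuple ltn_ord.
pose r := s - jump_time N n w.
pose F0 (h : R) : R := \1_`]0, eta] h * (f (h + r) * (g2 (X h w).2 / K)).
have mF0 : measurable_fun setT F0.
  apply: measurable_funM; first exact: measurable_indic.
  apply: measurable_funM.
    by apply: (measurableT_comp mf); exact: measurable_funD.
  apply: measurable_funM => //.
  by apply: (measurableT_comp mg2); exact: (measurableT_comp measurable_snd mXw).
have F01 h : 0 <= F0 h <= f (h + r).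
  have i01 : 0 <= (\1_`]0, eta] h : R) <= 1 by rewrite indicE; case: (_ \in _); rewrite ?lexx ?ler01.
  have /andP[i0 i1] := i01.
  have g0 : 0 <= g2 (X h w).2 / K by rewrite divr_ge0 // ltW.
  have g1 : g2 (X h w).2 / K <= 1 by rewrite ler_pdivrMr // mul1r.
  have fg0 : 0 <= f (h + r) * (g2 (X h w).2 / K) by exact: mulr_ge0.
  rewrite /F0 mulr_ge0 //= -[leRHS]mul1r ler_pM // -[leRHS]mulr1 ler_wpM2l //.
have diam h h' : F0 h != 0 -> F0 h' != 0 -> h' - h <= D.
  have gn x : F0 x != 0 -> g2 (X x w).2 != 0.
    by apply: contraNneq => gx; rewrite /F0 gx mul0r !mulr0.
  move=> /gn gh /gn gh'.
  have := @g2_supp (X h w).2 (X h' w).2 _ gh gh'; rewrite !tX.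
  rewrite (_ : jump_time N 1 w - h - _ = h' - h); last by ring.
  by apply => i; rewrite !tX; ring.
have := window_integral_le f0 f_npos f_decr mf mF0 F01 D0 diam.
move=> /(lee_wpmul2l (_ : (0 <= c%:E)%E)); rewrite lee_fin => /(_ c0); apply: le_trans.
rewrite -ge0_integralZl //; last 2 first.
- exact/measurable_EFinP.
- by move=> h _; rewrite lee_fin; have /andP[] := F01 h.
suff -> : (\int[mu]_(h in `]0%R, eta]) (C1%:E * (tail w * Phi (X h w))%:E) =
    \int[mu]_h (c%:E * (F0 h)%:E))%E by [].
rewrite [LHS]integral_mkcond; apply: eq_integral => h _; rewrite patchE /F0 indicE.
case: (h \in _); last by rewrite mul0r mule0.
rewrite -EFinM mul1r /c /Phi /= !tX (_ : s - _ = h + r); last by rewrite /r /=; ring.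
congr EFin; set x := \1_B _; set y := f _; set z := g2 _.
rewrite [RHS](_ : _ = C1 * (tail w * (x * (y * z))) * (K / K)); last by ring.
by rewrite divff ?mulr1 // gt_eqF.
Qed.

(** [A] does not depend on [h]: integrating [functional_integral_shift] over []0, eta]] produces the
    factor [eta], and Tonelli's theorem lets the integral over [h] be taken first, path by path. *)
Lemma functional_integral_average :
  (eta%:E * A <=
   (C1 * K * \int[P]_w (\1_B (lambda0 w) * (n <= N (s + eta) w)%N%:R))%:E *
     \int[mu]_(u in `]0%R, D]) (f u)%:E)%E.
Proof.
have A0 : (0 <= A)%E.
  by apply: integral_ge0 => w _; rewrite mule_ge0 // lee_fin // Phi0.
have fi0 : (0 <= \int[mu]_(u in `]0%R, D]) (f u)%:E)%E.
  by apply: integral_ge0 => u _; rewrite lee_fin.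
pose G (x : T * R) : \bar R := (C1%:E * (tail x.1 * Phi (X x.2 x.1))%:E)%E.
have mG : measurable_fun setT G.
  apply: measurable_funeM; apply/measurable_EFinP; apply: measurable_funM.
    exact: (measurableT_comp mtail measurable_fst).
  exact: (measurableT_comp mPhi measurable_shifted_hist_joint).
pose G' (x : T * R) : \bar R := ((\1_`]0, eta] x.2)%:E * G x)%E.
have mG' : measurable_fun setT G'.
  apply: emeasurable_funM => //; apply/measurable_EFinP.
  by apply: (@measurableT_comp _ _ _ _ _ _ (\1_`]0, eta] : R -> R)) => //; exact: measurable_snd.
have G0 x : (0 <= G x)%E by rewrite mule_ge0 // lee_fin // mulr_ge0 // Phi0.
have G'0 x : (0 <= G' x)%E by rewrite mule_ge0 // lee_fin.
have -> : (eta%:E * A = \int[mu]_(h in `]0%R, eta]) A)%E.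
  have := integral_cst mu (measurable_itv `]0, eta]) A; rewrite /cst => E; rewrite [RHS]E.
  rewrite muleC; congr (_ * _)%E; apply: esym.
  have : mu `]0, eta]%classic = eta%:E by rewrite lebesgue_measure_itv /= lte_fin eta0 sube0.
  exact.
apply: (@le_trans _ _ (\int[mu]_h \int[P]_w G' (w, h))%E).
  rewrite integral_mkcond; apply: ge0_le_integral => //.
  - by move=> h _; apply: erestrict_ge0.
  - by apply/(measurable_restrictT _ _).1.
  - exact: (measurable_fun_fubini_tonelli_G (m1 := P) G').
  move=> h _; rewrite patchE; case: ifPn => [|_]; last first.
    by apply: integral_ge0 => w _.
  move=> hI; rewrite /G' /= indicE hI; under eq_integral do rewrite mul1e.
  by move: hI; rewrite inE /= in_itv /= => /andP[]; exact: functional_integral_shift.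
have := fubini_tonelli (m1 := P) (m2 := mu) G' mG' G'0.
rewrite /fubini_F /fubini_G => <-.
have bt : bounded_mfun (fun w => C1 * K * (\1_B (lambda0 w) * tail w)).
  apply: bounded_mfunZ; apply: bounded_mfunM.
    split; first by apply: (@measurableT_comp _ _ _ _ _ _ (\1_B : R -> R)).
    by exists 1 => w; rewrite indicE; case: (_ \in _); rewrite ?normr1 // normr0 ler01.
  by apply: bounded_mfun_bool; exact: (mcount [set m | (n <= m)%N]).
rewrite -expectZ; last first.
  apply: bounded_mfunM.
    split; first by apply: (@measurableT_comp _ _ _ _ _ _ (\1_B : R -> R)).
    by exists 1 => w; rewrite indicE; case: (_ \in _); rewrite ?normr1 // normr0 ler01.
  by apply: bounded_mfun_bool; exact: (mcount [set m | (n <= m)%N]).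
rewrite -expect_EFin // muleC -ge0_integralZl //; last 2 first.
- by apply/measurable_EFinP; case: bt.
- move=> w _; rewrite lee_fin; apply: mulr_ge0; first exact: (mulr_ge0 C10 (ltW K0)).
  by rewrite /tail mulr_ge0.
apply: ge0_le_integral => //.
- by move=> w _; apply: integral_ge0 => h _.
- exact: (measurable_fun_fubini_tonelli_F (m2 := mu) G').
- by apply: measurable_funeM; apply/measurable_EFinP; case: bt.
move=> w _; rewrite muleC; apply: le_trans (window_functional_le w).
suff -> : (\int[mu]_h G' (w, h) =
    \int[mu]_(h in `]0%R, eta]) (C1%:E * (tail w * Phi (X h w))%:E))%E by [].
rewrite [RHS]integral_mkcond; apply: eq_integral => h _.
rewrite patchE /G' /= indicE; case: (h \in _); first by rewrite mul1e.
by rewrite mul0e.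
Qed.

End averaged_shift.

(** * The null event of a jump at the final time *)

Section jump_at_final_time.
Context (R : realType) d (T : measurableType d) (P : probability T R).
Context (xi alpha beta : R) (F : R -> set (set T)).
Context (lambda0 : {RV P >-> R}) (N : R -> T -> nat).
Hypothesis xi0 : 0 < xi.
Hypothesis alpha0 : 0 <= alpha.
Hypothesis beta0 : 0 < beta.
Hypothesis hawkesN : hawkes_process xi alpha beta F lambda0 N.
Local Notation FT t := (g_sigma_algebraType (F t)).
Let cpN := hawkes_counting hawkesN.
Let mtau := measurable_jump_time hawkesN.
Let mcount := count_measurable hawkesN.

Variable p : nat.
Local Notation n := p.+1.
Local Notation X := (@shifted_hist R d T P lambda0 N n n).

Variables (b s : R).
Hypothesis b0 : 0 <= b.
Hypothesis s0 : 0 <= s.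

Let bad := [set w | [/\ lambda0 w <= b, N s w = n & jump_time N n w = s]].

(** By [first_jump_expect] the time of jump [n] has a density; the indicator of the single time [s]
    is taken as test function. *)
Lemma jump_at_final_time_null : P.-negligible bad.
Proof.
have mwt := start_weight_measurable hawkesN b (lexx 0).
have wt01 := start_weight01 lambda0 N b 0.
have wtb := @start_weight_supp R d T P lambda0 N b 0.
have kn u : 0 <= u -> measurable_fun (T := FT u) [set w | N u w = p] (start_weight lambda0 N b 0).
  by move=> u0; apply: measurable_funTS; exact: (start_weight_adapted hawkesN).
have mY : measurable_fun setT (lambda0 : T -> R) by [].
have kY u : 0 <= u -> measurable_fun (T := FT u) [set w | N u w = p] (lambda0 : T -> R).
  by move=> u0; apply: measurable_funTS; exact: (lambda0_adapted hawkesN).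
pose psi (x : R * R) : R := \1_[set s] x.2.
have mpsi : measurable_fun setT psi.
  by apply: (@measurableT_comp _ _ _ _ _ _ (\1_[set s] : R -> R)) => //; exact: measurable_snd.
have psi1 x : psi x <= 1 by rewrite /psi indicE; case: (_ \in _).
have psi0 x : 0 <= psi x by [].
have := first_jump_expect xi0 alpha0 beta0 hawkesN b0 (lexx 0) s0 mwt wt01 wtb kn mY kY
  mpsi psi0 psi1.
set D := jump_density _ _ _ _ _ _ _ _ _.
have mD : measurable_fun setT D.
  exact: (measurable_jump_density xi0 alpha0 hawkesN p mwt wt01 mY mpsi psi0).
rewrite -integral_itv_bndo_bndc; last exact/measurable_EFinP/measurable_funTS.
rewrite integral0_eq; last first.
  move=> u /=; rewrite in_itv /= => /andP[_ us]; congr EFin.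
  rewrite /D /jump_density (@eq_Rintegral _ _ _ P _ (cst 0)) ?expect_cst // => w _.
  by rewrite /psi /= indicE memNset ?mulr0 // => us'; move: us; rewrite us' ltxx.
set f := fun w => _; move=> E.
have bf : bounded_mfun f.
  apply: bounded_mfunM; last first.
    split; first by apply: (measurableT_comp mpsi); exact: measurable_fun_pair.
    by exists 1 => w; rewrite ger0_norm.
  apply: bounded_mfunM.
    by split => //; exists 1 => w; have /andP[? ?] := wt01 w; rewrite ger0_norm.
  apply: bounded_mfun_bool.
  rewrite (_ : [set w | _] = [set w | (N 0 w <= p)%N] `&` [set w | (p < N s w)%N]).
    by apply: measurableI; [exact: (mcount [set n | (n <= p)%N])|exact: (mcount [set n | (p < n)%N])].
  by apply/seteqP; split => w /= /andP.
have f0 w : 0 <= f w.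
  by have /andP[? _] := wt01 w; rewrite /f !mulr_ge0.
have /ae_eq_integral_abs : measurable_fun setT (EFin \o f).
  by apply/measurable_EFinP; case: bf.
move=> /(_ P measurableT) [+ _]; rewrite (_ : (\int[P]_(x in _) _)%E = 0); last first.
  rewrite -E -expect_EFin //; apply: eq_integral => w _.
  by rewrite /= ger0_norm.
move=> /(_ erefl); apply: negligibleS => w /= [lb Nn Tn] /(_ I) /eqP.
rewrite /f /start_weight (counting_path0 (cpN w)) Nn /= ltnSn /psi /= !indicE !mem_set //=.
by rewrite !mulr1 eqe oner_eq0.
Qed.

Variable B : set R.
Hypothesis mB : measurable B.
Hypothesis Bb : forall y, B y -> y <= b.

Variable f1 : R -> R.
Hypothesis f1_ge0 : forall u, 0 < u -> 0 <= f1 u.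
Hypothesis f1_decr : forall u v, 0 < u -> u <= v -> f1 v <= f1 u.
Variable f2 : forall q : nat, q.-tuple R -> R.
Arguments f2 : clear implicits.
Hypothesis f2_meas : measurable_fun [set t : n.-tuple R | nonneg_tuple t] (f2 n).
Hypothesis f2_ge0 : forall t : n.-tuple R, nonneg_tuple t -> 0 <= f2 n t.

Local Notation f := (pos_part_fun f1).
Local Notation g2 := (diff_functional (f2 n)).

Lemma jump_tuple_diff w : jump_tuple N n w = diff_tuple (X 0 w).2.
Proof.
by apply: eq_from_tnth => i; rewrite !tnth_mktuple /= ltn_ord !subr0.
Qed.

Lemma jump_tuple_nonneg w : N s w = n -> nonneg_tuple (jump_tuple N n w).
Proof.
move=> Nn i; rewrite tnth_mktuple; case: ifP => _; first exact: jump_time_nneg.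
rewrite subr_ge0; apply: (jump_time_homo (cpN w) s0) => //.
by rewrite Nn ltn_ord.
Qed.

Lemma integral_last_jump_functional :
  (\int[P]_(w in lambda0 @^-1` B) (last_jump_functional f1 f2 N n s w)%:E =
   functional_integral lambda0 N B s f g2)%E.
Proof.
have m1 : measurable (lambda0 @^-1` B).
  by rewrite -[X in measurable X]setTI; exact: measurable_funP.
have mf := measurable_pos_part_fun f1_decr.
have mg := measurable_diff_functional f2_meas.
pose h1 w : R := (N s w == n)%:R * (f (s - jump_time N n w) * g2 (X 0 w).2).
(* [h2] carries the paths whose last jump is exactly at [s], where the functional involves
   [f1 0]. *)
pose h2 w : R := (N s w == n)%:R * (f1 0 * \1_[set s] (jump_time N n w) * g2 (X 0 w).2).
have mN : measurable_fun setT (fun w => (N s w == n)%:R : R).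
  apply: measurable_bool_nat; have := mcount [set m | m = n] s0.
  by congr measurable; apply/seteqP; split => w /= /eqP.
have mX : measurable_fun setT (fun w => g2 (X 0 w).2).
  apply: (measurableT_comp mg).
  exact: (measurableT_comp measurable_snd (measurable_shifted_hist hawkesN _ _)).
have mh1 : measurable_fun setT h1.
  apply: measurable_funM => //; apply: measurable_funM => //.
  by apply: (measurableT_comp mf); exact: measurable_funB.
have mh2 : measurable_fun setT h2.
  apply: measurable_funM => //; apply: measurable_funM => //; apply: measurable_funM => //.
  by apply: (@measurableT_comp _ _ _ _ _ _ (\1_[set s] : R -> R)).
have E w : last_jump_functional f1 f2 N n s w = h1 w + h2 w.
  rewrite /last_jump_functional /h1 /h2; case: eqP => [Nn|_]; last by rewrite mulr0 !mul0r addr0.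
  rewrite !mul1r mulr1 -mulrDl; congr (_ * _).
    have Ts : jump_time N n w <= s by apply: jump_time_le; rewrite ?Nn.
    rewrite indicE /pos_part_fun subr_gt0; move: Ts; rewrite le_eqVlt => /orP[/eqP ->|Ts].
      by rewrite ltxx mem_set // mulr1 add0r subrr.
    by rewrite Ts memNset ?mulr0 ?addr0 //= => Ts'; move: Ts; rewrite Ts' ltxx.
  rewrite jump_tuple_diff /diff_functional patchE mem_set //=.
  by rewrite -jump_tuple_diff; exact: jump_tuple_nonneg.
rewrite (@ae_eq_integral _ _ _ P (lambda0 @^-1` B) (EFin \o h1)) //; last 3 first.
- apply: measurable_funTS; apply/measurable_EFinP.
  rewrite (_ : last_jump_functional f1 f2 N n s = fun w => h1 w + h2 w); last exact/funext.
  exact: measurable_funD.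
- by apply: measurable_funTS; exact/measurable_EFinP.
- apply: (negligibleS _ jump_at_final_time_null) => w /= /not_implyP[Bl]; rewrite E => ne.
  split; first exact: Bb.
    apply/eqP/negP => /negP Nn; apply: ne.
    by rewrite /h2 (negbTE Nn) mul0r addr0.
  apply/eqP/negP => /negP Ts; apply: ne.
  by rewrite /h2 indicE memNset ?mulr0 ?mul0r ?mulr0 ?addr0 //=; exact/eqP.
rewrite integral_mkcond; apply: eq_integral => w _.
rewrite patchE -EFinM /state_functional /= indicE.
rewrite (_ : (w \in lambda0 @^-1` B) = (lambda0 w \in B)); last by apply/idP/idP; rewrite !inE.
case: (lambda0 w \in B); last by rewrite mul0r mulr0.
by rewrite mul1r /h1 tnth_mktuple /= ltnSn subr0.
Qed.

End jump_at_final_time.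

Lemma geometric_sum_le (R : realFieldType) (r : R) (m : nat) : 0 <= r -> r < 1 ->
  \sum_(1 <= q < m) r ^+ q <= (1 - r)^-1.
Proof.
move=> r0 r1; have r1' : 0 < 1 - r by rewrite subr_gt0.
have rm : 0 <= r ^+ m by rewrite exprn_ge0.
suff : (\sum_(1 <= q < m) r ^+ q) * (1 - r) + r ^+ m <= 1.
  move=> h; rewrite -[leRHS]mul1r ler_pdivlMr //.
  by apply: le_trans h; rewrite lerDl.
elim: m {rm} => [|[|m] IH]; first by rewrite big_geq // mul0r add0r expr0.
  by rewrite big_geq // mul0r add0r expr1 ltW.
rewrite big_nat_recr //= mulrDl -addrA [r ^+ m.+2]exprSr (mulrBr (r ^+ m.+1)) mulr1 subrK.
exact: IH.
Qed.

(** * Geometric decay in the number of jumps *)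

Section level_bound.
Context (R : realType) d (T : measurableType d) (P : probability T R).
Context (xi alpha beta : R) (F : R -> set (set T)).
Context (lambda0 : {RV P >-> R}) (N : R -> T -> nat).
Hypothesis xi0 : 0 < xi.
Hypothesis alpha0 : 0 <= alpha.
Hypothesis beta0 : 0 < beta.
Hypothesis hawkesN : hawkes_process xi alpha beta F lambda0 N.

Local Notation mu := (@lebesgue_measure R).

Variable p : nat.
Local Notation n := p.+1.
Variables (b eps kap th eta s : R) (B : set R).
Hypothesis b0 : 0 <= b.
Hypothesis mB : measurable B.
Hypothesis Bb : forall y, B y -> y <= b.
Hypothesis kap0 : 0 < kap.
Hypothesis th0 : 0 < th.
Hypothesis kap_eps : kap * beta * xi <= eps.
Hypothesis th_kap : expR (th + kap * alpha) - 1 <= kap * beta.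
Hypothesis eta0 : 0 < eta.
Hypothesis eta_th : beta * eta <= th / 2.
Hypothesis aeta : alpha * eta <= 2^-1.
Hypothesis b_eta : 4 * b * eta <= 1.
Hypothesis s0 : 0 <= s.

Variable f1 : R -> R.
Hypothesis f1_ge0 : forall u, 0 < u -> 0 <= f1 u.
Hypothesis f1_decr : forall u v, 0 < u -> u <= v -> f1 v <= f1 u.
Hypothesis f1_int : exists2 delta, 0 < delta & mu.-integrable `]0, delta[ (EFin \o f1).
Variable f2 : forall q : nat, q.-tuple R -> R.
Arguments f2 : clear implicits.
Hypothesis f2_meas : measurable_fun [set t : n.-tuple R | nonneg_tuple t] (f2 n).
Hypothesis f2_ge0 : forall t : n.-tuple R, nonneg_tuple t -> 0 <= f2 n t.
Variables (K : R) (J : p.-tuple R -> interval R) (Jbar : R).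
Hypothesis K0 : 0 < K.
Hypothesis f2K : forall t : n.-tuple R, nonneg_tuple t -> f2 n t <= K.
Hypothesis J_length : forall t : p.-tuple R, nonneg_tuple t ->
  (mu [set` J t] <= Jbar%:E)%E.
Hypothesis f2_supp : forall t : n.-tuple R, nonneg_tuple t -> f2 n t != 0 ->
  head 0 t \in J (behead_tuple t).
Hypothesis Jbar0 : 0 <= Jbar.

(** The factor 2 comes from the comparison of laws, [K] bounds [f2], division by [eta] comes from
    the averaging, and the exponentials come from the moment bound at time [s + eta] and from the
    initial intensity. Neither [n] nor [s] occurs. *)
Definition level_constant : R :=
  2 * K / eta * expR (kap * beta * xi * eta) * expR (kap * b).

Lemma integral_last_jump_le :
  (\int[P]_(w in lambda0 @^-1` B) (last_jump_functional f1 f2 N n s w)%:E <=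
   (level_constant * (\int[mu]_(u in `[0%R, Jbar]) f1 u) * expR (eps * s) *
      expR (- (th / 2)) ^+ n)%:E * distribution P lambda0 B)%E.
Proof.
rewrite (integral_last_jump_functional xi0 alpha0 beta0 hawkesN b0 s0 mB Bb) //.
set f := pos_part_fun f1; set g2 := diff_functional (f2 n).
have f0 : forall u, 0 <= f u by exact: pos_part_fun_ge0.
have := functional_integral_average xi0 alpha0 beta0 hawkesN b0 mB Bb eta0 aeta b_eta s0
  f0 (pos_part_fun_npos f1) (pos_part_fun_decr f1_decr)
  (measurable_diff_functional f2_meas) (diff_functional_ge0 f2_ge0)
  (fun t => diff_functional_le t (ltW K0) f2K) K0 Jbar0
  (diff_functional_supp J_length f2_supp Jbar0).
rewrite (pos_part_fun_integral f1_ge0 f1_decr Jbar0 f1_int).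
set A := functional_integral _ _ _ _ _ _; set I1 := \int[mu]_(u in _) f1 u.
have I10 : 0 <= I1.
  rewrite -lee_fin /I1 -(pos_part_fun_integral f1_ge0 f1_decr Jbar0 f1_int).
  by apply: integral_ge0 => u _; rewrite lee_fin.
have seta0 : 0 <= s + eta by rewrite addr_ge0 // ltW.
have := count_tail_le xi0 alpha0 beta0 hawkesN n b0 (ltW th0) (ltW kap0) th_kap mB Bb seta0.
set E1 := \int[P]_w (_ * _); set PB := \int[P]_w \1_B _ => tail avg.
have PB0 : 0 <= PB by apply: expect_ge0.
have -> : distribution P lambda0 B = PB%:E.
  rewrite /PB -expect_EFin; last first.
    split; first by apply: (@measurableT_comp _ _ _ _ _ _ (\1_B : R -> R)).
    by exists 1 => w; rewrite indicE; case: (_ \in _); rewrite ?normr1 // normr0 ler01.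
  have m1 : measurable (lambda0 @^-1` B).
    by rewrite -[X in measurable X]setTI; exact: measurable_funP.
  transitivity (P (lambda0 @^-1` B)) => //.
  rewrite -[X in P X]setIT -integral_indic //; apply: eq_integral => w _; congr EFin.
have -> : A = ((eta^-1)%:E * (eta%:E * A))%E.
  by rewrite muleA -EFinM mulVf ?mul1e // gt_eqF.
have ie0 : (0 <= (eta^-1)%:E)%E by rewrite lee_fin invr_ge0 ltW.
apply: (le_trans (lee_wpmul2l ie0 avg)).
rewrite -!EFinM lee_fin.
have C10 : 0 <= 2 * expR (beta * eta) ^+ n * K * I1 / eta.
  by rewrite divr_ge0 ?(ltW eta0) // !mulr_ge0 ?exprn_ge0 ?expR_ge0 // ltW.
rewrite (_ : eta^-1 * _ = 2 * expR (beta * eta) ^+ n * K * I1 / eta * E1); last by ring.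
apply: (le_trans (ler_wpM2l C10 tail)).
(* The shift costs [beta * eta <= th / 2] per jump in the exponent, at most half of what the tail
   bound gains. *)
have e1 : expR (beta * eta) ^+ n * expR (- th * n%:R) <= expR (- (th / 2)) ^+ n.
  rewrite -!expRM_natr -expRD ler_expR mulNr mulNr -mulrBl.
  by rewrite -mulNr ler_wpM2r //; move: eta_th; lra.
have e2 : expR (kap * beta * xi * (s + eta)) <=
    expR (kap * beta * xi * eta) * expR (eps * s).
  by rewrite -expRD ler_expR mulrDr addrC lerD2l ler_wpM2r.
set x := expR (beta * eta) ^+ n in e1 *; set y := expR (- th * n%:R) in e1 *.
set z := expR (kap * beta * xi * (s + eta)) in e2 *.
rewrite (_ : _ * (y * _) = (2 * K / eta * expR (kap * b) * PB * I1) * ((x * y) * z)); last by ring.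
set v := expR (- (th / 2)) ^+ n in e1 *.
rewrite /level_constant; set c := expR (kap * beta * xi * eta) in e2 *.
rewrite [leRHS](_ : _ = (2 * K / eta * expR (kap * b) * PB * I1) * (v * (c * expR (eps * s)))); last by ring.
apply: ler_wpM2l.
  by rewrite !mulr_ge0 ?invr_ge0 ?expR_ge0 // ltW.
by apply: ler_pM => //; rewrite ?mulr_ge0 ?exprn_ge0 ?expR_ge0.
Qed.

End level_bound.

Theorem theorem5p1 (R : realType) (xi alpha beta : R)
  (hxi : 0 < xi) (halpha : 0 <= alpha) (hbeta : 0 < beta)
  (hsub : alpha / beta < 1)
  (f1 : R -> R)
  (f1_ge0 : forall u, 0 < u -> 0 <= f1 u)
  (f1_decr : forall u v, 0 < u -> u <= v -> f1 v <= f1 u)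
  (f1_int : exists2 delta, 0 < delta &
     lebesgue_measure.-integrable `]0, delta[ (EFin \o f1))
  (f2 : forall q : nat, q.-tuple R -> R)
  (J : forall q : nat, q.-1.-tuple R -> interval R)
  (Jbar : R)
  (f2_meas : forall q : nat, (0 < q)%N ->
     measurable_fun [set t : q.-tuple R | nonneg_tuple t] (f2 q))
  (f2_ge0 : forall (q : nat) (t : q.-tuple R), (0 < q)%N ->
     nonneg_tuple t -> 0 <= f2 q t)
  (f2_bounded : exists K : R, forall (q : nat) (t : q.-tuple R), (0 < q)%N ->
     nonneg_tuple t -> f2 q t <= K)
  (J_nonneg : forall (q : nat) (t : q.-1.-tuple R), (0 < q)%N ->
     nonneg_tuple t -> [set` J q t] `<=` [set x | 0 <= x])
  (J_length : forall (q : nat) (t : q.-1.-tuple R), (0 < q)%N ->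
     nonneg_tuple t -> (lebesgue_measure [set` J q t] <= Jbar%:E)%E)
  (f2_supp : forall (q : nat) (t : q.-tuple R), (0 < q)%N ->
     nonneg_tuple t -> f2 q t != 0 -> head 0 t \in J q (behead_tuple t)) :
  forall eps : R, 0 < eps -> forall a b : R,
  exists2 C : R, 0 < C &
  forall (d : measure_display) (T : measurableType d) (P : probability T R)
    (F : R -> set (set T)) (lambda0 : {RV P >-> R}) (N : R -> T -> nat),
  hawkes_process xi alpha beta F lambda0 N ->
  forall s : R, 0 <= s ->
  forall g : nat -> R -> \bar R,
  (forall q : nat, (0 < q)%N ->
     cond_expectation_given
       (fun w => (last_jump_functional f1 f2 N q s w)%:E) lambda0 (g q)) ->
  {ae distribution P lambda0, forall y0 : R, y0 \in `[a, b] ->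
     (\sum_(1 <= q <oo) g q y0
       <= (C * (\int[lebesgue_measure]_(u in `[0%R, Jbar]) f1 u)
             * expR (eps * s))%:E)%E}.
Proof.
move=> eps eps0 a b1.
(* For [q = 1] the interval depends on the empty tuple only, so [Jbar] bounds an actual length. *)
have Jbar0 : 0 <= Jbar.
  have t0 : nonneg_tuple ([tuple] : 0.-tuple R) by case.
  by rewrite -lee_fin; apply: le_trans (@J_length 1%N [tuple] isT t0); exact: measure_ge0.
have [K0 f2K0] := f2_bounded.
(* The bound on [f2] is made positive, since it is divided by. *)
pose K := Num.max K0 1.
have K_gt0 : 0 < K by rewrite lt_max ltr01 orbT.
have f2K (q : nat) (t : q.-tuple R) : (0 < q)%N -> nonneg_tuple t -> f2 q t <= K.
  by move=> q0 t0; rewrite (le_trans (f2K0 q t q0 t0)) // le_max lexx.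
(* The upper end of the compact interval, made nonnegative; the exponents and the constant depend on
   the initial intensity only through it, whence the uniformity in [y0]. *)
pose b := Num.max b1 0.
have b0 : 0 <= b by rewrite le_max lexx orbT.
have ab : alpha < beta by move: hsub; rewrite ltr_pdivrMr // mul1r.
have [kap [th [eta [kap0 th0 kap_eps th_kap [eta0 eta_th aeta b_eta]]]]] :=
  subcritical_exponents hxi halpha ab eps0 b0.
pose r := expR (- (th / 2)).
have r0 : 0 < r by exact: expR_gt0.
have r1 : r < 1 by rewrite -[ltRHS]expR0 ltr_expR oppr_lt0 divr_gt0.
have r1' : 0 < 1 - r by rewrite subr_gt0.
pose C0 := level_constant xi beta b kap eta K.
have C00 : 0 < C0.
  by rewrite /C0 /level_constant !mulr_gt0 ?expR_gt0 // invr_gt0.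
(* The constant is fixed before the probability space, the process and [s]; the denominator comes
   from the geometric series over [q]. *)
exists (C0 / (1 - r)); first by rewrite divr_gt0.
move=> d T P F lambda0 N hawkesN s s0 g hg.
pose I1 : R := \int[lebesgue_measure]_(u in `[0%R, Jbar]) f1 u.
have I10 : 0 <= I1.
  rewrite -lee_fin /I1 -(pos_part_fun_integral f1_ge0 f1_decr Jbar0 f1_int).
  by apply: integral_ge0 => u _; rewrite lee_fin; exact: pos_part_fun_ge0.
pose c := C0 * I1 * expR (eps * s).
have c0 : 0 <= c.
  by apply: mulr_ge0 (expR_ge0 _); apply: mulr_ge0 I10; exact: ltW.
have mab : measurable (`[a, b1]%classic : set R) by exact: measurable_itv.
(* For each number of jumps, the bounds over all events [lambda0 \in B] with [B] inside the compact
   interval give an almost sure bound on the version [g]; the countably many exceptional sets are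
   united afterwards. *)
have bound p : {ae distribution P lambda0, forall y : R, `[a, b1]%classic y ->
    (g p.+1 y <= (c * r ^+ p.+1)%:E)%E}.
  have [mg g0 gE] := hg p.+1 (ltn0Sn p).
  apply: ae_le_of_integral => // [|B mB Bab].
    by rewrite mulr_ge0 // exprn_ge0 // ltW.
  have Bb y : B y -> y <= b.
    by move=> /Bab /=; rewrite in_itv /= => /andP[_ yb]; rewrite le_max yb.
  rewrite gE //.
  exact: (integral_last_jump_le hxi halpha hbeta hawkesN b0 mB Bb kap0 th0 kap_eps th_kap
    eta0 eta_th aeta b_eta s0 f1_ge0 f1_decr f1_int (@f2_meas p.+1 (ltn0Sn p))
    (fun t => @f2_ge0 p.+1 t (ltn0Sn p)) K_gt0 (fun t => f2K p.+1 t (ltn0Sn p))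
    (fun t => @J_length p.+1 t (ltn0Sn p)) (fun t => @f2_supp p.+1 t (ltn0Sn p)) Jbar0).
apply: filterS (ae_foralln bound) => y H yab.
have gy q : (0 < q)%N -> (0 <= g q y)%E by move=> q0; have [] := hg q q0.
apply: lime_le.
  by apply: is_cvg_nneseries => q q1 _; exact: gy.
apply: nearW => m.
apply: (@le_trans _ _ (\sum_(1 <= q < m) (c * r ^+ q)%:E)%E).
  rewrite big_nat_cond [leRHS]big_nat_cond; apply: lee_sum => q /andP[/andP[q1 _] _].
  by have := H q.-1 yab; rewrite prednK.
rewrite sumEFin lee_fin -mulr_sumr -/I1 [leRHS](_ : _ = c * (1 - r)^-1); last by rewrite /c; ring.
by rewrite ler_wpM2l // geometric_sum_le // ltW.
Qed.
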